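(* Let $\Delta: S(K)\to S(Y)$ be a surjective isometry, where $K$ is an elementary JB$^*$-triple and $Y$ is a real Banach space. Let $\mathcal{C}\subset S(K)$ be a non-empty convex subset. Then $\Delta|_{\mathcal{C}}$ is an affine mapping, i.e. $\Delta(tx+(1-t)y)=t\Delta(x)+(1-t)\Delta(y)$ for all $x,y\in\mathcal{C}$ and $t\in[0,1]$.
   Context: $S(X)$ denotes the unit sphere of a Banach space $X$. An isometry is a distance-preserving map; no linearity of $\Delta$ is assumed. A JB$^*$-triple is a complex Banach space $E$ with a continuous triple product $\{\cdot,\cdot,\cdot\}:E\times E\times E\to E$, bilinear and symmetric in the outer variables and conjugate linear in the middle one, such that, writing $L(a,b)(z)=\{a,b,z\}$: (a) $L(a,b)L(x,y)-L(x,y)L(a,b)=L(L(a,b)x,y)-L(x,L(b,a)y)$; (b) $L(a,a)$ is a hermitian operator with non-negative spectrum; (c) $\|\{a,a,a\}\|=\|a\|^3$. Elementary JB$^*$-triples are the following six types. Type 1: $K(H_1,H_2)$, the compact linear operators between complex Hilbert spaces. Types 2 and 3: for a complex Hilbert space $H$ with a conjugation $j$ and $x^t:=jx^*j$, the spaces $\{x\in K(H): x^t=-x\}$ (type 2) and $\{x\in K(H): x^t=x\}$ (type 3). In types 1--3 the norm is the operator norm and $\{a,b,c\}=\frac12(ab^*c+cb^*a)$. Type 4 (spin factor): a complex Hilbert space of dimension $\ge 3$ with conjugation $x\mapsto\overline{x}$, triple product $\{a,b,c\}=\langle a,b\rangle c+\langle c,b\rangle a-\langle a,\overline{c}\rangle\overline{b}$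 and norm $\|x\|^2=\langle x,x\rangle+\sqrt{\langle x,x\rangle^2-|\langle x,\overline{x}\rangle|^2}$. Type 6: the finite dimensional exceptional JB$^*$-algebra $H_3(\mathbb{O}^{\mathbb{C}})$ of $3\times 3$ hermitian matrices over the complex octonions (the JB$^*$-algebra whose self-adjoint part is the JB-algebra $H_3(\mathbb{O})$), with $\{a,b,c\}=(a\circ b^* )\circ c+(c\circ b^* )\circ a-(a\circ c)\circ b^*$. Type 5: the finite dimensional subtriple $M_{1,2}(\mathbb{O}^{\mathbb{C}})$ of $1\times2$ matrices over the complex octonions, realized as the Peirce-1 subspace $\{x : \{p,p,x\}=\frac12 x\}$ of a minimal projection $p$ in the type 6 factor. *)

(* Defs.v *)
From HB Require Import structures.
From mathcomp Require Import all_boot all_order all_algebra.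
From mathcomp Require Import all_classical all_reals all_analysis.
From mathcomp Require Import complex.

Set Implicit Arguments.
Unset Strict Implicit.
Unset Printing Implicit Defensive.

Import Order.TTheory GRing.Theory Num.Theory.
Import numFieldNormedType.Exports.

Local Open Scope classical_set_scope.
Local Open Scope ring_scope.
Local Open Scope complex_scope.

(* A normed module over R[i] has an R[i]-valued norm (whose values are real);
   this is the same norm with values in R. *)
Definition cnorm (R : realType) (E : normedModType R[i]) (x : E) : R :=
  complex.Re `|x|.

Definition unit_sphere (F : numFieldType) (E : normedModType F) : set E :=
  [set x | `|x| = 1].
Arguments unit_sphere {F} E.

Section Operators.
Variables (R : realType) (E : completeNormedModType R[i]).
Implicit Types T : E -> E.

Definition op_exp T : E -> E :=
  fun x => limn (series (fun n => (n`!%:R : R[i])^-1 *: iter n T x)).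

(* T is hermitian when exp(itT) is isometric for every real t. *)
Definition hermitian_op T : Prop :=
  forall (t : R) (x : E), `|op_exp (fun y => (0 +i* t) *: T y) x| = `|x|.

(* Spectrum of T in the algebra of bounded linear operators on E. *)
Definition op_spectrum T : set R[i] :=
  [set l | ~ exists S : E -> E,
      [/\ linear S, continuous S,
          forall x, S (T x - l *: x) = x & forall x, T (S x) - l *: S x = x]].

(* In R[i], 0 <= l means that l is a nonnegative real number. *)
Definition nonneg_spectrum T : Prop := forall l, op_spectrum T l -> 0 <= l.

End Operators.

Record jbstar_triple (R : realType) := JBStarTriple {
  jb_space :> completeNormedModType R[i];
  triple : jb_space -> jb_space -> jb_space -> jb_space;
  triple_linear : forall b c, linear (fun a => triple a b c);
  triple_sym : forall a b c, triple a b c = triple c b a;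
  triple_conj_linear : forall a c (k : R[i]) x y,
    triple a (k *: x + y) c = k^* *: triple a x c + triple a y c;
  triple_continuous :
    continuous (fun u : jb_space * jb_space * jb_space =>
                  triple u.1.1 u.1.2 u.2);
  triple_jordan : forall a b x y z,
    triple a b (triple x y z) - triple x y (triple a b z) =
    triple (triple a b x) y z - triple x (triple b a y) z;
  triple_hermitian : forall a, hermitian_op (triple a a);
  triple_nonneg : forall a, nonneg_spectrum (triple a a);
  triple_norm : forall a, `|triple a a a| = `|a| ^+ 3 }.

Record hilbert_space (R : realType) := HilbertSpace {
  hilbert_sort :> completeNormedModType R[i];
  inner : {dot hilbert_sort for Num.conj};
  inner_norm : forall x, inner x x = `|x| ^+ 2 }.

Section HilbertOperators.
Variable R : realType.
Implicit Types H : hilbert_space R.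

Definition op_norm H1 H2 (f : H1 -> H2) : R :=
  sup [set cnorm (f x) | x in [set x : H1 | `|x| <= 1]].

(* For a bounded linear f, the vector chosen exists and is unique. *)
Definition adjoint H1 H2 (f : H1 -> H2) : H2 -> H1 :=
  fun y => xget 0 [set z | forall x, inner H2 (f x) y = inner H1 x z].

Definition compact_op H1 H2 : set (H1 -> H2) :=
  [set f | linear f /\ precompact (f @` [set x : H1 | `|x| <= 1])].

Definition op_triple H1 H2 (a b c : H1 -> H2) : H1 -> H2 :=
  2^-1 *: ((a \o adjoint b \o c) + (c \o adjoint b \o a)).

Definition conjugation H (j : H -> H) : Prop :=
  [/\ forall (k : R[i]) x y, j (k *: x + y) = k^* *: j x + j y,
      forall x, j (j x) = x & forall x, `|j x| = `|x|].

Definition op_transpose H (j : H -> H) (x : H -> H) : H -> H :=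
  j \o adjoint x \o j.

Definition dim_ge3 H : Prop :=
  exists e : 'I_3 -> H, forall k : 'I_3 -> R[i],
    \sum_i k i *: e i = 0 -> forall i, k i = 0.

Definition spin_triple H (j : H -> H) (a b c : H) : H :=
  inner H a b *: c + inner H c b *: a - inner H a (j c) *: j b.

Definition spin_norm H (j : H -> H) (x : H) : R :=
  let q := complex.Re (inner H x x) in
  Num.sqrt (q + Num.sqrt (q ^+ 2 - complex.Re `|inner H x (j x)| ^+ 2)).

End HilbertOperators.

Section CayleyDickson.
Variables (A : zmodType) (mul : A -> A -> A) (inv : A -> A).

Definition cd_mul (x y : A * A) : A * A :=
  (mul x.1 y.1 - mul (inv y.2) x.2, mul y.2 x.1 + mul x.2 (inv y.1)).

Definition cd_inv (x : A * A) : A * A := (inv x.1, - x.2).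

End CayleyDickson.

Section Exceptional.
Variable R : realType.

(* Three Cayley-Dickson doublings; starting from R they give the octonions, and
   starting from R[i] with the identity as involution they give their
   complexification. *)
Definition coct : lmodType R[i] :=
  (((R[i] * R[i]) * (R[i] * R[i])) * ((R[i] * R[i]) * (R[i] * R[i])))%type.

Definition coct_mul : coct -> coct -> coct :=
  cd_mul (cd_mul (cd_mul *%R id) (cd_inv id)) (cd_inv (cd_inv id)).

(* The R[i]-linear extension of the conjugation of the octonions. *)
Definition coct_conj : coct -> coct := cd_inv (cd_inv (cd_inv id)).

(* The conjugate-linear map of coct fixing the real octonions. *)
Definition coct_bar (x : coct) : coct :=
  let q (y : (R[i] * R[i]) * (R[i] * R[i])) :=
    (((y.1.1)^*, (y.1.2)^*), ((y.2.1)^*, (y.2.2)^*)) in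
  (q x.1, q x.2).

(* 3 x 3 matrices; MathComp's 'M[_]_3 is an lmodType only over the ring of its
   entries, and coct is not associative. *)
Definition coct_mx : lmodType R[i] := 'I_3 -> 'I_3 -> coct.

Implicit Types a b c p q : coct_mx.

(* Hermitian means here with respect to the linear involution coct_conj. *)
Definition H3 : set coct_mx :=
  [set a | forall i k, a k i = coct_conj (a i k)].

Definition mx_mul a b : coct_mx :=
  fun i k => \sum_l coct_mul (a i l) (b l k).

Definition jordan_mul a b : coct_mx := 2^-1 *: (mx_mul a b + mx_mul b a).

(* The involution x + iy |-> x - iy (x, y in H_3(O)) of the JB*-algebra; its
   self-adjoint elements in H3 are the hermitian matrices over the real
   octonions. *)
Definition jordan_star a : coct_mx := fun i k => coct_bar (a i k).

Definition jordan_triple a b c : coct_mx :=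
  jordan_mul (jordan_mul a (jordan_star b)) c
  + jordan_mul (jordan_mul c (jordan_star b)) a
  - jordan_mul (jordan_mul a c) (jordan_star b).

(* N is a JB*-algebra norm on H3; completeness is automatic in finite
   dimension, and such a norm exists and is unique. *)
Definition jbstar_norm (N : coct_mx -> R) : Prop :=
  [/\ [/\ forall a, H3 a -> N a = 0 -> a = 0,
          forall a b, H3 a -> H3 b -> N (a + b) <= N a + N b &
          forall (k : R[i]) a, H3 a -> N (k *: a) = complex.Re `|k| * N a],
      forall a b, H3 a -> H3 b -> N (jordan_mul a b) <= N a * N b,
      forall a, H3 a -> N (jordan_star a) = N a &
      forall a, H3 a -> N (jordan_triple a a a) = N a ^+ 3].

Definition projection : set coct_mx :=
  [set p | [/\ H3 p, jordan_star p = p & jordan_mul p p = p]].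

(* For projections, q <= p means jordan_mul p q = q. *)
Definition minimal_projection p : Prop :=
  [/\ projection p, p <> 0 &
      forall q, projection q -> jordan_mul p q = q -> q = 0 \/ q = p].

Definition peirce1 p : set coct_mx :=
  [set x | H3 x /\ jordan_triple p p x = 2^-1 *: x].

End Exceptional.

(* E is, up to a linear isometric triple isomorphism, the subspace A of V with
   norm N and triple product tp. *)
Definition realized_as (R : realType) (E : jbstar_triple R) (V : lmodType R[i])
    (A : set V) (N : V -> R) (tp : V -> V -> V -> V) : Prop :=
  exists Phi : {linear E -> V},
    [/\ set_bij setT A Phi,
        forall x, cnorm x = N (Phi x) &
        forall a b c, Phi (triple a b c) = tp (Phi a) (Phi b) (Phi c)].

Inductive elementary (R : realType) (E : jbstar_triple R) : Prop :=
| Type1 (H1 H2 : hilbert_space R) of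
    realized_as E (@compact_op R H1 H2) (@op_norm R H1 H2) (@op_triple R H1 H2)
| Type2 (H : hilbert_space R) (j : H -> H) of conjugation j &
    realized_as E [set x | compact_op x /\ op_transpose j x = - x]
      (@op_norm R H H) (@op_triple R H H)
| Type3 (H : hilbert_space R) (j : H -> H) of conjugation j &
    realized_as E [set x | compact_op x /\ op_transpose j x = x]
      (@op_norm R H H) (@op_triple R H H)
| Type4 (H : hilbert_space R) (j : H -> H) of dim_ge3 H & conjugation j &
    realized_as E setT (spin_norm j) (spin_triple j)
| Type5 (N : coct_mx R -> R) (p : coct_mx R) of
    jbstar_norm N & minimal_projection p &
    realized_as E (peirce1 p) N (@jordan_triple R)
| Type6 (N : coct_mx R -> R) of jbstar_norm N &
    realized_as E (@H3 R) N (@jordan_triple R).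

(* Main.v *)
(* Two points of C lie in a maximal convex subset F of the unit sphere, and the
   stars {z : |u + z| = 2} show that Delta F is convex too. So it suffices to see
   that an isometry T of F onto a convex set is affine. Let m be the preimage of
   the midpoint of T(a + d) and T(a - d). Convexity of the norm on the side of Y
   gives |m - z| <= (|a + d - z| + |a - d - z|) / 2 for all z in F, which forces
   m = a as soon as d is a multiple of a tripotent: z = a +- d makes m - a
   orthogonal to d, and then z = a - c (m - a) gives m = a. The same test, applied
   to the parallelogram spanned by two such directions d and d', removes the mixed
   term of the biaffine map (s, t) |-> T(a + s d + t d'). Hence T is affine along
   every finite sum of multiples of tripotents.
   For compact operators F is e + B where e is a minimal tripotent and B is the
   unit ball of the operators orthogonal to e, in which finite rank operators are
   dense. In finite dimension (types 5 and 6) the extreme points of the unit ball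
   of the span of F - F play the role of the tripotents, and in a spin factor F is
   a euclidean disc. *)

(* In general neither norm is strictly convex, so a metric midpoint is not unique, and nothing
   relates [Delta (- x)] to [- Delta x]. Hence two stages: the midpoint of two image points is shown
   to be an image point by measuring its distance to the points [Delta (- c)]; its preimage is then
   located by the geometry of [F]. Locating it needs room inside [F], and room vanishes at the
   boundary. The argument therefore runs at points around which a copy of [F], shrunk by a fixed
   factor [k], still fits, with step sizes that depend on [k] and on the direction but not on the
   point. This uniformity allows a whole segment to be cut into finitely many equal steps; arbitrary
   points of [F] are reached by shrinking towards a centre [a0]. [Y] and [Delta] carry no complex
   structure, so all of this happens over the reals. *)
Require Import Defs.
From HB Require Import structures.
From mathcomp Require Import all_boot all_order all_algebra.
From mathcomp Require Import all_classical all_reals all_analysis.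
From mathcomp Require Import complex.
From mathcomp Require Import ring lra.

Set Implicit Arguments.
Unset Strict Implicit.
Unset Printing Implicit Defensive.

Import Order.TTheory GRing.Theory Num.Theory.
Import numFieldNormedType.Exports.

Local Open Scope classical_set_scope.
Local Open Scope ring_scope.
Local Open Scope complex_scope.
(* On top, so that [x^*] is [Num.conj] and not [conjc]. *)
Local Open Scope ring_scope.

(** * Identities between linear combinations *)

Section ModuleIdentities.
Variables (R : pzRingType) (V : lmodType R).

Inductive mexpr :=
  MVar of nat | MZero | MAdd of mexpr & mexpr | MOpp of mexpr
| MScale of R & mexpr.

Fixpoint meval (e : seq V) (t : mexpr) : V :=
  match t with
  | MVar i => e`_i
  | MZero => 0
  | MAdd a b => meval e a + meval e b
  | MOpp a => - meval e a
  | MScale r a => r *: meval e a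
  end.

(** [Nat.eqb] here and the fixpoint [mall] below are chosen because [cbn] computes them away,
    leaving one explicit scalar equation per vector. *)
Fixpoint mcoef (i : nat) (t : mexpr) : R :=
  match t with
  | MVar k => if Nat.eqb k i then 1 else 0
  | MZero => 0
  | MAdd a b => mcoef i a + mcoef i b
  | MOpp a => - mcoef i a
  | MScale r a => r * mcoef i a
  end.

Lemma mevalE (e : seq V) (t : mexpr) :
  meval e t = \sum_(i < size e) mcoef i t *: e`_i.
Proof.
elim: t => [k||a IHa b IHb|a IHa|r a IHa] /=.
- case: (ltnP k (size e)) => [ke|ek]; last first.
    rewrite nth_default// big1// => i _.
    case: (PeanoNat.Nat.eqb_spec k i) => [ki|]; last by rewrite scale0r.
    by rewrite ki leqNgt ltn_ord in ek.
  rewrite (bigD1 (Ordinal ke)) //= PeanoNat.Nat.eqb_refl scale1r big1 ?addr0//.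
  move=> i /eqP ik; case: (PeanoNat.Nat.eqb_spec k i) => [ki|]; last by rewrite scale0r.
  by case: ik; apply: val_inj.
- by rewrite big1// => i _; rewrite scale0r.
- by rewrite IHa IHb -big_split/=; apply: eq_bigr => i _; rewrite scalerDl.
- by rewrite IHa -sumrN; apply: eq_bigr => i _; rewrite scaleNr.
- by rewrite IHa scaler_sumr; apply: eq_bigr => i _; rewrite scalerA.
Qed.

Fixpoint mall (n : nat) (P : nat -> Prop) : Prop :=
  if n is m.+1 then mall m P /\ P m else True.

Lemma meval_eq (e : seq V) (t u : mexpr) :
  mall (size e) (fun i => mcoef i t = mcoef i u) -> meval e t = meval e u.
Proof.
move=> h; rewrite !mevalE; apply: eq_bigr => i _; congr (_ *: _).
elim: (size e) h i => [|m IH] /= h i; first by case: i.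
case: h => h1 h2; case: (unliftP ord_max i) => [j ->|->//].
by rewrite lift_max; exact: IH.
Qed.

End ModuleIdentities.

Ltac mlookup x e :=
  lazymatch e with
  | x :: _ => constr:(0%N)
  | _ :: ?t => let n := mlookup x t in constr:(S n)
  end.
Ltac minsert x e :=
  match constr:(Set) with
  | _ => let n := mlookup x e in e
  | _ => constr:(x :: e)
  end.
Ltac matoms t e :=
  lazymatch t with
  | GRing.add ?a ?b => let e := matoms a e in matoms b e
  | GRing.opp ?a => matoms a e
  | GRing.scale _ ?a => matoms a e
  | GRing.zero => e
  | _ => minsert t e
  end.
Ltac mreify R t e :=
  lazymatch t with
  | GRing.add ?a ?b =>
      let a := mreify R a e in let b := mreify R b e in constr:(@MAdd R a b)
  | GRing.opp ?a => let a := mreify R a e in constr:(@MOpp R a)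
  | GRing.scale ?r ?a => let a := mreify R a e in constr:(@MScale R r a)
  | GRing.zero => constr:(@MZero R)
  | _ => let n := mlookup t e in constr:(@MVar R n)
  end.
(* Reduces an identity between linear combinations to scalar identities, one
   for each vector that occurs. *)
Ltac lincomb_over R V :=
  lazymatch goal with
  | |- ?t = ?u =>
      let e := matoms t (@nil (GRing.Lmodule.sort V)) in let e := matoms u e in
      let t' := mreify R t e in let u' := mreify R u e in
      refine (@meval_eq R V e t' u' _); cbn [mall size mcoef Nat.eqb];
      repeat split
  end.

(** * Maximal convex subsets of the sphere *)

Ltac lincomb R V :=
  lincomb_over R V; try field; repeat split => //.

Section Norms.
Variables (R : realType) (X : lmodType R).

(** A norm is a bare real function, so that the same lemmas serve [K] with restricted scalars, [Y],
    and coordinate rows with a norm pulled back along a linear map. *)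
Record is_norm (N : X -> R) : Prop := IsNorm {
  is_normD : forall x y, N (x + y) <= N x + N y;
  is_normZ : forall r x, N (r *: x) = `|r| * N x;
  is_norm_eq0 : forall x, N x = 0 -> x = 0 }.

Variables (N : X -> R) (N_norm : is_norm N).

Lemma is_norm0 : N 0 = 0.
Proof. by rewrite -(scale0r 0) (is_normZ N_norm) normr0 mul0r. Qed.

Lemma is_normN x : N (- x) = N x.
Proof. by rewrite -scaleN1r (is_normZ N_norm) normrN1 mul1r. Qed.

Lemma is_norm_dist x y : N (x - y) = N (y - x).
Proof. by rewrite -is_normN opprB. Qed.

Lemma is_norm_ge0 x : 0 <= N x.
Proof.
have := is_normD N_norm x (- x).
by rewrite subrr is_norm0 is_normN; lra.
Qed.

Lemma is_normZ_ge0 r x : 0 <= r -> N (r *: x) = r * N x.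
Proof. by move=> r0; rewrite (is_normZ N_norm) ger0_norm. Qed.

Lemma is_norm_convex t x y : 0 <= t <= 1 ->
  N (t *: x + (1 - t) *: y) <= t * N x + (1 - t) * N y.
Proof.
move=> /andP[t0 t1]; apply: le_trans (is_normD N_norm _ _) _.
by rewrite !is_normZ_ge0 ?subr_ge0.
Qed.

Definition convex_in (C : set X) := forall x y t,
  C x -> C y -> 0 <= t <= 1 -> C (t *: x + (1 - t) *: y).

Definition sphere_convex (C : set X) :=
  (forall x, C x -> N x = 1) /\ convex_in C.

Definition star_closed (C : set X) := forall u,
  N u = 1 -> (forall c, C c -> N (u + c) = 2) -> C u.

Lemma convex_mid (C : set X) x y :
  convex_in C -> C x -> C y -> C (2^-1 *: x + 2^-1 *: y).
Proof.
move=> cC Cx Cy; have := cC x y 2^-1 Cx Cy.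
have -> : 1 - 2^-1 = 2^-1 :> R by lra.
by apply; lra.
Qed.

Lemma sphere_convex_add (C : set X) x y :
  sphere_convex C -> C x -> C y -> N (x + y) = 2.
Proof.
move=> [sC cC] Cx Cy; have := sC _ (convex_mid cC Cx Cy).
by rewrite -scalerDr is_normZ_ge0 ?invr_ge0//; lra.
Qed.

(** The points with parameters [s] and [1 - s] have sum [u + c] of norm 2 and norms at most 1, so
    both norms equal 1. *)
Lemma norm_segment u c s : N u = 1 -> N c = 1 -> N (u + c) = 2 ->
  0 <= s <= 1 -> N (s *: u + (1 - s) *: c) = 1.
Proof.
move=> Nu Nc Nuc s01; have s01' : 0 <= 1 - s <= 1 by lra.
have h1 := is_norm_convex u c s01; have h2 := is_norm_convex u c s01'.
have := is_normD N_norm (s *: u + (1 - s) *: c)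
  ((1 - s) *: u + (1 - (1 - s)) *: c).
have -> : s *: u + (1 - s) *: c + ((1 - s) *: u + (1 - (1 - s)) *: c) = u + c.
  by lincomb R X.
by rewrite Nuc; rewrite Nu Nc in h1 h2; lra.
Qed.

(** The convex function [N (u + _)] is at most 2 at [a] and [b]; if a combination giving [a]
    positive weight reaches 2, then so does [a]. *)
Lemma norm_add_convex2 u a b t : N u = 1 -> N a = 1 -> N b = 1 -> 0 < t <= 1 ->
  N (u + (t *: a + (1 - t) *: b)) = 2 -> N (u + a) = 2.
Proof.
move=> Nu Na Nb t01 h.
have t01' : 0 <= t <= 1 by lra.
have := is_norm_convex (u + a) (u + b) t01'.
have -> : t *: (u + a) + (1 - t) *: (u + b) = u + (t *: a + (1 - t) *: b).
  by lincomb R X.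
have := is_normD N_norm u a; have := is_normD N_norm u b.
rewrite h Nu Na Nb; nra.
Qed.

Lemma convex_cone (D : set X) u : convex_in D ->
  convex_in [set x | exists s c, [/\ 0 <= s <= 1, D c & x = s *: u + (1 - s) *: c]].
Proof.
move=> cD _ _ t [s1 [c1 [s1P D1 ->]]] [s2 [c2 [s2P D2 ->]]] tP.
pose s := t * s1 + (1 - t) * s2.
have sP : 0 <= s <= 1 by rewrite /s; nra.
(* With all the weight on [u] the component in [D] is arbitrary, and there is no [1 - s] to divide
   by. *)
have [s1E|sn1] := eqVneq s 1.
  exists 1, c1; split => //; first by rewrite ler01 lexx.
  have e1 : t * (1 - s1) = 0.
    by move: s1E; rewrite /s => ?; apply/eqP; rewrite eq_le; apply/andP; split; nra.
  have e2 : (1 - t) * (1 - s2) = 0 by move: s1E e1; rewrite /s; lra.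
  have -> : t *: (s1 *: u + (1 - s1) *: c1) + (1 - t) *: (s2 *: u + (1 - s2) *: c2)
    = s *: u + (t * (1 - s1)) *: c1 + ((1 - t) * (1 - s2)) *: c2.
    by rewrite /s; lincomb R X.
  by rewrite e1 e2 s1E; lincomb R X.
have s1n0 : 1 - s != 0 by rewrite subr_eq0 eq_sym.
have s1gt0 : 0 < 1 - s by rewrite lt0r s1n0; lra.
(* [1 - s] is the total weight on [D], and [r] is the share of [c1] in it. *)
pose r := t * (1 - s1) / (1 - s).
have rP : 0 <= r <= 1.
  rewrite divr_ge0 ?mulr_ge0 /=; try lra.
  by rewrite ler_pdivrMr// /s; nra.
exists s, (r *: c1 + (1 - r) *: c2); split => //; first exact: cD.
have sE : 1 - (t * s1 + (1 - t) * s2) != 0 by [].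
by rewrite /r /s; lincomb R X.
Qed.

(** A maximal convex subset [D] of the sphere is star closed: if [N (u + c) = 2] for all its points
    [c], the cone of [u] over [D] is convex and stays in the sphere by [norm_segment], so maximality
    puts [u] into [D]. *)
Lemma exists_star_closed (C : set X) : sphere_convex C -> C !=set0 ->
  exists D : set X, [/\ C `<=` D, sphere_convex D & star_closed D].
Proof.
move=> sC C0.
(* Carrying [C] inside [P] makes the union of the empty chain acceptable as well. *)
pose P (A : set X) := sphere_convex (C `|` A).
have [F cF FP|A [PA Amax]] := @Zorn_bigcup _ P.
  split=> [x [Cx|[A FA Ax]]|x y t]; first exact: sC.1.
    by apply: (cF _ FA).1; right.
  case=> [Cx|[A FA Ax]] [Cy|[B FB By]] tP.
  - by left; apply: sC.2.
  - by have [?|?] := (cF _ FB).2 x y t (or_introl Cx) (or_intror By) tP;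
      [left | right; exists B].
  - by have [?|?] := (cF _ FA).2 x y t (or_intror Ax) (or_introl Cy) tP;
      [left | right; exists A].
  - have [AB|BA] := FP _ _ FA FB.
      by have [?|?] := (cF _ FB).2 x y t (or_intror (AB _ Ax)) (or_intror By) tP;
        [left | right; exists B].
    by have [?|?] := (cF _ FA).2 x y t (or_intror Ax) (or_intror (BA _ By)) tP;
      [left | right; exists A].
exists (C `|` A); split => // u Nu uD.
pose D' := [set x | exists s c, [/\ 0 <= s <= 1, (C `|` A) c & x = s *: u + (1
    - s) *: c]].
have DD' : C `|` A `<=` D'.
  by move=> c Dc; exists 0, c; split => //; rewrite ?lexx ?ler01//; lincomb R X.
have CD' : C `|` D' = D'.
  by apply/seteqP; split => [x [Cx|//]|x]; [apply: DD'; left | right].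
have D'u : D' u.
  by case: C0 => c Cc; exists 1, c; split; [rewrite ler01 lexx|left|lincomb R X].
have PD' : P D'.
  rewrite /P CD'; split; last exact: convex_cone PA.2.
  by move=> _ [s [c [sP Dc ->]]]; apply: norm_segment => //; [exact: PA.1|exact: uD].
right; have [->|nA] := pselect (A = D'); first by [].
exfalso; apply: (Amax D') => //; split.
  by move=> x Ax; apply: DD'; right.
by move=> D'A; apply: nA; apply/seteqP; split => // x Ax; apply: DD'; right.
Qed.

End Norms.

(** * Midpoints in the image of a star-closed convex set *)

Section SphereIsometries.
Variables (R : realType) (X : lmodType R) (N : X -> R) (N_norm : is_norm N).
Variables (Y : normedModType R) (T : X -> Y).
Hypothesis T_sphere : forall x, N x = 1 -> `|T x| = 1.
Hypothesis T_surj : forall y : Y, `|y| = 1 -> exists2 x, N x = 1 & T x = y.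
Hypothesis T_iso : forall x y, N x = 1 -> N y = 1 -> `|T x - T y| = N (x - y).

Lemma normr_is_norm : is_norm (fun y : Y => `|y|).
Proof.
split=> [x y|r x|x /eqP]; [exact: ler_normD|exact: normrZ|].
by rewrite normr_eq0 => /eqP.
Qed.
Let nY := normr_is_norm.

(** For each [c] in [C] the points [T x1], [T x2] and [- T (- c)] lie in one convex subset of the
    sphere of [Y]. So the midpoint of the first two has distance 2 from [T (- c)], its preimage [m]
    satisfies [N (m + c) = 2], and star-closedness gives [C m]. *)
Lemma sphere_isometry_mid (C : set X) x1 x2 :
  sphere_convex N C -> star_closed N C -> C x1 -> C x2 ->
  exists2 m, C m & T m = 2^-1 *: T x1 + 2^-1 *: T x2.
Proof.
move=> sC starC Cx1 Cx2.
have NC := sC.1.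
have NN x : N x = 1 -> N (- x) = 1 by rewrite is_normN.
have TC x : C x -> `|T x| = 1 by move=> /NC/T_sphere.
have TCN x : C x -> `|T (- x)| = 1 by move=> /NC/NN/T_sphere.
have TDC u x : N u = 1 -> C x -> `|T u - T (- x)| = N (u + x).
  by move=> Nu Cx; rewrite T_iso//; [rewrite opprK | exact/NN/NC].
have TBC u x : N u = 1 -> C x -> `|T u - T x| = N (u - x).
  by move=> Nu Cx; rewrite T_iso//; exact: NC.
have key c : C c -> `|T x1 + T x2 - T (- c) - T (- c)| = 4.
  move=> Cc.
  (* [xb] is the barycentre of [x1], [x2] and [c], built in two steps so that [norm_add_convex2] can
     pass from [xb] to each of the three points. *)
  pose x' := 2^-1 *: x2 + 2^-1 *: c.
  pose xb := 3^-1 *: x1 + (1 - 3^-1) *: x'.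
  have Cx' : C x' by apply: convex_mid => //; exact: sC.2.
  have Cxb : C xb by apply: sC.2 => //; lra.
  have N2 u x : C x -> x = x1 \/ x = x2 \/ x = c -> N u = 1 -> N (u + xb) = 2
      -> N (u + x) = 2.
    move=> Cx xE Nu Nuxb.
    case: xE => [->|xE].
      by apply: norm_add_convex2 Nuxb => //; try exact: NC; lra.
    have Nux' : N (u + x') = 2.
      apply: (norm_add_convex2 N_norm (b := x1) (t := 1 - 3^-1)) => //; try
          exact: NC; try lra.
      rewrite -[RHS]Nuxb /xb; congr (N (_ + _)); lincomb R X.
    case: xE => ->.
      apply: (norm_add_convex2 N_norm (b := c) (t := 2^-1)) => //; try exact:
          NC; try lra.
      rewrite -[RHS]Nux' /x'; congr (N (_ + _)); lincomb R X.
    apply: (norm_add_convex2 N_norm (b := x2) (t := 2^-1)) => //; try exact: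
        NC; try lra.
    rewrite -[RHS]Nux' /x'; congr (N (_ + _)); lincomb R X.
  (* [v + v'] has norm [N (xb + xb) = 2], so the segment between them lies in the sphere and extends
     to a star-closed convex [D]. Each [y] in [D] is some [T u], and [y + v] of norm 2 means
     [N (u + xb) = 2]; hence [N (u + x) = 2] and [- T (- x)] is in [D]. For [T x] the preimage of
     [- y] is used with [v']. *)
  pose v := - T (- xb); pose v' := T xb.
  have Nv : `|v| = 1 by rewrite normrN TCN.
  have Nv' : `|v'| = 1 by rewrite TC.
  have Nvv : `|v + v'| = 2.
    rewrite /v /v' addrC TDC//; last exact: NC.
    exact: (sphere_convex_add N_norm sC).
  pose D0 := [set y | exists s w, [/\ 0 <= s <= 1, [set v'] w & y = s *: v + (1
      - s) *: w]].
  have sD0 : sphere_convex (fun y : Y => `|y|) D0.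
    split; last first.
      apply: (@convex_cone _ Y) => _ _ t -> -> _ /=.
      by lincomb R Y.
    by move=> _ [s [_ [sP -> ->]]]; apply: (norm_segment nY).
  have D0v : D0 v by exists 1, v'; split => //; [rewrite ler01 lexx|lincomb R Y].
  have D0v' : D0 v' by exists 0, v'; split => //; [rewrite ler01 lexx|lincomb R Y].
  have [|D [D0D sD starD]] := exists_star_closed nY sD0; first by exists v.
  have D1 x : C x -> x = x1 \/ x = x2 \/ x = c -> D (- T (- x)).
    move=> Cx xE; apply: starD; first by rewrite normrN TCN.
    move=> y Dy; have [u Nu yE] := T_surj (sD.1 _ Dy).
    rewrite addrC -yE TDC//; apply: N2 => //; rewrite -TDC// yE.
    exact: (sphere_convex_add nY sD Dy (D0D _ D0v)).
  have D2 x : C x -> x = x1 \/ x = x2 \/ x = c -> D (T x).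
    move=> Cx xE; apply: starD; first exact: TC.
    move=> y Dy; have Ny : `|- y| = 1 by rewrite normrN sD.1.
    have [u Nu yE] := T_surj Ny.
    rewrite -[y]opprK -yE distrC TBC// -(is_normN N_norm) opprB addrC.
    apply: N2 => //; first exact: NN.
    rewrite -(is_normN N_norm) opprD opprK -TBC// yE -normrN opprD !opprK.
    exact: (sphere_convex_add nY sD Dy (D0D _ D0v')).
  have Dm := convex_mid sD.2 (D2 _ Cx1 (or_introl erefl)) (D2 _ Cx2 (or_intror
      (or_introl erefl))).
  have Dc := D1 _ Cc (or_intror (or_intror erefl)).
  have := sD.1 _ (convex_mid sD.2 Dm Dc).
  have -> : 2^-1 *: (2^-1 *: T x1 + 2^-1 *: T x2) + 2^-1 *: - T (- c)
    = 4^-1 *: (T x1 + T x2 - T (- c) - T (- c)) by lincomb R Y.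
  rewrite normrZ gtr0_norm ?invr_gt0//; lra.
pose y := 2^-1 *: T x1 + 2^-1 *: T x2.
have yc c : C c -> `|y - T (- c)| = 2.
  move=> Cc; have -> : y - T (- c) = 2^-1 *: (T x1 + T x2 - T (- c) - T (- c)).
    by rewrite /y; lincomb R Y.
  by rewrite normrZ gtr0_norm ?invr_gt0// key//; lra.
(* The lower bound comes from [c = x1]: the distance from [y] to the unit vector [T (- x1)] is 2. *)
have Ny : `|y| = 1.
  apply/eqP; rewrite eq_le; apply/andP; split.
    rewrite (le_trans (ler_normD _ _))// !normrZ gtr0_norm ?invr_gt0//.
    by rewrite !TC//; lra.
  have := ler_normB y (T (- x1)); rewrite yc// TCN//; lra.
have [m Nm mE] := T_surj Ny.
exists m => //; apply: starC => // c Cc.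
by rewrite -TDC// mE yc.
Qed.

End SphereIsometries.

(** * Affinity of isometries along directions *)

Inductive lspan (R : pzRingType) (X : lmodType R) (D : set X) : X -> Prop :=
| lspan0 : lspan D 0
| lspan_add h c d : lspan D h -> D d -> lspan D (h + c *: d).

Lemma lspanD (R : pzRingType) (X : lmodType R) (D : set X) h k :
  lspan D h -> lspan D k -> lspan D (h + k).
Proof.
by move=> hD; elim=> [|{}k c d _ IH Dd]; rewrite ?addr0// addrA; exact: lspan_add.
Qed.

Lemma lspanZ (R : pzRingType) (X : lmodType R) (D : set X) c h :
  lspan D h -> lspan D (c *: h).
Proof.
elim=> [|{}h c' d _ IH Dd]; first by rewrite scaler0; exact: lspan0.
by rewrite scalerDr scalerA; exact: lspan_add.
Qed.

Lemma archi_mul_le0 (R : realType) (C x : R) :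
  (forall n, n%:R * x <= C) -> x <= 0.
Proof.
move=> h; rewrite leNgt; apply/negP => x0.
have := h (Num.Def.archi_bound `|C / x|); rewrite leNgt => /negP; apply.
by rewrite -ltr_pdivrMr// (le_lt_trans (ler_norm _))// archi_boundP.
Qed.

Section MidpointAffine.
Variables (R : realType) (X : lmodType R) (N : X -> R) (N_norm : is_norm N).
Variables (Y : normedModType R) (T : X -> Y) (F : set X).
Hypothesis F_convex : convex_in F.
Hypothesis T_iso : forall x y, F x -> F y -> `|T x - T y| = N (x - y).

(** On the segment the defect [g] is bounded because [T] is isometric. It vanishes at both ends and
    respects midpoints, so its value at [s] is half its value at [2 * s] or [2 * s - 1]; iterating
    halves the bound for ever. *)
Lemma midpoint_affine :
  (forall x y, F x -> F y -> T (2^-1 *: x + 2^-1 *: y) = 2^-1 *: T x + 2^-1 *: T y) ->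
  forall x y (t : R), F x -> F y -> 0 <= t <= 1 ->
    T (t *: x + (1 - t) *: y) = t *: T x + (1 - t) *: T y.
Proof.
move=> mid x y t Fx Fy tP.
pose g (s : R) := T (s *: x + (1 - s) *: y) - (s *: T x + (1 - s) *: T y).
have Fs (s : R) : 0 <= s <= 1 -> F (s *: x + (1 - s) *: y) by exact: F_convex.
have g0 : g 0 = 0 by rewrite /g subr0 !scale0r !add0r !scale1r subrr.
have g1 : g 1 = 0 by rewrite /g subrr !scale0r !addr0 !scale1r subrr.
have gmid (s r : R) : 0 <= s <= 1 -> 0 <= r <= 1 ->
    g (2^-1 * s + 2^-1 * r) = 2^-1 *: g s + 2^-1 *: g r.
  move=> sP rP; rewrite /g.
  have -> : (2^-1 * s + 2^-1 * r) *: x + (1 - (2^-1 * s + 2^-1 * r)) *: y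
     = 2^-1 *: (s *: x + (1 - s) *: y) + 2^-1 *: (r *: x + (1 - r) *: y).
    by lincomb R X.
  by rewrite mid; [lincomb R Y|exact: Fs|exact: Fs].
have gB (s : R) : 0 <= s <= 1 -> `|g s| <= 2 * N (x - y).
  move=> sP; rewrite /g.
  have -> : T (s *: x + (1 - s) *: y) - (s *: T x + (1 - s) *: T y)
    = (T (s *: x + (1 - s) *: y) - T y) - s *: (T x - T y) by lincomb R Y.
  apply: le_trans (ler_normB _ _) _; rewrite T_iso//; last exact: Fs.
  have -> : s *: x + (1 - s) *: y - y = s *: (x - y) by lincomb R X.
  case/andP: sP => s0 s1; rewrite normrZ T_iso// (is_normZ_ge0 N_norm)// ger0_norm//.
  by have := is_norm_ge0 N_norm (x - y); nra.
have gn n : forall s : R, 0 <= s <= 1 -> `|g s| <= 2^-1 ^+ n * (2 * N (x - y)).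
  elim: n => [|n IH] s sP; first by rewrite expr0 mul1r; exact: gB.
  have [s2|s2] := leP s 2^-1.
    have -> : s = 2^-1 * (2 * s) + 2^-1 * 0 by field.
    rewrite gmid ?lexx ?ler01//; last by lra.
    rewrite g0 scaler0 addr0 normrZ gtr0_norm ?invr_gt0// exprS -mulrA.
    by rewrite ler_wpM2l ?invr_ge0//; apply: IH; lra.
  have -> : s = 2^-1 * (2 * s - 1) + 2^-1 * 1 by field.
  rewrite gmid ?lexx ?ler01//; last by lra.
  rewrite g1 scaler0 addr0 normrZ gtr0_norm ?invr_gt0// exprS -mulrA.
  by rewrite ler_wpM2l ?invr_ge0//; apply: IH; lra.
have gt0 : `|g t| <= 0.
  apply: (@archi_mul_le0 _ (2 * N (x - y))) => n.
  have := gn n t tP; rewrite exprVn mulrC ler_pdivlMr ?exprn_gt0// => h.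
  rewrite mulrC; apply: le_trans h; rewrite ler_wpM2l//.
  by rewrite -natrX ler_nat ltnW// ltn_expl.
by apply/eqP; rewrite -subr_eq0 -normr_le0.
Qed.

End MidpointAffine.

Section Reduction.
Variables (R : realType) (X : lmodType R) (N : X -> R) (N_norm : is_norm N).
Variables (Y : normedModType R) (T : X -> Y) (F : set X).
(** [D] holds the directions along which affinity is proved. For operators [orth] is orthogonality
    and [orth_norm] is the maximum formula for orthogonal summands; in finite dimension [orth d w]
    is [w = 0], and [orth_of_norm] is the extremality of [d]. [F_room] and [F_core] provide, around
    [a0], a ball of orthogonal displacements and a piece of every direction. *)
Variables (a0 : X) (D : set X) (orth : X -> X -> Prop) (rho : R).
Hypothesis F_convex : convex_in F.
Hypothesis T_iso : forall x y, F x -> F y -> `|T x - T y| = N (x - y).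
Hypothesis T_mid : forall x y, F x -> F y ->
  exists2 m, F m & T m = 2^-1 *: T x + 2^-1 *: T y.
Hypothesis Fa0 : F a0.
Hypothesis orth_of_norm : forall d x y (c : R), D d -> F x -> F y -> 0 < c ->
  N (c *: d + (x - y)) <= c * N d -> N (c *: d - (x - y)) <= c * N d ->
  orth d (x - y).
Hypothesis orth_norm : forall d d' w (s t r : R), D d -> D d' ->
  orth d w -> orth d' w ->
  N (s *: d + t *: d' + r *: w) <= Num.max (N (s *: d + t *: d')) (N (r *: w)).
Hypothesis rho_gt0 : 0 < rho.
Hypothesis F_room : forall d w (c : R), D d -> orth d w -> N (c *: w) <= rho ->
  F (a0 + c *: w).
Hypothesis F_core : forall d, D d ->
  exists2 r, 0 < r & forall s : R, `|s| <= r -> F (a0 + s *: d).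

(** A quantitative relative interior: [F] shrunk by [k] about [a0] and moved to [a] still fits into
    [F]. The factor [k] is what makes later estimates uniform in [a]. *)
Definition inner_pt k a := forall z, F z -> F (a + k *: (z - a0)).

Lemma inner_pt_mem k a : inner_pt k a -> F a.
Proof. by move=> /(_ _ Fa0); rewrite subrr scaler0 addr0. Qed.

Lemma inner_pt_room (k : R) a d w (c : R) : 0 < k -> inner_pt k a -> D d -> orth d w ->
  N (c *: w) <= k * rho -> F (a + c *: w).
Proof.
move=> k0 ka Dd dw cw; have kn0 : k != 0 by rewrite gt_eqF.
have /ka : F (a0 + (c / k) *: w).
  apply: (F_room Dd dw); rewrite mulrC -scalerA (is_normZ_ge0 N_norm); last by
      rewrite invr_ge0 ltW.
  by rewrite ler_pdivrMl.
suff -> : a + k *: (a0 + (c / k) *: w - a0) = a + c *: w by [].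
by lincomb R X.
Qed.

Lemma inner_pt_convex k : convex_in (inner_pt k).
Proof.
move=> x y t kx ky tP z Fz.
have -> : t *: x + (1 - t) *: y + k *: (z - a0) =
  t *: (x + k *: (z - a0)) + (1 - t) *: (y + k *: (z - a0)) by lincomb R X.
by apply: F_convex => //; [exact: kx|exact: ky].
Qed.

Lemma inner_pt_shrink (k : R) x : 0 <= k <= 1 -> F x ->
  inner_pt k ((1 - k) *: x + k *: a0).
Proof.
move=> kP Fx z Fz.
have -> : (1 - k) *: x + k *: a0 + k *: (z - a0) = k *: z + (1 - k) *: x.
  by lincomb R X.
exact: F_convex.
Qed.

(** Half of the room pays for the displacement: [s *: d + (k / 2) *: (z - a0)] is [k] times the
    displacement from [a0] to the midpoint of [z] and [a0 + (s * (2 / k)) *: d]. *)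
Lemma inner_pt_move (k : R) d : 0 < k -> D d -> exists2 e, 0 < e &
  forall (s : R) a, `|s| <= e -> inner_pt k a -> inner_pt (k / 2) (a + s *: d).
Proof.
move=> k0 Dd; have [r r0 Fr] := F_core Dd.
have kn0 : k != 0 by rewrite gt_eqF.
exists (r * k / 2) => [|s a sr ka z Fz]; first by rewrite !mulr_gt0 ?invr_gt0.
have Fs : F (a0 + (s * (2 / k)) *: d).
  apply: Fr; rewrite normrM [`|2 / k|]gtr0_norm ?divr_gt0//.
  by rewrite mulrA ler_pdivrMr//; lra.
have := ka _ (convex_mid F_convex Fs Fz).
suff -> : a + k *: (2^-1 *: (a0 + (s * (2 / k)) *: d) + 2^-1 *: z - a0)
  = a + s *: d + (k / 2) *: (z - a0) by [].
by lincomb R X.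
Qed.

Lemma orth_of_normr d x y (c : R) : D d -> F x -> F y -> c != 0 ->
  N (c *: d + (x - y)) <= `|c| * N d -> N (c *: d - (x - y)) <= `|c| * N d ->
  orth d (x - y).
Proof.
move=> Dd Fx Fy c0; have [c_gt0|c_le0] := ltP 0 c.
  by rewrite gtr0_norm//; exact: orth_of_norm.
have c_lt0 : c < 0 by rewrite lt_neqAle c0.
rewrite ltr0_norm// => h1 h2; apply: (@orth_of_norm _ _ _ (- c)) => //.
- by rewrite oppr_gt0.
- by rewrite scaleNr -(is_normN N_norm) opprD opprK.
- by rewrite scaleNr -opprD (is_normN N_norm).
Qed.

(* If the preimage of the midpoint is orthogonal to both directions, moving
   away from it inside [F] shows that it is the midpoint. *)
Lemma orth_mid_eq (k : R) a m d d' (s t : R) : 0 < k -> inner_pt k a -> D d -> D d' ->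
  F m -> F (a + (s *: d + t *: d')) -> F (a - (s *: d + t *: d')) ->
  T m = 2^-1 *: T (a + (s *: d + t *: d')) + 2^-1 *: T (a - (s *: d + t *: d')) ->
  orth d (m - a) -> orth d' (m - a) -> N (s *: d + t *: d') <= k * rho -> m = a.
Proof.
move=> k0 ka Dd Dd' Fm Fp Fq Tm dm d'm stN.
apply/eqP; rewrite -subr_eq0; apply: contraT => w0; exfalso.
set w := m - a in dm d'm w0.
have Nw : 0 < N w.
  rewrite lt0r is_norm_ge0// andbT; apply: contra w0 => /eqP/(is_norm_eq0 N_norm) ->.
  by [].
(* The test point [a + c *: w] lies on the far side of [a] from [m], as far as the room allows. Its
   distance to [m] is [N w + k * rho], whereas the midpoint formula and the maximum formula bound
   that distance by [k * rho]. *)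
pose c := - (k * rho / N w).
have kr0 : 0 < k * rho by rewrite mulr_gt0.
have c0 : c <= 0 by rewrite oppr_le0 divr_ge0 ?ltW.
have Ncw : N (c *: w) = k * rho.
  by rewrite (is_normZ N_norm) ler0_norm// opprK divfK// gt_eqF.
have Fz : F (a + c *: w) by apply: (inner_pt_room k0 ka Dd dm); rewrite Ncw.
have : `|T m - T (a + c *: w)| = N w + k * rho.
  rewrite T_iso// (_ : m - (a + c *: w) = (1 - c) *: w); last by rewrite /w;
      lincomb R X.
  rewrite (is_normZ_ge0 N_norm) ?subr_ge0 ?(le_trans c0)// mulrBl mul1r /c;
      congr (_ + _).
  by rewrite mulNr opprK divfK// gt_eqF.
have : `|T m - T (a + c *: w)| <= k * rho.
  rewrite Tm.
  have -> : 2^-1 *: T (a + (s *: d + t *: d')) + 2^-1 *: T (a - (s *: d + t *: d'))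
     - T (a + c *: w) = 2^-1 *: (T (a + (s *: d + t *: d')) - T (a + c *: w)) +
     2^-1 *: (T (a - (s *: d + t *: d')) - T (a + c *: w)) by lincomb R Y.
  apply: le_trans (ler_normD _ _) _; rewrite !normrZ gtr0_norm ?invr_gt0//.
  rewrite !T_iso//.
  have h1 : N (a + (s *: d + t *: d') - (a + c *: w)) <= k * rho.
    rewrite (_ : _ - _ = s *: d + t *: d' + (- c) *: w); last by lincomb R X.
    apply: le_trans (orth_norm _ _ _ Dd Dd' dm d'm) _.
    by rewrite ge_max stN scaleNr (is_normN N_norm)// Ncw lexx.
  have h2 : N (a - (s *: d + t *: d') - (a + c *: w)) <= k * rho.
    rewrite (_ : _ - _ = - (s *: d + t *: d' + c *: w)); last by lincomb R X.
    rewrite (is_normN N_norm)//; apply: le_trans (orth_norm _ _ _ Dd Dd' dm d'm) _.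
    by rewrite ge_max stN Ncw lexx.
  lra.
lra.
Qed.

(** Since [T m] is the midpoint, [m] has distance [|s| * N d] from both [a + s *: d] and
    [a - s *: d]; this makes [m - a] orthogonal to [d], and [orth_mid_eq] applies with a zero second
    displacement. *)
Lemma direction_mid (k : R) a d (s : R) : 0 < k -> inner_pt k a -> D d ->
  F (a + s *: d) -> F (a - s *: d) -> `|s| * N d <= k * rho ->
  T a = 2^-1 *: T (a + s *: d) + 2^-1 *: T (a - s *: d).
Proof.
move=> k0 ka Dd Fp Fq sN; have Fa := inner_pt_mem ka.
have [->|s0] := eqVneq s 0; first by rewrite scale0r subr0 addr0; lincomb R Y.
have [m Fm Tm] := T_mid Fp Fq.
have E : s *: d + 0 *: d = s *: d by lincomb R X.
suff ma : m = a by rewrite -{1}ma.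
have h1 : N (s *: d + (m - a)) <= `|s| * N d.
  rewrite (_ : s *: d + (m - a) = m - (a - s *: d)); last by lincomb R X.
  rewrite -T_iso// Tm [X in `|X|](_ : _ = 2^-1 *: (T (a + s *: d) - T (a - s *: d))).
    rewrite normrZ T_iso// (_ : a + s *: d - _ = (2 * s) *: d); last by lincomb R X.
    rewrite (is_normZ N_norm) normrM [`|2^-1|]gtr0_norm ?invr_gt0//.
    by rewrite [`|2|]gtr0_norm//; lra.
  by lincomb R Y.
have h2 : N (s *: d - (m - a)) <= `|s| * N d.
  rewrite (_ : s *: d - (m - a) = (a + s *: d) - m); last by lincomb R X.
  rewrite -T_iso// Tm [X in `|X|](_ : _ = 2^-1 *: (T (a + s *: d) - T (a - s *: d))).
    rewrite normrZ T_iso// (_ : a + s *: d - _ = (2 * s) *: d); last by lincomb R X.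
    rewrite (is_normZ N_norm) normrM [`|2^-1|]gtr0_norm ?invr_gt0//.
    by rewrite [`|2|]gtr0_norm//; lra.
  by lincomb R Y.
have dm := orth_of_normr Dd Fm Fa s0 h1 h2.
apply: (@orth_mid_eq k a m d d s 0) => //; rewrite ?E//.
by rewrite (is_normZ N_norm).
Qed.

(* On the 3 x 3 grid spanned by two directions, [T] is affine in each variable;
   extremality of both directions kills the mixed term. *)
Lemma direction_pair (k : R) a d d' (s t : R) : 0 < k -> D d -> D d' ->
  (forall i j : R, `|i| <= 1 -> `|j| <= 1 ->
     inner_pt k (a + (i * s) *: d + (j * t) *: d')) ->
  `|s| * N d + `|t| * N d' <= k * rho ->
  T (a + s *: d + t *: d') - T (a + t *: d') = T (a + s *: d) - T a.
Proof.
move=> k0 Dd Dd' kg stN.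
have [->|s0] := eqVneq s 0; first by rewrite scale0r addr0 !subrr.
have [->|t0] := eqVneq t 0; first by rewrite scale0r !addr0.
have Nd := is_norm_ge0 N_norm d; have Nd' := is_norm_ge0 N_norm d'.
have sN : `|s| * N d <= k * rho.
  have : 0 <= `|t| * N d' by rewrite mulr_ge0.
  by lra.
have tN : `|t| * N d' <= k * rho.
  have : 0 <= `|s| * N d by rewrite mulr_ge0.
  by lra.
pose p (i j : R) := a + (i * s) *: d + (j * t) *: d'.
pose g (i j : R) := T (p i j).
have F1 : `|1 : R| <= 1 by rewrite normr1.
have FN1 : `|-1 : R| <= 1 by rewrite normrN normr1.
have F0 : `|0 : R| <= 1 by rewrite normr0.
have Fp (i j : R) : `|i| <= 1 -> `|j| <= 1 -> F (p i j).
  by move=> i1 j1; exact/inner_pt_mem/kg.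
have row (j : R) : `|j| <= 1 -> g 0 j = 2^-1 *: g 1 j + 2^-1 *: g (-1) j.
  move=> j1.
  have E1 : p 1 j = p 0 j + s *: d by rewrite /p; lincomb R X.
  have E2 : p (-1) j = p 0 j - s *: d by rewrite /p; lincomb R X.
  rewrite /g E1 E2; apply: (direction_mid k0) => //; first exact: kg.
    by rewrite -E1; exact: Fp.
  by rewrite -E2; exact: Fp.
have col (i : R) : `|i| <= 1 -> g i 0 = 2^-1 *: g i 1 + 2^-1 *: g i (-1).
  move=> i1.
  have E1 : p i 1 = p i 0 + t *: d' by rewrite /p; lincomb R X.
  have E2 : p i (-1) = p i 0 - t *: d' by rewrite /p; lincomb R X.
  rewrite /g E1 E2; apply: (direction_mid k0) => //; first exact: kg.
    by rewrite -E1; exact: Fp.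
  by rewrite -E2; exact: Fp.
have p00 : p 0 0 = a by rewrite /p; lincomb R X.
have p11 : p 1 1 = a + (s *: d + t *: d') by rewrite /p; lincomb R X.
have pNN : p (-1) (-1) = a - (s *: d + t *: d') by rewrite /p; lincomb R X.
have [m Fm Tm] := T_mid (Fp 1 1 F1 F1) (Fp (-1) (-1) FN1 FN1).
rewrite -!/(g _ _) in Tm.
have Fa : F a by rewrite -p00; exact: Fp.
have dist (i j i' j' : R) : `|i| <= 1 -> `|j| <= 1 -> `|i'| <= 1 -> `|j'| <= 1 ->
    `|g i j - g i' j'| = N (p i j - p i' j') by move=> *; rewrite T_iso//; exact: Fp.
have distm (i j : R) : `|i| <= 1 -> `|j| <= 1 -> `|T m - g i j| = N (m - p i j).
  by move=> *; rewrite T_iso//; exact: Fp.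
have c10 := col 1 F1; have c00 := col 0 F0; have cN0 := col (-1) FN1.
have r01 := row 1 F1; have r00 := row 0 F0; have r0N := row (-1) FN1.
(* [m] is compared with the centre of a side of the parallelogram. By [col], [T] of that centre is
   the mean of the two corners, so the difference to [T m] is half of an adjacent side, which [row]
   identifies with [g 1 1 - g 0 1]. *)
have dm : orth d (m - a).
  apply: (orth_of_normr Dd Fm Fa s0).
    rewrite [X in N X](_ : _ = m - p (-1) 0); last by rewrite /p; lincomb R X.
    rewrite -distm// (_ : T m - _ = g 1 1 - g 0 1); last first.
      by rewrite Tm cN0 r01; lincomb R Y.
    rewrite dist// (_ : _ - _ = s *: d) ?(is_normZ N_norm)//.
    by rewrite /p; lincomb R X.
  rewrite [X in N X](_ : _ = - (m - p 1 0)); last by rewrite /p; lincomb R X.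
  rewrite (is_normN N_norm)// -distm// -normrN (_ : - (T m - _) = g 1 (-1) - g 0 (-1)).
    rewrite dist// (_ : _ - _ = s *: d) ?(is_normZ N_norm)//.
    by rewrite /p; lincomb R X.
  by rewrite Tm c10 r0N; lincomb R Y.
have d'm : orth d' (m - a).
  apply: (orth_of_normr Dd' Fm Fa t0).
    rewrite [X in N X](_ : _ = m - p 0 (-1)); last by rewrite /p; lincomb R X.
    rewrite -distm// (_ : T m - _ = g 1 1 - g 1 0); last first.
      by rewrite Tm c10 r0N; lincomb R Y.
    rewrite dist// (_ : _ - _ = t *: d') ?(is_normZ N_norm)//.
    by rewrite /p; lincomb R X.
  rewrite [X in N X](_ : _ = - (m - p 0 1)); last by rewrite /p; lincomb R X.
  rewrite (is_normN N_norm)// -distm// -normrN (_ : - (T m - _) = g (-1) 1 - g (-1) 0).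
    rewrite dist// (_ : _ - _ = t *: d') ?(is_normZ N_norm)//.
    by rewrite /p; lincomb R X.
  by rewrite Tm cN0 r01; lincomb R Y.
have ma : m = a.
  apply: (@orth_mid_eq k a m d d' s t) => //.
  - by rewrite -p00; exact: kg.
  - by rewrite -p11; exact: Fp.
  - by rewrite -pNN; exact: Fp.
  - by rewrite -p11 -pNN.
  - by apply: le_trans (is_normD N_norm _ _) _; rewrite !(is_normZ N_norm).
have Ta : g 0 0 = T a by rewrite /g p00.
(* [row] and [col] make [g 0 0] the mean of all four corners, while [m = a] makes it the mean of two
   opposite ones; so both diagonals have the same sum. *)
have E : g 1 (-1) = g 1 1 + g (-1) (-1) - g (-1) 1.
  have : g 0 0 = 2^-1 *: g 1 1 + 2^-1 *: g (-1) (-1) by rewrite Ta -{1}ma.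
  rewrite c00 r01 r0N => /(congr1 (fun z => 4 *: z - g 1 1 - g (-1) (-1) - g (-1) 1)) e.
  transitivity (4 *: (2^-1 *: (2^-1 *: g 1 1 + 2^-1 *: g (-1) 1) +
     2^-1 *: (2^-1 *: g 1 (-1) + 2^-1 *: g (-1) (-1))) - g 1 1 - g (-1) (-1) -
         g (-1) 1).
    by lincomb R Y.
  by rewrite e; lincomb R Y.
have -> : a + s *: d + t *: d' = p 1 1 by rewrite /p !mul1r.
have -> : a + t *: d' = p 0 1 by rewrite /p; lincomb R X.
have -> : a + s *: d = p 1 0 by rewrite /p; lincomb R X.
rewrite -!/(g _ _) -Ta r01 c10 c00 r01 r0N E; lincomb R Y.
Qed.

(** This and [locally_invariant] are carried together through the induction over [lspan]: invariance
    makes increments along several directions add up, and oddness is then additive. The bound [e]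
    precedes [a] because [inner_mid] uses it at every point of a subdivision. *)
Definition locally_odd h := forall k : R, 0 < k -> exists2 e, 0 < e &
  forall (s : R) a, `|s| <= e -> inner_pt k a -> T (a + s *: h) - T a = T a - T
      (a - s *: h).

Definition locally_invariant h := forall (k : R) d, 0 < k -> D d ->
  exists2 e, 0 < e & forall (s t : R) a, `|s| <= e -> `|t| <= e -> inner_pt k a ->
    T (a + s *: h + t *: d) - T (a + t *: d) = T (a + s *: h) - T a.

Lemma small_scale (x : R) : 0 <= x -> forall c : R, 0 < c ->
  exists2 e, 0 < e & forall s : R, `|s| <= e -> `|s| * x <= c.
Proof.
move=> x0 c c0; have x1 : 0 < x + 1 by lra.
exists (c / (x + 1)) => [|s]; first exact: divr_gt0.
by rewrite ler_pdivlMr//; have := normr_ge0 s; nra.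
Qed.

Lemma locally_odd_dir d : D d -> locally_odd d.
Proof.
move=> Dd k k0; have [e e0 He] := inner_pt_move k0 Dd.
have [e' e'0 He'] := small_scale (is_norm_ge0 N_norm d) (mulr_gt0 k0 rho_gt0).
exists (Num.min e e') => [|s a]; first by rewrite lt_min e0.
rewrite le_min => /andP[se se'] ka.
have Fp := inner_pt_mem (He s a se ka).
have Fq : F (a - s *: d).
  by rewrite -scaleNr; apply: inner_pt_mem (He _ a _ ka); rewrite normrN.
have E := direction_mid k0 ka Dd Fp Fq (He' s se').
rewrite E; lincomb R Y.
Qed.

Lemma locally_invariant_dir d : D d -> locally_invariant d.
Proof.
move=> Dd k d' k0 Dd'.
have k2 : 0 < k / 2 by lra.
have k4 : 0 < k / 2 / 2 by lra.
have [e e0 He] := inner_pt_move k0 Dd; have [e' e'0 He'] := inner_pt_move k2 Dd'.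
have kr : 0 < k / 2 / 2 * rho / 2 by rewrite !mulr_gt0 ?invr_gt0.
have [f f0 Hf] := small_scale (is_norm_ge0 N_norm d) kr.
have [f' f'0 Hf'] := small_scale (is_norm_ge0 N_norm d') kr.
exists (Num.min (Num.min e e') (Num.min f f')) => [|s t a].
  by rewrite !lt_min e0 e'0 f0.
rewrite !le_min => /andP[/andP[se _] /andP[sf _]].
move=> /andP[/andP[_ te'] /andP[_ tf']] ka.
apply: (direction_pair k4) => //; last first.
  by have := Hf s sf; have := Hf' t tf'; lra.
move=> i j i1 j1; apply: He'.
  by rewrite normrM (le_trans _ te')// ler_piMl.
by apply: He => //; rewrite normrM (le_trans _ se)// ler_piMl.
Qed.

Lemma lspan_locally_affine h : lspan D h -> locally_odd h /\ locally_invariant h.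
Proof.
elim=> [|{}h c d _ [oh ih] Dd].
  split=> [k k0|k d k0 Dd]; exists 1 => //.
    by move=> s a _ _; rewrite scaler0 subr0 addr0.
  by move=> s t a _ _ _; rewrite scaler0 !addr0 !subrr.
have od := locally_odd_dir Dd; have id := locally_invariant_dir Dd.
(* Invariance of the increment along [h] under the shift by [(s * c) *: d], read as additivity of
   increments. *)
have expand (k : R) : 0 < k -> exists2 e, 0 < e &
    forall (s : R) a, `|s| <= e -> inner_pt k a ->
    T (a + s *: (h + c *: d)) - T a
    = (T (a + s *: h) - T a) + (T (a + (s * c) *: d) - T a).
  move=> k0; have [e e0 He] := ih k d k0 Dd.
  have [f f0 Hf] := small_scale (normr_ge0 c) e0.
  exists (Num.min e f) => [|s a]; first by rewrite lt_min e0.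
  rewrite le_min => /andP[se sf] ka.
  rewrite -(He s (s * c))// ?normrM ?Hf//.
  rewrite (_ : a + s *: (h + c *: d) = a + s *: h + (s * c) *: d).
    by lincomb R Y.
  by lincomb R X.
split=> [k k0|k d' k0 Dd'].
  have [e e0 He] := expand k k0; have [f f0 Hf] := oh k k0; have [g g0 Hg] := od k k0.
  have [g' g'0 Hg'] := small_scale (normr_ge0 c) g0.
  exists (Num.min e (Num.min f g')) => [|s a]; first by rewrite !lt_min e0 f0.
  rewrite !le_min => /andP[se /andP[sf sg]] ka.
  have E1 := He s a se ka.
  have E2 : T (a - s *: (h + c *: d)) - T a
      = (T (a - s *: h) - T a) + (T (a - (s * c) *: d) - T a).
    have := He (- s) a _ ka; rewrite normrN => /(_ se).
    by rewrite !scaleNr mulNr scaleNr.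
  have E3 := Hf s a sf ka.
  have E4 : T (a + (s * c) *: d) - T a = T a - T (a - (s * c) *: d).
    by apply: Hg => //; rewrite normrM; exact: Hg'.
  by rewrite E1 E3 E4 -[in RHS]opprB E2; lincomb R Y.
(* [expand] is applied at [a] and at [a + t *: d']; at the second point only the room [k / 2] is
   left. *)
have k2 : 0 < k / 2 by lra.
have [e e0 He] := expand _ k2; have [e' e'0 He'] := expand _ k0.
have [m m0 Hm] := inner_pt_move k0 Dd'.
have [f f0 Hf] := ih k d' k0 Dd'; have [g g0 Hg] := id k d' k0 Dd'.
have [g' g'0 Hg'] := small_scale (normr_ge0 c) g0.
exists (Num.min (Num.min e e') (Num.min m (Num.min (Num.min f g) g'))) => [|s t a].
  by rewrite !lt_min e0 e'0 m0 f0 g0.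
rewrite !le_min => /andP[/andP[se se'] /andP[_ /andP[/andP[sf sg] sg']]].
move=> /andP[_ /andP[tm /andP[/andP[tf tg] _]]] ka.
have E1 := He s _ se (Hm t a tm ka); have E2 := He' s a se' ka.
have E3 := Hf s t a sf tf ka.
have E4 : T (a + (s * c) *: d + t *: d') - T (a + t *: d') = T (a + (s * c) *: d) - T a.
  by apply: Hg => //; rewrite normrM; exact: Hg'.
rewrite E2 -E3 -E4 (addrAC a (s *: (h + c *: d))) E1.
by rewrite (addrAC a (s *: h)) (addrAC a ((s * c) *: d)).
Qed.

(** The segment is cut into [2 * n] steps shorter than the uniform bound [e]. Oddness at each grid
    point makes consecutive increments of [T] equal, so [T] is affine on the grid; the even number
    of steps puts the midpoint on it. *)
Lemma inner_mid (k : R) x y : 0 < k -> inner_pt k x -> inner_pt k y ->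
  locally_odd (y - x) -> T (2^-1 *: x + 2^-1 *: y) = 2^-1 *: T x + 2^-1 *: T y.
Proof.
move=> k0 kx ky oxy; have [e e0 He] := oxy k k0.
pose n := (Num.Def.archi_bound e^-1).+1.
have n0 : 0 < n%:R :> R by rewrite ltr0n.
have ne : n%:R^-1 <= e.
  rewrite invf_ple ?posrE// ltW// (lt_le_trans (archi_boundP _))//; last by
      rewrite ler_nat leqnSn.
  by rewrite invr_ge0 ltW.
pose u (i : nat) := x + (i%:R / (2 * n%:R)) *: (y - x).
have uk i : (i <= n.*2)%N -> inner_pt k (u i).
  move=> i2n.
  have -> : u i = (i%:R / (2 * n%:R)) *: y + (1 - i%:R / (2 * n%:R)) *: x.
    by rewrite /u; lincomb R X; rewrite ?mulf_neq0// gt_eqF.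
  apply: inner_pt_convex => //; apply/andP; split.
    by rewrite divr_ge0// mulr_ge0// ltW.
  by rewrite ler_pdivrMr ?mulr_gt0// mul1r -natrM ler_nat mul2n.
have step i : (i.+2 <= n.*2)%N -> T (u i.+2) - T (u i.+1) = T (u i.+1) - T (u i).
  move=> i2n.
  have := He (2 * n%:R)^-1 (u i.+1) _ (uk _ (ltnW i2n)).
  have nn0 : n%:R != 0 :> R by rewrite gt_eqF.
  have -> : u i.+1 + (2 * n%:R)^-1 *: (y - x) = u i.+2.
    by rewrite /u -[i.+2%:R]natr1; lincomb R X; rewrite ?mulf_neq0.
  have -> : u i.+1 - (2 * n%:R)^-1 *: (y - x) = u i.
    by rewrite /u -[i.+1%:R]natr1; lincomb R X; rewrite ?mulf_neq0.
  apply; rewrite gtr0_norm ?invr_gt0 ?mulr_gt0// invfM (le_trans _ ne)//.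
  by rewrite ler_piMl ?invr_ge0 ?ltW// invf_lt1// ltr1n.
have dif i : (i.+1 <= n.*2)%N -> T (u i.+1) - T (u i) = T (u 1%N) - T (u 0%N).
  elim: i => [//|i IH] i2n; rewrite step// IH//; exact: ltnW.
have val i : (i <= n.*2)%N -> T (u i) = T (u 0%N) + i%:R *: (T (u 1%N) - T (u 0%N)).
  elim: i => [|i IH] i2n; first by rewrite scale0r addr0.
  rewrite -[T (u i.+1)](subrK (T (u i))) dif// IH ?(ltnW i2n)// -natr1; lincomb R Y.
have u0 : u 0%N = x by rewrite /u mul0r scale0r addr0.
have nn0 : n%:R != 0 :> R by rewrite gt_eqF.
have u2n : u n.*2 = y.
  by rewrite /u -mul2n natrM divff ?mulf_neq0// scale1r addrC subrK.
have un : u n = 2^-1 *: x + 2^-1 *: y.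
  by rewrite /u; lincomb R X.
have := val n; rewrite un u0 => ->; last by rewrite -addnn leq_addr.
have := val n.*2 (leqnn _); rewrite u2n u0 => ->.
by rewrite -mul2n natrM; lincomb R Y.
Qed.

Hypothesis F_approx : forall x y e, F x -> F y -> 0 < e ->
  exists x' y', [/\ F x', F y', N (x - x') <= e, N (y - y') <= e & lspan D (y' - x')].

(** Both points are first replaced by approximations whose difference is in the span of [D], then
    moved by a proportion [e] towards [a0] to become inner. Both moves cost a multiple of [e], and
    [T] is isometric, so the midpoint defect is also bounded by a multiple of [e]. *)
Lemma directions_affine x y (t : R) : F x -> F y -> 0 <= t <= 1 ->
  T (t *: x + (1 - t) *: y) = t *: T x + (1 - t) *: T y.
Proof.
apply: (midpoint_affine N_norm F_convex T_iso) => {}x {}y Fx Fy.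
pose M := N (x - a0) + N (y - a0) + 2.
have M0 : 0 < M.
  by have := is_norm_ge0 N_norm (x - a0); have := is_norm_ge0 N_norm (y - a0);
      rewrite /M; lra.
apply/eqP; rewrite -subr_eq0 -normr_le0.
have small e : 0 < e <= 1 ->
    `|T (2^-1 *: x + 2^-1 *: y) - (2^-1 *: T x + 2^-1 *: T y)| <= e * (2 * M).
  move=> /andP[e0 e1].
  have [x1 [y1 [Fx1 Fy1 xx1 yy1 xy1]]] := F_approx Fx Fy e0.
  pose x2 := (1 - e) *: x1 + e *: a0; pose y2 := (1 - e) *: y1 + e *: a0.
  have eP : 0 <= e <= 1 by rewrite ltW.
  have kx := inner_pt_shrink eP Fx1; have ky := inner_pt_shrink eP Fy1.
  rewrite -/x2 -/y2 in kx ky.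
  have [oddh _] : locally_odd (y2 - x2) /\ locally_invariant (y2 - x2).
    apply: lspan_locally_affine.
    have -> : y2 - x2 = (1 - e) *: (y1 - x1) by rewrite /x2 /y2; lincomb R X.
    exact: lspanZ.
  have midE := inner_mid e0 kx ky oddh.
  have Fx2 := inner_pt_mem kx; have Fy2 := inner_pt_mem ky.
  have distF z z1 : F z -> F z1 -> N (z - z1) <= e ->
      N (z - ((1 - e) *: z1 + e *: a0)) <= e * (N (z - a0) + 1).
    move=> Fz Fz1 zz1.
    rewrite [X in N X](_ : _ = (1 - e) *: (z - z1) + e *: (z - a0)); last by
        lincomb R X.
    apply: le_trans (is_normD N_norm _ _) _.
    rewrite !(is_normZ_ge0 N_norm) ?subr_ge0// ?(ltW e0)//.
    by have := is_norm_ge0 N_norm (z - z1); nra.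
  have dx := distF _ _ Fx Fx1 xx1; have dy := distF _ _ Fy Fy1 yy1.
  rewrite -/x2 in dx; rewrite -/y2 in dy.
  have -> : T (2^-1 *: x + 2^-1 *: y) - (2^-1 *: T x + 2^-1 *: T y)
    = (T (2^-1 *: x + 2^-1 *: y) - T (2^-1 *: x2 + 2^-1 *: y2))
      - (2^-1 *: (T x - T x2) + 2^-1 *: (T y - T y2)).
    by rewrite midE; lincomb R Y.
  apply: le_trans (ler_normB _ _) _.
  have h1 := ler_normD (2^-1 *: (T x - T x2)) (2^-1 *: (T y - T y2)).
  rewrite !normrZ [`|2^-1|]gtr0_norm ?invr_gt0// !T_iso// in h1.
  rewrite T_iso; [|by apply: convex_mid..].
  rewrite (_ : 2^-1 *: x + 2^-1 *: y - (2^-1 *: x2 + 2^-1 *: y2)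
    = 2^-1 *: (x - x2) + 2^-1 *: (y - y2)); last by lincomb R X.
  have h2 := is_normD N_norm (2^-1 *: (x - x2)) (2^-1 *: (y - y2)).
  rewrite !(is_normZ_ge0 N_norm) ?invr_ge0// in h2.
  have eM : 0 <= e * M by rewrite mulr_ge0// ltW.
  by rewrite /M in eM *; lra.
apply: (@archi_mul_le0 _ (2 * M)) => n.
case: n => [|n]; first by rewrite mul0r; lra.
have n0 : 0 < n.+1%:R :> R by rewrite ltr0n.
rewrite mulrC -ler_pdivlMr// mulrC; apply: small.
by rewrite invr_gt0 n0 invf_le1// ler1n.
Qed.

End Reduction.

(** * Finite dimension *)

Section RowSpaces.
Variable R : realType.

(** Among all finite matrices with rows in [S] one has maximal rank. Appending a further element of
    [S] cannot raise the rank, so its row space contains [S]; a free subfamily of its rows is then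
    kept. *)
Lemma row_basis n (S : set 'rV[R]_n) : exists r (A : 'M[R]_(r, n)),
  [/\ forall i, S (row i A), row_free A & forall s, S s -> (s <= A)%MS].
Proof.
pose P k := `[< exists m (A : 'M[R]_(m, n)), (forall i, S (row i A)) /\ \rank A = k >].
have P0 : exists k, P k.
  exists 0%N; apply/asboolP; exists 0%N, 0; split; first by case.
  by rewrite mxrank0.
have Pn k : P k -> (k <= n)%N.
  by move=> /asboolP[m [A [_ <-]]]; exact: rank_leq_col.
have [k /asboolP[m [A [SA rA]]] kmax] := ex_maxnP P0 Pn.
have subA s : S s -> (s <= A)%MS.
  move=> Ss; have AAs : (A <= col_mx A s)%MS by rewrite -addsmxE addsmxSl.
  have sAs : (s <= col_mx A s)%MS by rewrite -addsmxE addsmxSr.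
  apply: submx_trans sAs _; have := mxrank_leqif_sup AAs => -[_ <-].
  rewrite eqn_leq mxrankS//= rA; apply: kmax; apply/asboolP.
  exists (m + 1)%N, (col_mx A s); split => // i.
  case: (splitP i) => j ij.
    rewrite (_ : i = lshift 1 j); last exact/val_inj.
    by rewrite rowKu.
  rewrite (_ : i = rshift m j); last exact/val_inj.
  by rewrite rowKd ord1 row_id.
exists (\rank A), (rowsub (maxrankfun A) A); split.
- by move=> i; rewrite row_rowsub.
- exact: maxrowsub_free.
- by move=> s /subA; rewrite eq_maxrowsub.
Qed.

Lemma coord_norm_le n (c : 'rV[R]_n) i : `|c 0 i| <= `|c|.
Proof.
rewrite [leRHS]/Num.norm /= mx_normrE; apply/bigmax_geP; right.
by exists (0, i).
Qed.

Lemma row_lipschitz_continuous n (f : 'rV[R]_n -> R) (C : R) :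
  (forall x y, `|f x - f y| <= C * `|x - y|) -> continuous f.
Proof.
move=> fC x.
apply: (@cvgrPdist_le _ _ _ (nbhs x) (nbhs_filter x) f (f x)).2 => e e0.
have C1 : 0 < `|C| + 1 by rewrite ltr_wpDl.
apply/nbhs_ballP; exists (e / (`|C| + 1)) => /=; first exact: divr_gt0.
move=> y; rewrite mx_norm_ball /ball_/= => xy; apply: le_trans (fC _ _) _.
apply: (@le_trans _ _ ((`|C| + 1) * `|x - y|)).
  by rewrite ler_wpM2r// ler_wpDr// ler_norm.
by rewrite -ler_pdivlMl// mulrC ltW.
Qed.

Variables (n : nat) (M : 'rV[R]_n -> R) (M_norm : is_norm M).

Lemma row_norm_le : exists2 C, 0 <= C & forall c, M c <= C * `|c|.
Proof.
exists (\sum_i M (delta_mx 0 i)) => [|c].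
  by rewrite sumr_ge0// => i _; exact: is_norm_ge0.
rewrite {1}(row_sum_delta c) mulr_suml.
elim/big_ind2: _ => [|x1 x2 y1 y2 h1 h2|i _].
- by rewrite (is_norm0 M_norm).
- by apply: le_trans (is_normD M_norm _ _) _; exact: lerD.
- rewrite (is_normZ M_norm) mulrC ler_wpM2l ?(is_norm_ge0 M_norm)//.
  exact: coord_norm_le.
Qed.

Lemma row_norm_continuous : continuous M.
Proof.
have [C C0 MC] := row_norm_le.
apply: (@row_lipschitz_continuous _ _ C) => x y.
rewrite (le_trans _ (MC _))// ler_norml; apply/andP; split.
  rewrite lerNl opprB lerBlDr is_norm_dist//.
  by rewrite -{1}(subrK x y) (is_normD M_norm).
by rewrite lerBlDr -{1}(subrK y x) (is_normD M_norm).
Qed.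

Lemma row_norm_ge : exists2 m, 0 < m & forall c, m * `|c| <= M c.
Proof.
pose S := [set c : 'rV[R]_n | `|c| = 1].
have nS c : c != 0 -> S (`|c|^-1 *: c).
  by move=> c0; rewrite /S/= normrZ ger0_norm ?invr_ge0// mulVf// normr_eq0.
(* For [n = 0] there is no unit vector and hence no minimum; every [c] is then 0 and any constant
   will do. *)
have [S0|/set0P/negP/negPn/eqP S0] := pselect (S !=set0); last first.
  exists 1 => // c; have [->|c0] := eqVneq c 0.
    by rewrite normr0 mulr0 is_norm_ge0.
  by have := nS c c0; rewrite S0.
have cS : compact S.
  apply: bounded_closed_compact.
    by exists 1; split => // x x1 c /= ->; exact: ltW.
  apply: (@closed_comp _ _ (fun c : 'rV[R]_n => `|c|) [set 1]).
    by move=> c _; exact: norm_continuous.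
  exact: closed_eq.
have [|c0 /[!inE] Sc0 minc0] := EVT_min_rV (f := M) S0 cS.
  by apply: continuous_subspaceT; exact: row_norm_continuous.
have Mc0 : 0 < M c0.
  rewrite lt0r is_norm_ge0// andbT; apply/eqP => /(is_norm_eq0 M_norm) c00.
  by move: Sc0; rewrite /S/= c00 normr0 => /esym/eqP; rewrite oner_eq0.
exists (M c0) => // c; have [->|cn0] := eqVneq c 0.
  by rewrite normr0 mulr0 is_norm_ge0.
rewrite -ler_pdivlMr ?normr_gt0// mulrC -(is_normZ_ge0 M_norm) ?invr_ge0//.
by apply: minc0; rewrite inE; exact: nS.
Qed.

(** Being an extreme point of the ball of radius [M d], without normalising [d]; so 0 qualifies, and
    only the span of these vectors matters. *)
Definition extreme_dir (d : 'rV[R]_n) :=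
  forall w, M (d + w) <= M d -> M (d - w) <= M d -> w = 0.

(* A linear form that is positive somewhere attains its maximum over the unit
   ball; the point of largest euclidean norm where it does is extreme. *)
Lemma extreme_dir_exists (f : 'cV[R]_n) : f != 0 ->
  exists2 d, extreme_dir d & d *m f != 0.
Proof.
move=> f0.
pose B := [set c | M c <= 1]; pose phi (c : 'rV[R]_n) := (c *m f) 0 0.
have [m m0 Mm] := row_norm_ge.
have phiB x y : phi (x - y) = phi x - phi y by rewrite /phi mulmxBl !mxE.
have phiD x y : phi (x + y) = phi x + phi y by rewrite /phi mulmxDl !mxE.
have phiZ (k : R) x : phi (k *: x) = k * phi x by rewrite /phi -scalemxAl mxE.
have cphi : continuous phi.
  apply: (@row_lipschitz_continuous _ _ (\sum_i `|f i 0|)) => x y.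
  rewrite -phiB /phi mxE mulr_suml (le_trans (ler_norm_sum _ _ _))//.
  by apply: ler_sum => i _; rewrite normrM mulrC ler_wpM2l// coord_norm_le.
have cB : compact B.
  apply: bounded_closed_compact.
    exists m^-1; split; first exact: num_real.
    move=> x x1 c /= Bc; apply: le_trans (ltW x1).
    rewrite -[leRHS]mulr1 ler_pdivlMl//.
    exact: le_trans (Mm c) Bc.
  apply: (@closed_comp _ _ M [set x | x <= 1]).
    by move=> c _; exact: row_norm_continuous.
  exact: closed_le.
have B0 : B !=set0 by exists 0; rewrite /B/= is_norm0.
have [|c1 /[!inE] Bc1 maxc1] := EVT_max_rV B0 cB (f := phi).
  exact: continuous_subspaceT.
have phi1 : 0 < phi c1.
  have [i fi] : exists i, f i 0 != 0.
    apply: contrapT => /forallNP h; move/negP: f0; apply; apply/eqP/colP => i.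
    by rewrite mxE; apply/eqP/negPn/negP; exact: h.
  pose e : 'rV[R]_n := f i 0 *: delta_mx 0 i.
  have phie : 0 < phi e.
    by rewrite phiZ /phi -rowE mxE -expr2 exprn_even_gt0.
  have Me1 : 0 < M e + 1 by rewrite ltr_wpDl// is_norm_ge0.
  apply: lt_le_trans (maxc1 ((M e + 1)^-1 *: e) _).
    by rewrite phiZ mulr_gt0// invr_gt0.
  rewrite inE /B/= is_normZ_ge0 ?invr_ge0 ?(ltW Me1)// ler_pdivrMl// mulr1.
  by rewrite lerDl.
pose G := B `&` phi @^-1` [set phi c1].
have cG : compact G.
  apply: compact_closedI => //; apply: closed_comp; last exact: closed_eq.
  by move=> c _; exact: cphi.
pose q (c : 'rV[R]_n) := \sum_i c 0 i * c 0 i.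
have cq : continuous q.
  apply: continuous_big => [|i _ c]; first exact: add_continuous.
  have ci : {for c, continuous (fun x : 'rV[R]_n => x 0 i)} by exact: coord_continuous.
  exact: (cvgM ci ci).
have [||c2 /[!inE] -[Bc2 phi2] maxc2] := EVT_max_rV _ cG (f := q).
- by exists c1.
- exact: continuous_subspaceT.
exists c2; last by apply: contraTneq phi1 => e; rewrite -phi2 /= /phi e mxE ltxx.
move=> w h1 h2.
have phiw : phi w = 0.
  have /maxc1 : c2 + w \in B by rewrite inE /B/= (le_trans h1).
  have /maxc1 : c2 - w \in B by rewrite inE /B/= (le_trans h2).
  by move: phi2; rewrite phiB phiD /= => ->; lra.
have q1 : q (c2 + w) <= q c2.
  apply: maxc2; rewrite inE; split; first by rewrite /B/= (le_trans h1).
  by rewrite /= phiD phiw addr0.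
have q2 : q (c2 - w) <= q c2.
  apply: maxc2; rewrite inE; split; first by rewrite /B/= (le_trans h2).
  by rewrite /= phiB phiw subr0.
(* The parallelogram law for [q]: the values at [c2 + w] and [c2 - w] exceed those at [c2] by
   [2 * q w] in total, yet neither exceeds the maximum. *)
have qw : q w = 0.
  apply/eqP; rewrite eq_le; apply/andP; split; last first.
    by apply: sumr_ge0 => i _; rewrite -expr2 sqr_ge0.
  have : q (c2 + w) + q (c2 - w) = 2 * q c2 + 2 * q w.
    rewrite /q !mulr_sumr -!big_split/=; apply: eq_bigr => i _.
    by rewrite !mxE; ring.
  lra.
apply/rowP => i; rewrite mxE; apply/eqP; rewrite -sqrf_eq0 expr2.
have := psumr_eq0P _ qw; move=> -> // j _.
by rewrite -expr2 sqr_ge0.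
Qed.

(** If the extreme directions spanned a proper subspace, a nonzero column of the cokernel would be a
    linear form vanishing on all of them, against [extreme_dir_exists]. *)
Lemma extreme_dir_span c : lspan extreme_dir c.
Proof.
have [r [A [extA _ subA]]] := row_basis extreme_dir.
have fullA : row_full A.
  rewrite -cokermx_eq0; apply/negPn/negP => k0.
  have [j kj] : exists j, col j (cokermx A) != 0.
    apply: contrapT => /forallNP h; move/negP: k0; apply; apply/eqP/matrixP => i j.
    by have /negP/negPn/eqP/colP/(_ i) := h j; rewrite !mxE.
  have [d extd] := extreme_dir_exists kj.
  have /submxP[u ->] := subA _ extd.
  by rewrite colE mulmxA -(mulmxA u) mulmx_coker mulmx0 mul0mx eqxx.
have /submxP[u ->] := submx_full c fullA.
rewrite mulmx_sum_row; elim/big_ind: _ => [|x y hx hy|i _].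
- exact: lspan0.
- exact: lspanD.
- by rewrite -[_ *: _]add0r; apply: lspan_add; [exact: lspan0|exact: extA].
Qed.

End RowSpaces.

(** The weight missing to 1 falls on [x0]. The induction splits off one vertex and rescales the
    others by [1 - u i]; when this is not positive they carry no weight at all. *)
Lemma convex_sum (R : realType) (X : lmodType R) (F : set X) (x0 : X) (I : Type)
    (l : seq I) (v : I -> X) : convex_in F -> F x0 -> (forall i, F (x0 + v i)) ->
  forall u : I -> R, (forall i, 0 <= u i) -> \sum_(i <- l) u i <= 1 ->
  F (x0 + \sum_(i <- l) u i *: v i).
Proof.
move=> cF Fx0 Fv; elim: l => [|i l IH] u u0; first by rewrite !big_nil addr0.
rewrite !big_cons; set s := \sum_(j <- l) u j => us.
have s0 : 0 <= s by exact: sumr_ge0.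
have [u1|u1] := leP 1 (u i).
  have se : s = 0 by apply/eqP; rewrite eq_le s0 andbT; lra.
  have -> : \sum_(j <- l) u j *: v j = 0.
    have : forall w : I -> R, (forall i, 0 <= w i) -> \sum_(j <- l) w j = 0 ->
        \sum_(j <- l) w j *: v j = 0.
      elim: (l) => [|j k IHk] w w0; first by rewrite !big_nil.
      rewrite !big_cons => ws.
      have k0 : 0 <= \sum_(m <- k) w m by exact: sumr_ge0.
      have wj0 := w0 j.
      rewrite (_ : w j = 0) ?scale0r ?add0r; last by lra.
      by apply: IHk => //; lra.
    exact.
  have -> : u i = 1 by lra.
  by rewrite scale1r addr0.
have d0 : 0 < 1 - u i by lra.
have dn0 : 1 - u i != 0 by rewrite gt_eqF.
have -> : x0 + (u i *: v i + \sum_(j <- l) u j *: v j)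
  = u i *: (x0 + v i) + (1 - u i) *: (x0 + \sum_(j <- l) (u j / (1 - u i)) *: v j).
  have -> : \sum_(j <- l) (u j / (1 - u i)) *: v j
     = (1 - u i)^-1 *: \sum_(j <- l) u j *: v j.
    by rewrite scaler_sumr; apply: eq_bigr => j _; rewrite scalerA mulrC.
  by lincomb R X.
apply: cF => //; last by rewrite u0/= ltW.
apply: IH => [j|]; first by rewrite divr_ge0// ltW.
by rewrite -mulr_suml ler_pdivrMr// mul1r -/s; lra.
Qed.

Section FiniteDimension.
Variables (R : realType) (X : lmodType R) (N : X -> R) (N_norm : is_norm N).
Variables (n : nat) (psi : X -> 'rV[R]_n).
Hypothesis psiB : forall x y, psi (x - y) = psi x - psi y.
Hypothesis psiZ : forall (r : R) x, psi (r *: x) = r *: psi x.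
Hypothesis psi_inj : injective psi.
Variables (Y : normedModType R) (T : X -> Y) (F : set X).
Hypothesis F_convex : convex_in F.
Hypothesis T_iso : forall x y, F x -> F y -> `|T x - T y| = N (x - y).
Hypothesis T_mid : forall x y, F x -> F y ->
  exists2 m, F m & T m = 2^-1 *: T x + 2^-1 *: T y.

Let psi0 : psi 0 = 0. Proof. by rewrite -(subrr 0) psiB subrr. Qed.
Let psiD x y : psi (x + y) = psi x + psi y.
Proof. by rewrite -[y in LHS]opprK psiB -[- y]sub0r psiB psi0 sub0r opprK. Qed.

(** Points [p i] of [F] are chosen so that the vectors [p i - x0] form a basis of the span of
    [F - x0]; the simplex on [x0] and the [p i] then has interior in that span. [L] passes to
    coordinates, where the extreme directions live. *)
Lemma finite_dim_affine x y (t : R) : F x -> F y -> 0 <= t <= 1 ->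
  T (t *: x + (1 - t) *: y) = t *: T x + (1 - t) *: T y.
Proof.
move=> Fx Fy tP; pose x0 := x.
have [r [A [SA freeA subA]]] := row_basis [set psi (z - x0) | z in F].
have /choice[p pP] : forall i, exists z, F z /\ psi (z - x0) = row i A.
  by move=> i; have [z Fz zE] := SA i; exists z.
pose v i := p i - x0.
pose L (c : 'rV[R]_r) := \sum_i c 0 i *: v i.
have psiL c : psi (L c) = c *m A.
  rewrite mulmx_sum_row /L; elim/big_ind2: _ => [//|x1 x2 y1 y2 <- <-|i _].
    by rewrite psiD.
  by rewrite psiZ (pP i).2.
have LD c d : L (c + d) = L c + L d.
  by rewrite /L -big_split/=; apply: eq_bigr => i _; rewrite mxE scalerDl.
have LZ (k : R) c : L (k *: c) = k *: L c.
  by rewrite /L scaler_sumr; apply: eq_bigr => i _; rewrite mxE scalerA.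
have L0 c : L c = 0 -> c = 0.
  move=> /(congr1 psi); rewrite psiL psi0 -(mul0mx _ A).
  exact: (row_free_inj freeA).
have LB c d : L (c - d) = L c - L d by rewrite LD -(scaleN1r d) LZ scaleN1r.
have L00 : L 0 = 0 by have := LB 0 0; rewrite !subrr.
have FL z : F z -> exists c, z = x0 + L c.
  move=> Fz; have /submxP[c cE] := subA (psi (z - x0)) (ex_intro2 _ _ z Fz erefl).
  exists c; rewrite -(psi_inj (x1 := z - x0) (x2 := L c)) ?psiL//.
  by rewrite addrC subrK.
have M_norm : is_norm (fun c => N (L c)).
  split=> [c d|k c|c].
  - by rewrite LD (is_normD N_norm).
  - by rewrite LZ (is_normZ N_norm).
  - by move=> /(is_norm_eq0 N_norm)/L0.
pose D := [set L d | d in extreme_dir (fun c => N (L c))].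
have spanL c : lspan D (L c).
  elim: (extreme_dir_span M_norm c) => [|h k d _ IH extd].
    by rewrite L00; exact: lspan0.
  by rewrite LD LZ; apply: lspan_add => //; exists d.
(* The number of vertices of the simplex; [a0] is its barycentre, with weight [q^-1] at each
   vertex. *)
pose q : R := r.+1%:R.
have q0 : 0 < q by rewrite ltr0n.
have qn0 : q != 0 by rewrite gt_eqF.
pose a0 := x0 + L (const_mx q^-1).
have Fx0v i : F (x0 + v i) by rewrite /v addrC subrK; exact: (pP i).1.
have F_core d : D d -> exists2 e, 0 < e & forall s : R, `|s| <= e -> F (a0 + s *: d).
  move=> [c _ <-].
  have c1 : 0 < `|c| + 1 by rewrite ltr_wpDl.
  (* Changing each weight by at most [q ^- 2] keeps it nonnegative, and the [r = q - 1] weights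
     still sum to at most [1 - q ^- 2]. *)
  exists (q ^- 2 / (`|c| + 1)) => [|s].
    by rewrite mulr_gt0// invr_gt0// exprn_gt0.
  rewrite ler_pdivlMr// => sc.
  have sci i : `|s * c 0 i| <= q ^- 2.
    rewrite normrM (le_trans _ sc)// ler_wpM2l//.
    by rewrite (le_trans (coord_norm_le c i))// lerDl.
  have qq : q ^- 2 <= q^-1.
    by rewrite lef_pV2 ?posrE ?exprn_gt0// expr2 ler_peMl ?(ltW q0)// ler1n.
  have -> : a0 + s *: L c = x0 + \sum_i (q^-1 + s * c 0 i) *: v i.
    rewrite /a0 -LZ -addrA -LD; congr (_ + _); apply: eq_bigr => i _.
    by rewrite !mxE.
  apply: convex_sum => // [i|].
    have := sci i; rewrite ler_norml => /andP[h _].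
    by rewrite addrC -lerBlDr sub0r (le_trans _ h)// lerN2.
  apply: (@le_trans _ _ (\sum_(i < r) (q^-1 + q ^- 2))).
    by apply: ler_sum => i _; rewrite lerD2l (le_trans (ler_norm _)).
  rewrite sumr_const card_ord -[_ *+ r]mulr_natr.
  have -> : r%:R = q - 1 by rewrite /q -natr1 addrK.
  have -> : (q^-1 + q ^- 2) * (q - 1) = 1 - q ^- 2 by field.
  by rewrite gerBl invr_ge0 exprn_ge0// ltW.
have Fa0 : F a0.
  apply: convex_sum => // [i|]; first by rewrite mxE invr_ge0 ltW.
  under eq_bigr do rewrite mxE.
  rewrite sumr_const card_ord -[_ *+ r]mulr_natr ler_pdivrMl// mulr1.
  by rewrite ler_nat.
apply: (@directions_affine _ _ N N_norm Y T F a0 D (fun _ w => w = 0) 1) => //.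
- move=> d z w c [d' extd <-] Fz Fw c0.
  have [e ->] := FL _ Fz; have [f ->] := FL _ Fw.
  have -> : x0 + L e - (x0 + L f) = L (e - f) by rewrite LB opprD addrACA subrr add0r.
  have cn0 : c != 0 by rewrite gt_eqF.
  set w' := e - f => h1 h2.
  suff : c^-1 *: w' = 0 by move=> /eqP; rewrite scaler_eq0 invr_eq0 (negPf
      cn0)/= => /eqP ->.
  apply: extd; rewrite -(ler_pM2l c0) -(is_normZ_ge0 N_norm _ (ltW c0)).
    by rewrite LD LZ scalerDr scalerA divff// scale1r.
  by rewrite LB LZ scalerBr scalerA divff// scale1r.
- by move=> d d' w s u k _ _ -> _; rewrite scaler0 addr0 le_max lexx.
- by move=> d w c _ -> _; rewrite scaler0 addr0.
- move=> z w e Fz Fw e0; exists z, w; split => //.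
  + by rewrite subrr is_norm0// ltW.
  + by rewrite subrr is_norm0// ltW.
  have [c ->] := FL _ Fz; have [d ->] := FL _ Fw.
  by rewrite opprD addrACA subrr add0r -LB; exact: spanL.
Qed.

End FiniteDimension.

(** * Types 5 and 6 *)

(** An alias, so that the restricted real scalars do not compete with the complex module structure
    on the same type. *)
Definition realified (R : realType) (V : lmodType R[i]) : Type := V.

Section Realified.
Variables (R : realType) (V : lmodType R[i]).

HB.instance Definition _ := GRing.Zmodule.on (realified V).

Definition real_scale (r : R) (x : realified V) : realified V :=
  r%:C *: (x : V).

Fact real_scaleA a b x : real_scale a (real_scale b x) = real_scale (a * b) x.
Proof. by rewrite /real_scale scalerA rmorphM. Qed.
Fact real_scale1 : left_id 1 real_scale.
Proof. by move=> x; rewrite /real_scale scale1r. Qed.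
Fact real_scaleDr : right_distributive real_scale +%R.
Proof. by move=> a x y; rewrite /real_scale scalerDr. Qed.
Fact real_scaleDl x : {morph real_scale^~ x : a b / a + b}.
Proof. by move=> a b; rewrite /real_scale rmorphD scalerDl. Qed.

HB.instance Definition _ := GRing.Zmodule_isLmodule.Build R (realified V)
  real_scaleA real_scale1 real_scaleDr real_scaleDl.

Lemma real_scaleE (r : R) (x : realified V) : r *: x = (r%:C *: (x : V) : V).
Proof. by []. Qed.

End Realified.

Section ComplexNorm.
Variables (R : realType) (E : normedModType R[i]).

Lemma cnormE (x : E) : (cnorm x)%:C = `|x|.
Proof.
rewrite /cnorm; have : 0 <= `|x| by [].
by case: (`|x|) => a b; rewrite lecE/= => /andP[/eqP -> _].
Qed.

Lemma cnorm_is_norm : @is_norm R (realified E) (@cnorm R E).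
Proof.
split=> [x y|r x|x h].
- by have := @ler_normD _ E x y; rewrite -!cnormE -rmorphD lecR.
- apply: complexI; rewrite rmorphM !cnormE real_scaleE normrZ; congr (_ * _).
    by rewrite normc_def /= expr0n addr0 sqrtr_sqr.
  by rewrite -cnormE.
- by apply: (@normr0_eq0 _ E); rewrite -cnormE h.
Qed.

Lemma cnorm_eq1 (x : E) : cnorm x = 1 <-> unit_sphere E x.
Proof.
rewrite /unit_sphere/= -cnormE; split=> [->//|h].
exact: complexI.
Qed.

End ComplexNorm.

Definition pair_proj (A : Type) (b : bool) (x : A * A) := if b then x.2 else x.1.

Lemma pair_projB (A : zmodType) b (x y : (A * A)%type) :
  pair_proj b (x - y) = pair_proj b x - pair_proj b y.
Proof. by case: b. Qed.

Lemma pair_projZ (R : pzRingType) (A : lmodType R) b (c : R) (x : (A * A)%type) :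
  pair_proj b (c *: x) = c *: pair_proj b x.
Proof. by case: b. Qed.

Section OctonionMatrices.
Variable R : realType.

Definition coct_coord (b : bool * bool * bool) (x : coct R) : R[i] :=
  pair_proj b.2 (pair_proj b.1.2 (pair_proj b.1.1 x)).

Definition coct_mx_coord (j : 'I_3 * 'I_3 * (bool * bool * bool) * bool)
    (x : coct_mx R) : R :=
  let z := coct_coord j.1.2 (x j.1.1.1 j.1.1.2) in
  if j.2 then complex.Im z else complex.Re z.

Lemma coct_coordB b (x y : coct R) :
  coct_coord b (x - y) = coct_coord b x - coct_coord b y.
Proof. by rewrite /coct_coord !pair_projB. Qed.

Lemma coct_coordZ b (c : R[i]) (x : coct R) :
  coct_coord b (c *: x) = c * coct_coord b x.
Proof. by rewrite /coct_coord !pair_projZ. Qed.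

Lemma coct_mx_coordB j x y :
  coct_mx_coord j (x - y) = coct_mx_coord j x - coct_mx_coord j y.
Proof.
rewrite /coct_mx_coord -[(x - y) _ _]/(x j.1.1.1 j.1.1.2 - y j.1.1.1 j.1.1.2).
by rewrite coct_coordB; case: ifP => _; exact: raddfB.
Qed.

Lemma coct_mx_coordZ j (r : R) x :
  coct_mx_coord j (r%:C *: x) = r * coct_mx_coord j x.
Proof.
rewrite /coct_mx_coord -[(_ *: x) _ _]/(r%:C *: x j.1.1.1 j.1.1.2) coct_coordZ.
by case: (coct_coord _ _) => a b /=; case: ifP; rewrite mul0r ?addr0 ?subr0.
Qed.

Lemma coct_coord_inj (x y : coct R) :
  (forall b, coct_coord b x = coct_coord b y) -> x = y.
Proof.
case: x => [[[x1 x2] [x3 x4]] [[x5 x6] [x7 x8]]].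
case: y => [[[y1 y2] [y3 y4]] [[y5 y6] [y7 y8]]] h.
have e1 : x1 = y1 := h (false, false, false).
have e2 : x2 = y2 := h (false, false, true).
have e3 : x3 = y3 := h (false, true, false).
have e4 : x4 = y4 := h (false, true, true).
have e5 : x5 = y5 := h (true, false, false).
have e6 : x6 = y6 := h (true, false, true).
have e7 : x7 = y7 := h (true, true, false).
have e8 : x8 = y8 := h (true, true, true).
by rewrite e1 e2 e3 e4 e5 e6 e7 e8.
Qed.

Lemma coct_mx_coord_inj x y :
  (forall j, coct_mx_coord j x = coct_mx_coord j y) -> x = y.
Proof.
move=> h; apply/funext => i; apply/funext => k; apply: coct_coord_inj => b.
have := h ((i, k), b, true); have := h ((i, k), b, false).
rewrite /coct_mx_coord; cbn [fst snd].
by case: (coct_coord b (x i k)) (coct_coord b (y i k)) => ? ? [? ?] /= -> ->.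
Qed.

End OctonionMatrices.

Section SphereFaces.
Variables (R : realType) (K : jbstar_triple R) (Y : completeNormedModType R).
Variable Delta : K -> Y.
Hypothesis Delta_sphere : set_fun (unit_sphere K) (unit_sphere Y) Delta.
Hypothesis Delta_surj : set_surj (unit_sphere K) (unit_sphere Y) Delta.
Hypothesis Delta_isometry : forall x y, unit_sphere K x -> unit_sphere K y ->
  `|Delta x - Delta y| = cnorm (x - y).

Notation X := (realified K).
Let N : X -> R := @cnorm R K.
Let T : X -> Y := Delta.
Let N_norm : is_norm N := cnorm_is_norm K.

Lemma realified_sphere (x : X) : N x = 1 -> `|T x| = 1.
Proof. by move=> /cnorm_eq1/Delta_sphere. Qed.

Lemma realified_surj (y : Y) : `|y| = 1 -> exists2 x, N x = 1 & T x = y.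
Proof. by move=> /Delta_surj[x /cnorm_eq1 Nx <-]; exists x. Qed.

Lemma realified_isometry (x y : X) : N x = 1 -> N y = 1 ->
  `|T x - T y| = N (x - y).
Proof. by move=> /cnorm_eq1 Nx /cnorm_eq1 Ny; exact: Delta_isometry. Qed.

Lemma star_closed_mid (F : set X) x y : sphere_convex N F -> star_closed N F ->
  F x -> F y -> exists2 m, F m & T m = 2^-1 *: T x + 2^-1 *: T y.
Proof.
apply: (sphere_isometry_mid N_norm); [exact: realified_sphere|
  exact: realified_surj|exact: realified_isometry].
Qed.

Lemma sphere_convex_isometry (F : set X) : sphere_convex N F ->
  forall x y, F x -> F y -> `|T x - T y| = N (x - y).
Proof. by move=> [NF _] x y Fx Fy; apply: realified_isometry; exact: NF. Qed.

(** Types 5 and 6 at once: [Phi] followed by the real coordinates of a matrix over the complex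
    octonions embeds [K] linearly into a space of rows. *)
Lemma coct_mx_affine (C : set X) (A : set (coct_mx R)) M tp x y (t : R) :
  realized_as K A M tp -> sphere_convex N C -> C x -> C y -> 0 <= t <= 1 ->
  T (t *: x + (1 - t) *: y) = t *: T x + (1 - t) *: T y.
Proof.
move=> [Phi [[_ Phi_inj _] _ _]] sC Cx Cy tP.
have [F [CF sF starF]] := exists_star_closed N_norm sC (ex_intro _ x Cx).
pose J : finType := ('I_3 * 'I_3 * (bool * bool * bool) * bool)%type.
pose psi (z : X) := \row_(j < #|J|) coct_mx_coord (enum_val j) (Phi z).
apply: (@finite_dim_affine _ X N N_norm _ psi _ _ _ Y T F sF.2).
- by move=> u v; apply/rowP => j; rewrite !mxE -coct_mx_coordB -raddfB.
- by move=> r u; apply/rowP => j; rewrite !mxE -coct_mx_coordZ -linearZ.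
- move=> u v uv; apply: Phi_inj; rewrite ?inE//; apply: coct_mx_coord_inj => j.
  by have /rowP/(_ (enum_rank j)) := uv; rewrite !mxE enum_rankK.
- exact: sphere_convex_isometry.
- by move=> u v; exact: star_closed_mid.
- exact: CF.
- exact: CF.
- exact: tP.
Qed.

End SphereFaces.

(** * Hilbert spaces *)

Section ComplexModulus.
Variable R : realType.
Implicit Types z : R[i].

Definition cabs z : R := complex.Re `|z|.

Lemma cabsE z : (cabs z)%:C = `|z|.
Proof. by rewrite /cabs normc_def. Qed.

Lemma cabs_ge0 z : 0 <= cabs z.
Proof. by rewrite -ler0c cabsE. Qed.

Lemma cabsM z1 z2 : cabs (z1 * z2) = cabs z1 * cabs z2.
Proof. by apply: complexI; rewrite rmorphM !cabsE normrM. Qed.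

Lemma cabsD z1 z2 : cabs (z1 + z2) <= cabs z1 + cabs z2.
Proof. by have := ler_normD z1 z2; rewrite -!cabsE -rmorphD lecR. Qed.

Lemma cabs_sqr z : cabs z ^+ 2 = complex.Re z ^+ 2 + complex.Im z ^+ 2.
Proof.
by case: z => a b; rewrite /cabs normc_def /= sqr_sqrtr// addr_ge0 ?sqr_ge0.
Qed.

Lemma cabs_conj z : cabs z^* = cabs z.
Proof. by apply: complexI; rewrite !cabsE norm_conjC. Qed.

Lemma mulC_conj z : z * z^* = ((cabs z) ^+ 2)%:C.
Proof. by rewrite -normCK -cabsE rmorphXn. Qed.

Lemma cabs_eq0 z : cabs z = 0 -> z = 0.
Proof. by move=> h; apply: normr0_eq0; rewrite -cabsE h. Qed.

Lemma cabs_real (r : R) : cabs r%:C = `|r|.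
Proof. by rewrite /cabs normc_def /= expr0n addr0 sqrtr_sqr. Qed.

Lemma Re_le_cabs z : complex.Re z <= cabs z.
Proof.
rewrite (le_trans (ler_norm _))// -(@ler_pXn2r _ 2) ?nnegrE ?cabs_ge0//.
by rewrite cabs_sqr real_normK ?num_real// lerDl sqr_ge0.
Qed.

Lemma complex_Re_conj z : complex.Re z^* = complex.Re z.
Proof. by case: z. Qed.

Lemma ReZ (r : R) z : complex.Re (r%:C * z) = r * complex.Re z.
Proof. by case: z => a b /=; rewrite mul0r subr0. Qed.

Lemma conj_real (r : R) : (r%:C)^* = r%:C :> R[i].
Proof. by rewrite [LHS]complexE/= oppr0 rmorph0 mulr0 addr0. Qed.

Lemma exists_phase z : exists u, [/\ cabs u = 1 & u * z = (cabs z)%:C].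
Proof.
have [->|z0] := eqVneq z 0.
  by exists 1; rewrite cabs_real normr1 mulr0 cabs_real normr0.
have a0 : cabs z != 0 by apply: contra z0 => /eqP/cabs_eq0 ->.
exists ((cabs z)^-1%:C * z^*); split.
  by rewrite cabsM cabs_conj cabs_real ger0_norm ?invr_ge0 ?cabs_ge0// mulVf.
by rewrite -mulrA [z^* * z]mulrC mulC_conj -rmorphM expr2 mulrA mulVf// mul1r.
Qed.

End ComplexModulus.

Section Hilbert.
Variables (R : realType) (H : hilbert_space R).
Implicit Types x y z : H.

Lemma dotDl x y z : inner H (x + y) z = inner H x z + inner H y z.
Proof. by rewrite linearDl. Qed.
Lemma dotDr x y z : inner H z (x + y) = inner H z x + inner H z y.
Proof. by rewrite linearDr. Qed.
Lemma dotZl (k : R[i]) x z : inner H (k *: x) z = k * inner H x z.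
Proof. by rewrite linearZl_LR. Qed.
Lemma dotZr (k : R[i]) x z : inner H z (k *: x) = k^* * inner H z x.
Proof. by rewrite linearZr_LR. Qed.
Lemma dotC x y : inner H y x = (inner H x y)^*.
Proof. by rewrite (hermC _ y x) expr0 mul1r. Qed.
Lemma dotNl x z : inner H (- x) z = - inner H x z.
Proof. by rewrite linearNl. Qed.
Lemma dotNr x z : inner H z (- x) = - inner H z x.
Proof. by rewrite linearNr. Qed.
Lemma dot0l x : inner H 0 x = 0.
Proof. by rewrite linear0l. Qed.
Lemma dot0r x : inner H x 0 = 0.
Proof. by rewrite linear0r. Qed.

Definition dotE := (dotDl, dotDr, dotNl, dotNr, dotZl, dotZr).

Lemma dotxx x : inner H x x = (cnorm x ^+ 2)%:C.
Proof. by rewrite inner_norm -cnormE rmorphXn. Qed.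

Lemma cnorm_ge0 x : 0 <= cnorm x.
Proof. exact: (is_norm_ge0 (cnorm_is_norm _)). Qed.

Lemma cnorm_eq0 x : cnorm x = 0 -> x = 0.
Proof. exact: (is_norm_eq0 (cnorm_is_norm _)). Qed.

Lemma cnormD x y : cnorm (x + y) <= cnorm x + cnorm y.
Proof. exact: (is_normD (cnorm_is_norm _)). Qed.

Lemma cnormZ (k : R[i]) x : cnorm (k *: x) = cabs k * cnorm x.
Proof. by have := normrZ k x; rewrite -cabsE -!cnormE -rmorphM => /complexI. Qed.

Lemma cnorm_sqr x : cnorm x ^+ 2 = complex.Re (inner H x x).
Proof. by rewrite dotxx. Qed.

Lemma cnormD_sqr x y :
  cnorm (x + y) ^+ 2 = cnorm x ^+ 2 + cnorm y ^+ 2 + 2 * complex.Re (inner H x y).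
Proof.
rewrite !cnorm_sqr !dotE [inner H y x]dotC !raddfD/= complex_Re_conj; lra.
Qed.

Lemma parallelogram x y :
  cnorm (x + y) ^+ 2 + cnorm (x - y) ^+ 2 = 2 * cnorm x ^+ 2 + 2 * cnorm y ^+ 2.
Proof.
rewrite !cnormD_sqr dotNr [cnorm (- y)](is_normN (cnorm_is_norm _)) raddfN/=; lra.
Qed.

Lemma Re_dot_le x y : complex.Re (inner H x y) <= cnorm x * cnorm y.
Proof.
have := cnormD_sqr x y; have := cnormD x y.
have := cnorm_ge0 x; have := cnorm_ge0 y; have := cnorm_ge0 (x + y); nra.
Qed.

Lemma cauchy_schwarz x y : cabs (inner H x y) <= cnorm x * cnorm y.
Proof.
have [u [u1 uE]] := exists_phase (inner H x y).
have := Re_dot_le (u *: x) y; rewrite dotZl uE cnormZ u1 mul1r.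
by [].
Qed.

Lemma dot_eq0 x : (forall y, inner H y x = 0) -> x = 0.
Proof.
move=> /(_ x); rewrite dotxx => /(congr1 (@complex.Re R))/= /eqP.
by rewrite expf_eq0 => /eqP/cnorm_eq0.
Qed.

(** Strict convexity of the Hilbert norm, from the parallelogram law; it is the only source of
    uniqueness in the spin and operator cases. *)
Lemma eq_of_cnorm_add x y r : cnorm x <= r -> cnorm y <= r ->
  2 * r <= cnorm (x + y) -> x = y.
Proof.
move=> xr yr xyr; apply/eqP; rewrite -subr_eq0; apply/eqP/cnorm_eq0.
have := parallelogram x y.
have := cnorm_ge0 x; have := cnorm_ge0 y; have := cnorm_ge0 (x - y).
move=> h1 h2 h3 h4; apply/eqP; rewrite -sqrf_eq0; apply/eqP.
have : 4 * r ^+ 2 <= cnorm (x + y) ^+ 2 by nra.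
have : cnorm x ^+ 2 <= r ^+ 2 by nra.
have : cnorm y ^+ 2 <= r ^+ 2 by nra.
have : 0 <= cnorm (x - y) ^+ 2 by exact: sqr_ge0.
lra.
Qed.

Variables (j : H -> H) (j_conj : conjugation j).

Lemma conjugationD x y : j (x + y) = j x + j y.
Proof. by have [jP _ _] := j_conj; have := jP 1 x y; rewrite rmorph1 !scale1r. Qed.

Lemma conjugation0 : j 0 = 0.
Proof. by have /eqP := conjugationD 0 0; rewrite addr0 -subr_eq0 opprD addrA
    subrr sub0r oppr_eq0 => /eqP. Qed.

Lemma conjugationZ (k : R[i]) x : j (k *: x) = k^* *: j x.
Proof. by have [jP _ _] := j_conj; have := jP k x 0; rewrite conjugation0 !addr0. Qed.

Lemma conjugationN x : j (- x) = - j x.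
Proof. by rewrite -scaleN1r conjugationZ rmorphN rmorph1 scaleN1r. Qed.

Lemma conjugationK x : j (j x) = x.
Proof. by have [] := j_conj. Qed.

Lemma cnorm_conjugation x : cnorm (j x) = cnorm x.
Proof. by have [_ _ jn] := j_conj; rewrite /cnorm jn. Qed.

(** A conjugation is only assumed to preserve norms: polarisation gives the real parts, and
    replacing [y] by ['i *: y] gives the imaginary parts. *)
Lemma dot_conjugation x y : inner H (j x) (j y) = (inner H x y)^*.
Proof.
have Re_eq u v : complex.Re (inner H (j u) (j v)) = complex.Re (inner H u v).
  have := cnormD_sqr (j u) (j v); have := cnormD_sqr u v.
  rewrite -conjugationD !cnorm_conjugation; lra.
have := Re_eq x y; have := Re_eq x ('i%C *: y).
rewrite conjugationZ !dotZr.
case: (inner H (j x) (j y)) (inner H x y) => a b [c d] /=.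
rewrite !(mul0r, mul1r, oppr0, sub0r, add0r, mulN1r, opprK).
move=> e1 e2; apply/eqP; rewrite eq_complex/= e2 eqxx/=; apply/eqP; lra.
Qed.

End Hilbert.

(** * Spin factors *)

Section SpinNorm.
Variables (R : realType) (H : hilbert_space R) (j : H -> H).
Hypothesis j_conj : conjugation j.
Implicit Types x y z e : H.

Let q x : R := cnorm x ^+ 2.
Let P x : R := cabs (inner H x (j x)).

Let P_le_q x : P x <= q x.
Proof.
by rewrite /P /q (le_trans (cauchy_schwarz _ _))// (cnorm_conjugation j_conj) expr2.
Qed.

Let spin_normE x :
  spin_norm j x = Num.sqrt (q x + Num.sqrt (q x ^+ 2 - P x ^+ 2)).
Proof. by rewrite /spin_norm -cnorm_sqr. Qed.

Let sq_ge0 x : 0 <= q x ^+ 2 - P x ^+ 2.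
Proof.
rewrite subr_ge0 ler_pXn2r ?nnegrE ?cabs_ge0//; exact: sqr_ge0.
Qed.

Lemma spin_norm_le1 x : spin_norm j x <= 1 ->
  cnorm x ^+ 2 <= 1 /\
  2 * cnorm x ^+ 2 - 1 <= cabs (inner H x (j x)) ^+ 2.
Proof.
rewrite spin_normE -/(q x) -/(P x) => h.
have q0 : 0 <= q x by exact: sqr_ge0.
have s0 := sqrtr_ge0 (q x ^+ 2 - P x ^+ 2).
have s1 := sqrtr_ge0 (q x + Num.sqrt (q x ^+ 2 - P x ^+ 2)).
have e1 := sqr_sqrtr (addr_ge0 q0 s0); have e2 := sqr_sqrtr (sq_ge0 x).
have qs : q x + Num.sqrt (q x ^+ 2 - P x ^+ 2) <= 1 by rewrite -e1 expr_le1.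
split; first by lra.
have : Num.sqrt (q x ^+ 2 - P x ^+ 2) ^+ 2 <= (1 - q x) ^+ 2.
  by rewrite ler_pXn2r ?nnegrE//; lra.
by rewrite e2; lra.
Qed.

Lemma spin_norm_eq1 x : spin_norm j x = 1 ->
  cabs (inner H x (j x)) ^+ 2 = 2 * cnorm x ^+ 2 - 1.
Proof.
rewrite spin_normE -/(q x) -/(P x) => h.
have q0 : 0 <= q x by exact: sqr_ge0.
have s0 := sqrtr_ge0 (q x ^+ 2 - P x ^+ 2).
have := sqr_sqrtr (addr_ge0 q0 s0); rewrite h expr1n => e1.
have := sqr_sqrtr (sq_ge0 x).
rewrite (_ : Num.sqrt _ = 1 - q x); last by lra.
by move=> ?; lra.
Qed.

(** On isotropic vectors the spin norm is a multiple of the Hilbert norm, which is why the faces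
    below are euclidean. *)
Lemma spin_norm_isotropic x : inner H x (j x) = 0 ->
  spin_norm j x = Num.sqrt 2 * cnorm x.
Proof.
rewrite spin_normE /P => ->; rewrite (cabs_real 0) normr0 expr0n subr0.
rewrite sqrtr_sqr ger0_norm ?sqr_ge0// -mulr2n -[q x *+ 2]mulr_natl sqrtrM//.
by rewrite /q sqrtr_sqr ger0_norm// cnorm_ge0.
Qed.

(* [e / 2] is a minimal tripotent; the vectors of the unit ball on which the
   functional [<., e>] has modulus 1 form discs in the directions [j e]. *)
Lemma spin_norm_face x e : inner H e e = 2 -> inner H e (j e) = 0 ->
  spin_norm j x <= 1 -> 1 <= cabs (inner H x e) ->
  cabs (inner H x e) = 1 /\
  x = (inner H x e / 2) *: e + (inner H x (j e) / 2) *: j e.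
Proof.
move=> ee eje /spin_norm_le1[].
have [a aE] : exists a, inner H x e = a * 2 by exists (inner H x e / 2); field.
have [b bE] : exists b, inner H x (j e) = b * 2.
  by exists (inner H x (j e) / 2); field.
rewrite aE bE !mulfK//.
have jee : inner H (j e) e = 0 by rewrite dotC eje rmorph0.
have jeje : inner H (j e) (j e) = 2.
  by rewrite (dot_conjugation j_conj) ee rmorph_nat.
(* The component of [x] orthogonal to [e] and [j e]; the aim is to show that it vanishes. *)
pose g := x - (a *: e + b *: j e).
have ge : inner H g e = 0 by rewrite /g !dotE ee jee aE; ring.
have gje : inner H g (j e) = 0 by rewrite /g !dotE eje jeje bE; ring.
have xE : x = g + (a *: e + b *: j e) by rewrite /g subrK.
clearbody g.
have eg : inner H e g = 0 by rewrite dotC ge rmorph0.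
have jeg : inner H (j e) g = 0 by rewrite dotC gje rmorph0.
have jge : inner H (j g) e = 0.
  by rewrite -[e](conjugationK j_conj) (dot_conjugation j_conj) gje rmorph0.
have jgje : inner H (j g) (j e) = 0 by rewrite (dot_conjugation j_conj) ge rmorph0.
have ejg : inner H e (j g) = 0 by rewrite dotC jge rmorph0.
have jejg : inner H (j e) (j g) = 0 by rewrite dotC jgje rmorph0.
have cabs2 (z : R[i]) : cabs (z * 2) = 2 * cabs z.
  by rewrite mulrC cabsM -[2 in LHS](rmorph_nat (real_complex R)) cabs_real ger0_norm.
have qx : cnorm x ^+ 2 = cabs (a * 2) ^+ 2 / 2 + cabs (b * 2) ^+ 2 / 2 + cnorm g ^+ 2.
  have -> : cabs (a * 2) ^+ 2 / 2 + cabs (b * 2) ^+ 2 / 2 + cnorm g ^+ 2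
    = cnorm g ^+ 2 + (cabs a ^+ 2 + cabs a ^+ 2 + (cabs b ^+ 2 + cabs b ^+ 2)).
    by rewrite !cabs2; field.
  apply: complexI; rewrite -dotxx {1 2}xE !dotE ge gje eg jeg ee eje jee jeje.
  by rewrite dotxx !rmorphD/= -!mulC_conj; ring.
have px : inner H x (j x) = (a * 2) * (b * 2) + inner H g (j g).
  rewrite {1 2}xE !(conjugationD j_conj) !(conjugationZ j_conj).
  rewrite (conjugationK j_conj) !dotE ge gje ee eje jee jeje.
  by rewrite ejg jejg !conjCK; ring.
have gg : cabs (inner H g (j g)) <= cnorm g ^+ 2.
  by rewrite (le_trans (cauchy_schwarz _ _))// (cnorm_conjugation j_conj) expr2.
have pb : cabs (inner H x (j x)) <= cabs (a * 2) * cabs (b * 2) + cnorm g ^+ 2.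
  by rewrite px (le_trans (cabsD _ _))// cabsM lerD2l.
rewrite qx; have G0 : 0 <= cnorm g ^+ 2 := sqr_ge0 _.
have p0 := cabs_ge0 (inner H x (j x)); have b0 := cabs_ge0 (b * 2).
set G := cnorm g ^+ 2 in pb G0 *; set A := cabs (a * 2) in pb *; set B := cabs
    (b * 2) in pb b0 *.
set p := cabs (inner H x (j x)) in pb p0 *.
move=> q1 pq A1.
have p2 : p ^+ 2 <= (A * B + G) ^+ 2 by rewrite ler_pXn2r ?nnegrE// (le_trans p0).
have B1 : B ^+ 2 <= 1 by nra.
have AB : A * B <= 1 - G by have := sqr_ge0 (A - B); nra.
(* Inserting [qx] and [p <= A * B + G] into the unit-ball inequality gives the left side at most
   [- 2 * G * (1 - G - A * B)]. As [A >= 1 >= B], both summands are nonnegative and hence zero. *)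
have main : (A ^+ 2 - 1) * (1 - B ^+ 2) + G ^+ 2 <= 0.
  have : 0 <= G * (1 - G - A * B) by rewrite mulr_ge0//; lra.
  by nra.
have A21 : 0 <= A ^+ 2 - 1 by nra.
have B21 : 0 <= 1 - B ^+ 2 by lra.
have AB0 : 0 <= (A ^+ 2 - 1) * (1 - B ^+ 2) by exact: mulr_ge0.
have G2 : G ^+ 2 = 0.
  by apply/eqP; rewrite eq_le sqr_ge0 andbT; lra.
have GE : G = 0 by apply/eqP; rewrite -sqrf_eq0 G2.
split.
  have : A ^+ 2 <= 1.
    rewrite leNgt; apply/negP => A2.
    have B2 : 1 - B ^+ 2 <= 0.
      have : (A ^+ 2 - 1) * (1 - B ^+ 2) <= 0 by rewrite G2 in main; lra.
      by rewrite pmulr_rle0// subr_gt0.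
    have : A ^+ 2 <= 1 by lra.
    by rewrite leNgt A2.
  by move=> ?; apply/eqP; rewrite eq_le A1 andbT; nra.
have : g = 0 by apply: cnorm_eq0; apply/eqP; rewrite -sqrf_eq0 -/G GE.
by rewrite {1}xE => ->; rewrite add0r.
Qed.

(** The norm condition reads [P2 = 2 * cnorm z ^+ 2 - 1], which makes [w = z - p *: j z] isotropic;
    it remains to scale [w], and [1 - P2] is nonzero exactly because [cnorm z] is not 1. *)
Lemma spin_norm_attained z : spin_norm j z = 1 -> cnorm z ^+ 2 != 1 ->
  exists e, [/\ inner H e e = 2, inner H e (j e) = 0 & inner H z e = 1].
Proof.
move=> /spin_norm_eq1; set p := inner H z (j z) => pz q1.
set P2 := cabs p ^+ 2 in pz *.
have P1 : 1 - P2 != 0.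
  by apply: contra q1 => /eqP h; apply/eqP; lra.
have qz : inner H z z = ((1 + P2) / 2)%:C by rewrite dotxx; congr (_%:C); lra.
have jzz : inner H (j z) z = p^* by rewrite dotC.
have jzjz : inner H (j z) (j z) = ((1 + P2) / 2)%:C.
  by rewrite (dot_conjugation j_conj) qz conj_real.
have pp : p * p^* = P2%:C by rewrite mulC_conj.
have two : 2 = (2 : R)%:C :> R[i] by rewrite rmorph_nat.
have one : 1 = (1 : R)%:C :> R[i] by rewrite rmorph1.
pose w := z - p *: j z.
have jw : j w = j z - p^* *: z.
  by rewrite /w (conjugationD j_conj) (conjugationN j_conj) (conjugationZ j_conj)
    (conjugationK j_conj).
have ww : inner H w w = ((1 - P2) ^+ 2 / 2)%:C.
  rewrite /w !dotE qz jzz jzjz -/p.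
  transitivity (((1 + P2) / 2)%:C - p * p^* * 2 + p * p^* * ((1 + P2) / 2)%:C).
    by ring.
  rewrite pp two -!rmorphM -rmorphB -rmorphD.
  by congr (_%:C); field.
have wjw : inner H w (j w) = 0.
  rewrite jw /w !dotE conjCK qz jzz jzjz -/p.
  transitivity (p * (1 + p * p^* - ((1 + P2) / 2)%:C - ((1 + P2) / 2)%:C)).
    by ring.
  rewrite pp one -addrA -opprD -!rmorphD -rmorphB.
  by rewrite (_ : _ - _ = 0) ?rmorph0 ?mulr0//; field.
have zw : inner H z w = ((1 - P2) / 2)%:C.
  by rewrite /w !dotE qz -/p [p^* * p]mulrC pp -rmorphB; congr (_%:C); field.
exists ((2 / (1 - P2))%:C *: w); split.
- rewrite dotZl dotZr conj_real ww -!rmorphM/= two.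
  by congr (_%:C); field.
- by rewrite (conjugationZ j_conj) dotZl dotZr wjw !mulr0.
- rewrite dotZr conj_real zw -rmorphM one.
  by congr (_%:C); field.
Qed.

(* Each face of the unit ball is a euclidean disc, hence strictly convex. *)
Lemma spin_midpoint x y m : spin_norm j x <= 1 -> spin_norm j y <= 1 ->
  spin_norm j m <= 1 ->
  spin_norm j (3^-1 *: (x + y + m)) = 1 ->
  spin_norm j (m - x) <= spin_norm j (x - y) / 2 ->
  spin_norm j (y - m) <= spin_norm j (x - y) / 2 -> m - x = y - m.
Proof.
move=> x1 y1 m1 z1.
(* The Hilbert norm is at most 1 on the spin ball; if the barycentre reaches 1, strict convexity
   makes the three points equal. *)
have [zq|zq] := eqVneq (cnorm (3^-1 *: (x + y + m)) ^+ 2) 1.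
  have n1 u : spin_norm j u <= 1 -> cnorm u <= 1.
    by move=> /spin_norm_le1[]; have := cnorm_ge0 u; nra.
  have n3 : cnorm (x + y + m) = 3.
    move: zq; rewrite cnormZ -[3](rmorph_nat (real_complex R) 3%N) -fmorphV cabs_real.
    rewrite ger0_norm ?invr_ge0//; have := cnorm_ge0 (x + y + m); nra.
  have nx := n1 _ x1; have ny := n1 _ y1; have nm := n1 _ m1.
  have xy : x = y.
    apply: (@eq_of_cnorm_add _ _ _ _ 1) => //.
    by have := cnormD (x + y) m; lra.
  have xm : x = m.
    apply: (@eq_of_cnorm_add _ _ _ _ 1) => //.
    by have := cnormD (x + m) y; rewrite addrAC; lra.
  by move=> _ _; rewrite -xy -xm.
have [e [ee eje ze]] := spin_norm_attained z1 zq.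
have le1 u : spin_norm j u <= 1 -> complex.Re (inner H u e) <= 1.
  move=> u1; apply: le_trans (Re_le_cabs _) _.
  by have [/ltW//|h] := ltP (cabs (inner H u e)) 1; have [-> _] :=
      spin_norm_face ee eje u1 h.
(* Three real parts, each at most 1, add up to 3, so all three points lie on the face of [e] and
   their differences are multiples of the isotropic [j e]. *)
have sum3 : complex.Re (inner H x e) + complex.Re (inner H y e) + complex.Re
    (inner H m e) = 3.
  move: ze; rewrite dotZl !dotDl => /(congr1 (fun c : R[i] => complex.Re (3 * c))).
  by rewrite mulrA divff// mul1r mulr1 !raddfD.
have face u : spin_norm j u <= 1 -> complex.Re (inner H u e) = 1 ->
    u = (1 / 2) *: e + (inner H u (j e) / 2) *: j e.
  move=> u1 Ru; have h : 1 <= cabs (inner H u e) by rewrite -Ru Re_le_cabs.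
  have [c1 uE] := spin_norm_face ee eje u1 h.
  rewrite {1}uE; congr (_ / 2 *: _ + _).
  have := cabs_sqr (inner H u e); rewrite c1 Ru expr1n => c2.
  have Im0 : complex.Im (inner H u e) = 0 by apply/eqP; rewrite -sqrf_eq0;
      apply/eqP; lra.
  by case: (inner H u e) Ru Im0 => c d /= -> ->.
have ex := le1 _ x1; have ey := le1 _ y1; have em := le1 _ m1.
have rx : complex.Re (inner H x e) = 1 by lra.
have ry : complex.Re (inner H y e) = 1 by lra.
have rm : complex.Re (inner H m e) = 1 by lra.
have iso u v : spin_norm j u <= 1 -> spin_norm j v <= 1 ->
    complex.Re (inner H u e) = 1 -> complex.Re (inner H v e) = 1 ->
    spin_norm j (u - v) = Num.sqrt 2 * cnorm (u - v).
  move=> u1 v1 ue ve; apply: spin_norm_isotropic.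
  have -> : u - v = (inner H u (j e) / 2 - inner H v (j e) / 2) *: j e.
    by rewrite {1}(face _ u1 ue) {1}(face _ v1 ve) scalerBl opprD addrACA subrr add0r.
  rewrite (conjugationZ j_conj) (conjugationK j_conj) dotZl dotZr [inner H (j
      e) e]dotC eje.
  by rewrite rmorph0 !mulr0.
rewrite !iso//.
have s2 : 0 < Num.sqrt 2 :> R by rewrite sqrtr_gt0.
rewrite -!mulrA !ler_pM2l// => h1 h2.
apply: (eq_of_cnorm_add h1 h2).
rewrite (_ : m - x + (y - m) = - (x - y)); last by rewrite addrC addrA subrK opprB.
rewrite (is_normN (cnorm_is_norm _)); lra.
Qed.

End SpinNorm.

Section SpinFaces.
Variables (R : realType) (K : jbstar_triple R) (Y : completeNormedModType R).
Variable Delta : K -> Y.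
Hypothesis Delta_sphere : set_fun (unit_sphere K) (unit_sphere Y) Delta.
Hypothesis Delta_surj : set_surj (unit_sphere K) (unit_sphere Y) Delta.
Hypothesis Delta_isometry : forall x y, unit_sphere K x -> unit_sphere K y ->
  `|Delta x - Delta y| = cnorm (x - y).

Notation X := (realified K).
Let N : X -> R := @cnorm R K.
Let T : X -> Y := Delta.
Let N_norm : is_norm N := cnorm_is_norm K.

(** The preimage [m] of the midpoint has distance [N (u - v) / 2] from [u] and from [v], and the
    barycentre of the three points is in [F]. Metric midpoints in a disc are unique, so
    [spin_midpoint] determines [m]. *)
Lemma spin_affine (C : set X) (H : hilbert_space R) (j : H -> H) tp x y (t : R) :
  conjugation j -> realized_as K setT (spin_norm j) tp ->
  sphere_convex N C -> C x -> C y -> 0 <= t <= 1 ->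
  T (t *: x + (1 - t) *: y) = t *: T x + (1 - t) *: T y.
Proof.
move=> j_conj [Phi [[_ Phi_inj _] Phi_norm _]] sC Cx Cy tP.
have [F [CF sF starF]] := exists_star_closed N_norm sC (ex_intro _ x Cx).
have T_iso : forall a b : X, F a -> F b -> `|T a - T b| = N (a - b).
  exact: (sphere_convex_isometry Delta_isometry sF).
apply: (midpoint_affine N_norm sF.2 T_iso) => //; [|exact: CF..].
move=> u v Fu Fv.
have [m Fm] := star_closed_mid Delta_sphere Delta_surj Delta_isometry sF starF Fu Fv.
rewrite -/(T m) -/(T u) -/(T v) => Tm.
have half w w' : F w -> F w' -> T m - T w = 2^-1 *: (T w' - T w) ->
    N (m - w) = N (w' - w) / 2.
  move=> Fw Fw' e; rewrite -!T_iso// e normrZ gtr0_norm ?invr_gt0//; lra.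
have mu : N (m - u) = N (u - v) / 2.
  rewrite (is_norm_dist N_norm u); apply: half => //.
  by rewrite Tm; lincomb R Y.
have mv : N (m - v) = N (u - v) / 2.
  by apply: half => //; rewrite Tm; lincomb R Y.
suff mE : m - u = v - m.
  rewrite -Tm; congr (T _); rewrite -scalerDr; apply: esym.
  transitivity (2^-1 *: (m + m)); first by lincomb R (realified K : lmodType R).
  congr (_ *: _); apply/eqP; rewrite -subr_eq0.
  rewrite (_ : _ - _ = (m - u) - (v - m)); last by lincomb R (realified K : lmodType R).
  by rewrite mE subrr.
have Phi1 w : F w -> spin_norm j (Phi w) <= 1 by move=> Fw; rewrite -Phi_norm
    (sF.1 w Fw : cnorm w = 1).
have PhiE : Phi m - Phi u = Phi v - Phi m.
  apply: (spin_midpoint j_conj); try exact: Phi1.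
  - have Fz : F (3^-1 *: u + (1 - 3^-1) *: (2^-1 *: v + 2^-1 *: m)).
      by apply: sF.2 => //; [exact: (convex_mid sF.2)|lra].
    rewrite -(sF.1 _ Fz) /N Phi_norm; congr (spin_norm j _).
    have -> : 3^-1 *: u + (1 - 3^-1) *: (2^-1 *: v + 2^-1 *: m) = 3^-1 *: (u + v + m).
      by lincomb R (realified K : lmodType R).
    rewrite real_scaleE linearZ/= !raddfD/= fmorphV rmorph_nat.
    by [].
  - by rewrite -!raddfB -!Phi_norm -[cnorm _]/(N (m - u)) mu.
  - by rewrite -!raddfB -!Phi_norm -[cnorm _]/(N (v - m)) (is_norm_dist N_norm) mv.
by apply: Phi_inj; rewrite ?inE// !raddfB.
Qed.

End SpinFaces.

(** * Compact operators *)

Section ComplexNormTopology.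
Variables (R : realType) (E : normedModType R[i]).

Lemma ltr0c_Re (e : R[i]) : 0 < e -> 0 < complex.Re e /\ e = (complex.Re e)%:C.
Proof. by case: e => a b; rewrite ltcE/= => /andP[/eqP -> ?]. Qed.

Lemma nbhs_cnormP (x : E) (A : set E) :
  nbhs x A <-> exists2 e : R, 0 < e & forall y, cnorm (x - y) < e -> A y.
Proof.
split=> [/nbhs_ballP[e /ltr0c_Re[e0 eE] xA]|[e e0 xA]].
  exists (complex.Re e) => // y xy; apply: xA.
  by rewrite -ball_normE /ball_/= -cnormE eE ltcR.
apply/nbhs_ballP; exists e%:C => /=; first by rewrite ltcR.
by move=> y; rewrite -ball_normE /ball_/= -cnormE ltcR => /xA.
Qed.

Lemma cnormB_le (x y : E) : cnorm x - cnorm y <= cnorm (x - y).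
Proof.
have := is_normD (cnorm_is_norm E) (x - y) y.
by rewrite -[_ + _]/((x - y : E) + y) subrK lerBlDr.
Qed.

Lemma cnorm_distC (x y : E) : cnorm (x - y) = cnorm (y - x).
Proof. exact: (is_norm_dist (cnorm_is_norm E)). Qed.

Lemma cnorm_continuous : continuous (@cnorm R E).
Proof.
move=> x; apply/cvgrPdist_lt => e e0.
apply/nbhs_cnormP; exists e => // y xy; apply: le_lt_trans xy.
rewrite ler_norml cnormB_le andbT lerNl opprB cnorm_distC; exact: cnormB_le.
Qed.

Lemma closure_cnorm (A : set E) y (e : R) : closure A y -> 0 < e ->
  exists2 x, A x & cnorm (y - x) < e.
Proof.
move=> Ay e0; have /Ay[x [Ax xy]] : nbhs y [set x | cnorm (y - x) < e].
  by apply/nbhs_cnormP; exists e.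
by exists x.
Qed.

End ComplexNormTopology.

Lemma cauchy_cnorm_cvg (R : realType) (E : completeNormedModType R[i]) (a : nat -> E) :
  (forall e : R, 0 < e -> exists n, forall m, (n <= m)%N -> cnorm (a n - a m) <= e) ->
  exists x, forall e : R, 0 < e -> exists n, forall m, (n <= m)%N -> cnorm (x -
      a m) <= e.
Proof.
move=> ca; have : cvg (a @ \oo).
  apply/cauchy_cvgP/cauchy_exP => e /ltr0c_Re[e0 eE].
  have [n an] := ca (complex.Re e / 2) ltac:(lra).
  exists (a n), n => // m /= nm; rewrite -ball_normE /ball_/= -cnormE eE ltcR.
  by have := an m nm; lra.
move=> /cvg_ex[x ax]; exists x => e e0.
have /ax[n _ an] : nbhs x [set y | cnorm (x - y) < e].
  by apply/nbhs_cnormP; exists e.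
by exists n => m nm; apply: ltW; exact: an.
Qed.

Section CompactOperators.
Variables (R : realType) (H1 H2 : hilbert_space R).
Implicit Types f g : H1 -> H2.

Definition op_bound f (s : R) := forall a, cnorm (f a) <= s * cnorm a.

Lemma unit_ballP (x : H1) : `|x| <= 1 <-> cnorm x <= 1.
Proof. by rewrite -cnormE -(rmorph1 (real_complex R)) lecR. Qed.

Section Linear.
Variables (f : H1 -> H2) (f_lin : linear f).

Lemma lin_add x y : f (x + y) = f x + f y.
Proof. by have := f_lin 1 x y; rewrite !scale1r. Qed.

Lemma lin0 : f 0 = 0.
Proof. by have /eqP := lin_add 0 0; rewrite addr0 -subr_eq0 opprD addrA subrr
    sub0r oppr_eq0 => /eqP. Qed.

Lemma lin_scale (k : R[i]) x : f (k *: x) = k *: f x.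
Proof. by have := f_lin k x 0; rewrite lin0 !addr0. Qed.

Lemma lin_opp x : f (- x) = - f x.
Proof. by rewrite -scaleN1r lin_scale scaleN1r. Qed.

Lemma lin_sub x y : f (x - y) = f x - f y.
Proof. by rewrite lin_add lin_opp. Qed.

End Linear.

(* A maximizing sequence is Cauchy by the parallelogram law once its images
   converge. *)
Lemma compact_op_attained f : compact_op f ->
  exists2 xi, cnorm xi <= 1 & op_bound f (cnorm (f xi)).
Proof.
move=> [f_lin]; rewrite precompactE; set B := [set x : H1 | _].
set C := closure _ => cC.
have B0 : B 0 by rewrite /B/= normr0.
have CB x : cnorm x <= 1 -> C (f x).
  by move=> /unit_ballP x1; apply: subset_closure; exists x.
have [||y0 /[!inE] Cy0 maxy0] := compact_EVT_max _ cC (f := @cnorm R H2).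
- by exists (f 0); apply: subset_closure; exists 0.
- by apply: continuous_subspaceT; exact: cnorm_continuous.
pose M := cnorm y0.
have fM : op_bound f M.
  move=> a; have [->|a0] := eqVneq a 0.
    rewrite (lin0 f_lin) !(is_norm0 (cnorm_is_norm _)); lra.
  have na : 0 < cnorm a.
    by rewrite lt0r cnorm_ge0 andbT; apply: contra a0 => /eqP/cnorm_eq0 ->.
  have : cnorm (f ((cnorm a)^-1%:C *: a)) <= M.
    apply: maxy0; rewrite inE; apply: CB.
    by rewrite cnormZ cabs_real ger0_norm ?invr_ge0 ?cnorm_ge0// mulVf// gt_eqF.
  rewrite (lin_scale f_lin) cnormZ cabs_real ger0_norm ?invr_ge0 ?cnorm_ge0//.
  by rewrite ler_pdivrMl// mulrC.
(* The Cauchy argument divides by [M]; if [M = 0] then [f] vanishes and every vector norms it. *)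
have [M0|M0] := eqVneq M 0.
  exists 0; first by rewrite (is_norm0 (cnorm_is_norm _)).
  rewrite (lin0 f_lin) (is_norm0 (cnorm_is_norm _)) => a.
  by have := fM a; rewrite M0.
have {M0}Mgt0 : 0 < M by rewrite lt0r M0 cnorm_ge0.
have /choice[a aP] : forall n, exists x, cnorm x <= 1 /\ cnorm (y0 - f x) < n.+1%:R^-1.
  move=> n; have [|_ [x /unit_ballP x1 <-] xy] := closure_cnorm (e := n.+1%:R^-1) Cy0.
    by rewrite invr_gt0.
  by exists x.
have small (e : R) : 0 < e -> exists n, n.+1%:R^-1 <= e.
  move=> e0; exists (Num.Def.archi_bound e^-1).
  rewrite invf_ple ?posrE// ltW// (lt_le_trans (archi_boundP _))//.
    by rewrite invr_ge0 ltW.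
  by rewrite ler_nat.
have mono n m : (n <= m)%N -> m.+1%:R^-1 <= n.+1%:R^-1 :> R.
  by move=> nm; rewrite lef_pV2 ?posrE// ler_nat.
have near_sum n m : (n <= m)%N ->
    M * cnorm (a n + a m) >= 2 * M - 2 * n.+1%:R^-1.
  move=> nm; apply: le_trans (fM _); rewrite (lin_add f_lin).
  have [_ an] := aP n; have [_ am] := aP m; have := mono _ _ nm.
  have := cnormB_le (y0 + y0) (y0 + y0 - (f (a n) + f (a m))).
  rewrite opprB addrCA subrr addr0.
  have : cnorm (y0 + y0) = 2 * M.
    have -> : y0 + y0 = (2 : R)%:C *: y0 by rewrite rmorph_nat scaler_nat mulr2n.
    by rewrite cnormZ cabs_real ger0_norm.
  have : cnorm (y0 + y0 - (f (a n) + f (a m))) <= cnorm (y0 - f (a n)) + cnorm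
      (y0 - f (a m)).
    by rewrite opprD addrACA; exact: cnormD.
  by move: an am; move: (n.+1%:R^-1 : R) (m.+1%:R^-1 : R) => dn dm; lra.
have [e e0|xi xiP] := @cauchy_cnorm_cvg _ _ a.
  (* The bound [M * e ^+ 2 / 8] gives [cnorm (a n + a m) >= 2 - e ^+ 2 / 4], whose square is at
     least [4 - e ^+ 2]; the parallelogram law then leaves at most [e ^+ 2] for the difference. *)
  pose d := Num.min 1 (M * e ^+ 2 / 8).
  have d0 : 0 < d by rewrite lt_min ltr01/= !mulr_gt0// ?exprn_gt0 ?invr_gt0.
  have [n nd] := small d d0; exists n => m nm.
  move: nd; rewrite /d le_min => /andP[dn0 dM].
  have sum_ge : 2 - e ^+ 2 / 4 <= cnorm (a n + a m).
    rewrite -(ler_pM2l Mgt0); apply: le_trans (near_sum n m nm).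
    by move: dM; move: (n.+1%:R^-1 : R) => dn dM; lra.
  have [an1 _] := aP n; have [am1 _] := aP m.
  rewrite -(@ler_pXn2r _ 2) ?nnegrE ?cnorm_ge0 ?(ltW e0)//.
  have par := parallelogram (a n) (a m).
  have an2 : cnorm (a n) ^+ 2 <= 1 by rewrite expr_le1// cnorm_ge0.
  have am2 : cnorm (a m) ^+ 2 <= 1 by rewrite expr_le1// cnorm_ge0.
  have t2 : 4 - e ^+ 2 <= cnorm (a n + a m) ^+ 2.
    have := cnorm_ge0 (a n + a m); move: sum_ge; move: (cnorm _) => t.
    have [e8|e8] := leP (e ^+ 2) 8; last by have := sqr_ge0 t; lra.
    by have := sqr_ge0 (e ^+ 2); nra.
  lra.
have xi1 : cnorm xi <= 1.
  apply/ler_addgt0Pr => e /xiP[n /(_ n (leqnn n)) xn].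
  have := cnormB_le xi (a n); have [] := aP n; lra.
exists xi => //; suff -> : cnorm (f xi) = M by [].
apply/eqP; rewrite eq_le; apply/andP; split.
  by apply: le_trans (fM _) _; rewrite ler_piMr// ltW.
apply/ler_addgt0Pr => e e0.
have [n xn] := xiP (e / (2 * M)) ltac:(by rewrite divr_gt0// mulr_gt0).
have [k ke] := small (e / 2) ltac:(by lra).
pose m := maxn n k; have {xn}xm := xn m (leq_maxl _ _).
have [_ ym] := aP m; have mk := mono k m (leq_maxr _ _).
have h1 := cnormB_le y0 (f (a m)); have h2 := cnormB_le (f (a m)) (f xi).
have h3 : cnorm (f (a m) - f xi) <= e / 2.
  rewrite -(lin_sub f_lin) (le_trans (fM _))// cnorm_distC.
  rewrite (_ : e / 2 = M * (e / (2 * M))) ?ler_pM2l//.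
  by field; rewrite gt_eqF.
rewrite -/M in h1.
have {}ym : cnorm (y0 - f (a m)) <= e / 2 by rewrite (le_trans (ltW ym))//
    (le_trans mk).
lra.
Qed.

End CompactOperators.

Definition rank_sum (R : realType) (H1 H2 : hilbert_space R)
    (l : seq (H1 * H2)) (a : H1) : H2 :=
  \sum_(q <- l) inner H1 a q.1 *: q.2.

Section OperatorNorm.
Variables (R : realType) (H1 H2 : hilbert_space R).
Implicit Types f g : H1 -> H2.

Lemma op_normP f : compact_op f -> op_bound f (op_norm f) /\
  exists2 xi, cnorm xi <= 1 & cnorm (f xi) = op_norm f.
Proof.
move=> cf; have [xi xi1 fxi] := compact_op_attained cf.
suff -> : op_norm f = cnorm (f xi) by split => //; exists xi.
have le_xi x : `|x| <= 1 -> cnorm (f x) <= cnorm (f xi).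
  move=> /unit_ballP x1; apply: le_trans (fxi x) _.
  by rewrite ler_piMr// cnorm_ge0.
have Sxi : [set cnorm (f x) | x in [set x : H1 | `|x| <= 1]] (cnorm (f xi)).
  by exists xi => //; exact/unit_ballP.
apply/eqP; rewrite eq_le; apply/andP; split.
  by apply: ge_sup => [|_ [x x1 <-]]; [exists (cnorm (f xi))|exact: le_xi].
apply: ub_le_sup => //; exists (cnorm (f xi)) => _ [x x1 <-]; exact: le_xi.
Qed.

Lemma op_norm_le f s : compact_op f -> 0 <= s -> op_bound f s -> op_norm f <= s.
Proof.
move=> cf s0 fs; have [_ [xi xi1 <-]] := op_normP cf.
by apply: le_trans (fs xi) _; rewrite ler_piMr.
Qed.

Lemma op_norm_attained f : compact_op f -> op_norm f = 1 ->
  exists2 xi, cnorm xi = 1 & cnorm (f xi) = 1.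
Proof.
move=> cf f1; have [fb [xi xi1 fxi]] := op_normP cf; rewrite f1 in fxi fb.
exists xi => //; apply/eqP; rewrite eq_le xi1/=.
by have := fb xi; rewrite fxi mul1r.
Qed.

Lemma quadratic_tangent (r c : R) :
  (forall t : R, 2 * t * r <= t ^+ 2 * c) -> r = 0.
Proof.
move=> h; pose C := `|c| + 1.
have C0 : 0 < C by rewrite ltr_wpDl.
have cC : c <= C by rewrite /C (le_trans (ler_norm c))// lerDl.
have := h (r / C).
have -> : 2 * (r / C) * r = 2 * C * (r / C) ^+ 2 by field; rewrite gt_eqF.
rewrite mulrC => h'.
have : (r / C) ^+ 2 <= 0.
  have := sqr_ge0 (r / C); nra.
move=> r0; have : (r / C) ^+ 2 = 0 by apply/eqP; rewrite eq_le r0 sqr_ge0.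
move=> /eqP; rewrite sqrf_eq0 mulf_eq0 invr_eq0 (gt_eqF C0) orbF.
by move=> /eqP.
Qed.

(* First variation of the ratio [cnorm (f a) / cnorm a] at its maximum. *)
Lemma dot_norming f s xi a : linear f -> op_bound f s -> cnorm xi = 1 ->
  cnorm (f xi) = s -> inner H2 (f a) (f xi) = (s ^+ 2)%:C * inner H1 a xi.
Proof.
move=> f_lin fs xi1 fxi.
have real b : inner H1 xi b = 0 -> complex.Re (inner H2 (f xi) (f b)) = 0.
  move=> xib; apply: (@quadratic_tangent _ (s ^+ 2 * cnorm b ^+ 2 - cnorm (f b)
      ^+ 2)) => t.
  have : cnorm (f (xi + t%:C *: b)) ^+ 2 <= s ^+ 2 * cnorm (xi + t%:C *: b) ^+ 2.
    rewrite -exprMn ler_pXn2r ?nnegrE ?cnorm_ge0//.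
    by rewrite mulr_ge0// -?fxi cnorm_ge0.
  rewrite (lin_add f_lin) (lin_scale f_lin) !cnormD_sqr xi1 fxi !dotZr xib mulr0.
  rewrite !cnormZ cabs_real !exprMn real_normK ?num_real// conj_real ReZ /=.
  lra.
have orth b : inner H1 b xi = 0 -> inner H2 (f b) (f xi) = 0.
  move=> bxi; have [u [_ uE]] := exists_phase (inner H2 (f b) (f xi)).
  apply: cabs_eq0; have := real (u *: b).
  rewrite dotZr [inner H1 xi b]dotC bxi rmorph0 mulr0 => /(_ erefl).
  by rewrite -complex_Re_conj -dotC (lin_scale f_lin) dotZl uE.
have := orth (a - inner H1 a xi *: xi).
rewrite !dotE dotxx xi1 expr1n mulr1 subrr => /(_ erefl).
rewrite (lin_sub f_lin) (lin_scale f_lin) !dotE dotxx fxi => /eqP.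
by rewrite subr_eq0 mulrC => /eqP.
Qed.

Lemma norming_isometry f xi a : linear f -> op_bound f 1 -> cnorm xi = 1 ->
  cnorm (f xi) = 1 -> inner H2 (f a) (f xi) = inner H1 a xi.
Proof.
by move=> f_lin f1 xi1 fxi; rewrite (dot_norming _ f_lin f1 xi1 fxi) expr1n mul1r.
Qed.

Lemma compact_op_add f g : compact_op f -> compact_op g -> compact_op (f + g).
Proof.
move=> [f_lin cf] [g_lin cg]; split.
  move=> k x y; rewrite -[(f + g) _]/(f (k *: x + y) + g (k *: x + y)) f_lin g_lin.
  by rewrite addrACA -scalerDr.
rewrite !precompactE in cf cg.
have cK := compact_setX cf cg.
have cI : compact ((fun z : H2 * H2 => z.1 + z.2) @` (closure (f @` [set x | `|x| <= 1])
    `*` closure (g @` [set x | `|x| <= 1]))).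
  apply: continuous_compact cK; apply: continuous_subspaceT; exact: add_continuous.
apply: precompact_subset (compact_precompact (@norm_hausdorff _ H2) cI).
move=> _ [x x1 <-]; exists (f x, g x) => //.
by split; apply: subset_closure; exists x.
Qed.

(** Stated for a bounded functional that no vector represents yet, since [riesz] is derived from it.
    The image of the ball lies in the image of a square under a continuous map. *)
Lemma compact_op_functional (g : H1 -> R[i]) (w : H2) C :
  (forall (k : R[i]) x y, g (k *: x + y) = k * g x + g y) ->
  (forall a, cabs (g a) <= C * cnorm a) -> compact_op (fun a => g a *: w).
Proof.
move=> g_lin gC; split; first by move=> k x y; rewrite g_lin scalerDl scalerA.
have cont (v : H2) : continuous (fun s : R => s%:C *: v).
  move=> s A /nbhs_cnormP[e e0 sA].
  have v1 : 0 < cnorm v + 1 by rewrite ltr_wpDl// cnorm_ge0.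
  apply/nbhs_ballP; exists (e / (cnorm v + 1)) => /=; first exact: divr_gt0.
  move=> t; rewrite -ball_normE /ball_/= => st; apply: sA.
  rewrite -scalerBl -rmorphB cnormZ cabs_real.
  apply: le_lt_trans (_ : `|s - t| * (cnorm v + 1) < e).
    by rewrite ler_wpM2l// lerDl.
  by rewrite -ltr_pdivlMr.
pose I := `[(- `|C|), `|C| ]%classic.
have cI : compact ((fun p : R * R => p.1%:C *: w + p.2%:C *: ('i%C *: w)) @` (I `*` I)).
  apply: continuous_compact; last exact: compact_setX (@segment_compact _ _ _)
      (@segment_compact _ _ _).
  apply: continuous_subspaceT => p; apply: cvgD.
    by apply: (@continuous_comp _ _ _ fst (fun s : R => s%:C *: w)); [exact:
        cvg_fst|exact: cont].
  by apply: (@continuous_comp _ _ _ snd (fun s : R => s%:C *: ('i%C *: w)));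
      [exact: cvg_snd|exact: cont].
apply: precompact_subset (compact_precompact (@norm_hausdorff _ H2) cI).
move=> _ [a /unit_ballP a1 <-].
have ga : cabs (g a) <= `|C|.
  rewrite (le_trans (gC a))// (le_trans (ler_wpM2r (cnorm_ge0 _) (ler_norm C)))//.
  by rewrite ler_piMr.
exists (complex.Re (g a), complex.Im (g a)).
  have /andP[h1 h2] : (`|complex.Re (g a)| <= `|C|) && (`|complex.Im (g a)| <= `|C|).
    have := cabs_sqr (g a).
    rewrite -[complex.Re (g a) ^+ 2]real_normK ?num_real//.
    rewrite -[complex.Im (g a) ^+ 2]real_normK ?num_real//.
    have := normr_ge0 (complex.Re (g a)); have := normr_ge0 (complex.Im (g a)).
    have := cabs_ge0 (g a) => *; apply/andP; split; nra.
  by split; rewrite /I/= in_itv/= -ler_norml.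
by rewrite /= scalerA -scalerDl; congr (_ *: _); rewrite [RHS]complexE mulrC.
Qed.

End OperatorNorm.

(** * Riesz representation by norm attainment *)

Section Riesz.
Variables (R : realType) (H : hilbert_space R).

(** The operator [g _ *: w] is compact and so attains its norm at some [xi]. [dot_norming] says that
    [g a] times the constant [(g xi)^* * inner H w w] is a multiple of [inner H a xi]; dividing
    exhibits the vector. *)
Lemma riesz (g : H -> R[i]) C :
  (forall (k : R[i]) x y, g (k *: x + y) = k * g x + g y) ->
  (forall a, cabs (g a) <= C * cnorm a) -> exists z, forall a, g a = inner H a z.
Proof.
move=> g_lin gC.
have [g0|/existsNP[w gw]] := pselect (forall a, g a = 0).
  by exists 0 => a; rewrite dot0r.
pose f a := g a *: w.
have cf : compact_op f by exact: compact_op_functional g_lin gC.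
have [fb [xi xi1 fxi]] := op_normP cf.
have g00 : g 0 = 0.
  by have /eqP := g_lin 1 0 0; rewrite scaler0 addr0 mul1r -subr_eq0 opprD
      addrA subrr sub0r oppr_eq0 => /eqP.
have w0 : w != 0 by apply: contra_notN gw => /eqP ->.
have nw : 0 < cnorm w.
  by rewrite lt0r cnorm_ge0 andbT; apply: contra w0 => /eqP/cnorm_eq0 ->.
have s0 : 0 < op_norm f.
  have fw : 0 < cnorm (f w).
    rewrite cnormZ mulr_gt0// lt0r cabs_ge0 andbT.
    by apply/eqP => /cabs_eq0.
  by have := lt_le_trans fw (fb w); rewrite pmulr_lgt0.
have xiE : cnorm xi = 1.
  by apply/eqP; rewrite eq_le xi1/= -(ler_pM2l s0) mulr1 -{1}fxi fb.
have c0 : (g xi)^* * inner H w w != 0.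
  rewrite mulf_neq0//.
    rewrite conjC_eq0; apply/eqP => gxi; move: fxi; rewrite /f gxi scale0r.
    by rewrite (is_norm0 (cnorm_is_norm _)) => e; rewrite -e ltxx in s0.
  rewrite dotxx; apply/eqP => /(congr1 (@complex.Re R))/= /eqP.
  by rewrite sqrf_eq0 (gt_eqF nw).
exists (((op_norm f ^+ 2)%:C / ((g xi)^* * inner H w w))^* *: xi) => a.
have := dot_norming a cf.1 fb xiE fxi; rewrite /f dotZl dotZr => e.
rewrite dotZr conjCK mulrAC -e; field.
by move: c0; rewrite mulf_eq0 negb_or andbC.
Qed.

End Riesz.

(** * Gram-Schmidt and finite rank approximation *)

Section FiniteRank.
Variables (R : realType).

Definition subspace_of (H : hilbert_space R) (S : set H) :=
  S 0 /\ forall (k : R[i]) x y, S x -> S y -> S (k *: x + y).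

Section Projection.
Variable H : hilbert_space R.

Definition proj (l : seq H) (a : H) : H := \sum_(p <- l) inner H a p *: p.

Lemma dot_projl l a x : inner H (proj l a) x = \sum_(p <- l) inner H a p * inner H p x.
Proof.
rewrite /proj; elim: l => [|p l IH]; first by rewrite !big_nil dot0l.
by rewrite !big_cons dotDl dotZl IH.
Qed.

(** The second clause is what later proofs use of orthonormality. The third transfers every linear
    condition satisfied on [s] to the basis, without naming a span. *)
Lemma gram_schmidt (s : seq H) : exists l, [/\
  forall x, x \in s -> proj l x = x,
  forall a p, p \in l -> inner H (a - proj l a) p = 0 &
  forall S, subspace_of S -> (forall x, x \in s -> S x) -> forall p, p \in l -> S p].
Proof.
elim: s => [|x s [l [fixl orthl subl]]]; first by exists [::].
pose x' := x - proj l x.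
have Sproj S a : subspace_of S -> (forall p, p \in l -> S p) -> S (proj l a).
  move=> [S0 SD]; rewrite /proj; elim: (l) => [|p k IH] Sl; first by rewrite big_nil.
  rewrite big_cons; apply: SD; first by apply: Sl; rewrite mem_head.
  by apply: IH => q qk; apply: Sl; rewrite inE qk orbT.
have [x0|x0] := eqVneq x' 0.
  exists l; split => // [y|S SS Ss].
    rewrite inE => /orP[/eqP ->|]; last exact: fixl.
    by apply/eqP; rewrite eq_sym -subr_eq0; apply/eqP.
  by apply: subl => // y ys; apply: Ss; rewrite inE ys orbT.
have n0 : 0 < cnorm x'.
  by rewrite lt0r cnorm_ge0 andbT; apply: contra x0 => /eqP/cnorm_eq0 ->.
pose p := (cnorm x')^-1%:C *: x'.
have pp : inner H p p = 1.
  rewrite dotxx cnormZ cabs_real ger0_norm ?invr_ge0 ?cnorm_ge0//.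
  by rewrite mulVf ?gt_eqF// expr1n.
have pl q : q \in l -> inner H p q = 0.
  by move=> ql; rewrite dotZl orthl// mulr0.
have lp q : q \in l -> inner H q p = 0 by move=> ql; rewrite dotC pl// rmorph0.
have projp (a : H) : inner H (proj l a) p = 0.
  rewrite dot_projl big_seq big1// => q ql; by rewrite lp// mulr0.
have projE (a : H) : proj (p :: l) a = inner H a p *: p + proj l a.
  by rewrite /proj big_cons.
have xp : inner H x p *: p = x'.
  have -> : inner H x p = (cnorm x')%:C.
    have xx : x = x' + proj l x by rewrite subrK.
    rewrite {1}xx (dotDl x') (projp x) addr0 dotZr conj_real dotxx.
    by rewrite -rmorphM expr2 mulrA mulVf ?mul1r// gt_eqF.
  by rewrite scalerA -rmorphM divff ?gt_eqF// scale1r.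
have pE : p = (cnorm x')^-1%:C *: x' by [].
clearbody p; exists (p :: l); split.
- move=> y; rewrite projE inE => /orP[/eqP ->|ys]; first by rewrite xp subrK.
  rewrite fixl// (_ : inner H y p = 0) ?scale0r ?add0r//.
  by rewrite -(fixl y ys) projp.
- move=> a q; rewrite projE inE => /orP[/eqP ->|ql].
    by rewrite !dotE projp pp mulr1 addr0 subrr.
  by rewrite opprD addrCA dotDl orthl// dotNl dotZl pl// mulr0 oppr0 addr0.
- move=> S SS Ss q; rewrite inE => /orP[/eqP ->|]; last first.
    by apply: subl => // y ys; apply: Ss; rewrite inE ys orbT.
  have Sl : forall p, p \in l -> S p.
    by apply: subl => // y ys; apply: Ss; rewrite inE ys orbT.
  have Sx : S x by apply: Ss; rewrite mem_head.
  have := SS.2 (- 1) _ _ (Sproj S x SS Sl) Sx; rewrite scaleN1r addrC -/x' => Sx'.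
  by have := SS.2 (cnorm x')^-1%:C _ _ Sx' SS.1; rewrite addr0 pE.
Qed.

Lemma cnorm_orthD (x y : H) : inner H x y = 0 ->
  cnorm (x + y) ^+ 2 = cnorm x ^+ 2 + cnorm y ^+ 2.
Proof. by move=> xy; rewrite cnormD_sqr xy mulr0 addr0. Qed.

Lemma proj_best (l : seq H) a y :
  (forall a p, p \in l -> inner H (a - proj l a) p = 0) -> proj l y = y ->
  cnorm (a - proj l a) <= cnorm (a - y).
Proof.
move=> orthl yE; rewrite -(@ler_pXn2r _ 2) ?nnegrE ?cnorm_ge0//.
have orth b : inner H (a - proj l a) (proj l b) = 0.
  rewrite dotC dot_projl big_seq big1 ?rmorph0// => p pl.
  by rewrite [inner H p _]dotC orthl// rmorph0 mulr0.
have -> : a - y = (a - proj l a) + (proj l a - y) by rewrite addrA subrK.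
rewrite (cnorm_orthD (x := a - proj l a)) ?lerDl ?sqr_ge0//.
by rewrite dotDr dotNr -yE !orth subr0.
Qed.

End Projection.

Variables (H1 H2 : hilbert_space R).

(** With [k] an orthonormal basis for the vectors [q.1], the finite rank part sees only the
    projection of [a], [v] sees only the rest, and their values are orthogonal; Pythagoras on both
    sides gives the maximum. *)
Lemma rank_sum_orth (l : seq (H1 * H2)) (v : H1 -> H2) al be :
  linear v -> 0 <= al -> 0 <= be ->
  (forall q, q \in l -> v q.1 = 0 /\ forall a, inner H2 (v a) q.2 = 0) ->
  op_bound (rank_sum l) al -> op_bound v be ->
  op_bound (rank_sum l + v) (Num.max al be).
Proof.
move=> v_lin al0 be0 vl lal vbe a.
have [k [fixk orthk subk]] := gram_schmidt (map fst l).
pose b := a - proj k a.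
have vk p : p \in k -> v p = 0.
  apply: (subk [set p | v p = 0]) => [|x /mapP[q ql ->]]; last by have [] := vl q ql.
  split; first exact: lin0.
  by move=> c x y /= vx vy; rewrite v_lin vx vy scaler0 addr0.
have lb : rank_sum l b = 0.
  rewrite /rank_sum big_seq big1// => q ql; rewrite [inner H1 _ _](_ : _ = 0)
      ?scale0r//.
  rewrite -(fixk q.1); last exact: map_f.
  rewrite dotC dot_projl big_seq big1 ?rmorph0// => p pk.
  by rewrite [inner H1 p _]dotC orthk// rmorph0 mulr0.
have vproj : v (proj k a) = 0.
  rewrite /proj; elim: k vk {fixk orthk subk b lb} => [|p k IH] vk; first by
      rewrite big_nil lin0.
  rewrite big_cons (lin_add v_lin) (lin_scale v_lin) vk ?mem_head// scaler0 add0r.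
  by apply: IH => q qk; apply: vk; rewrite inE qk orbT.
have la : rank_sum l a = rank_sum l (proj k a).
  rewrite -[a in LHS](subrK (proj k a)) -/b -[RHS]add0r -lb /rank_sum -big_split/=.
  by apply: eq_bigr => q _; rewrite dotDl scalerDl.
have va : v a = v b by rewrite /b (lin_sub v_lin) vproj subr0.
rewrite -[(_ + _) a]/(rank_sum l a + v a) la va.
rewrite -(@ler_pXn2r _ 2) ?nnegrE ?cnorm_ge0//; last first.
  by rewrite mulr_ge0 ?cnorm_ge0// le_max al0.
rewrite exprMn cnorm_orthD; last first.
  rewrite dotC /rank_sum.
  elim: (l) vl => [|q r IH] vl; first by rewrite big_nil dot0r rmorph0.
  rewrite big_cons dotDr dotZr (vl q _).2 ?mem_head// mulr0 add0r IH// => q' q'r.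
  by apply: vl; rewrite inE q'r orbT.
have aE : cnorm a ^+ 2 = cnorm (proj k a) ^+ 2 + cnorm b ^+ 2.
  rewrite -cnorm_orthD ?[_ + b]addrC ?subrK// dotC.
  rewrite [inner H1 b _]dotC dot_projl big_seq big1 ?rmorph0// => p pk.
  by rewrite [inner H1 p _]dotC orthk// rmorph0 mulr0.
have h1 : cnorm (rank_sum l (proj k a)) ^+ 2 <= al ^+ 2 * cnorm (proj k a) ^+ 2.
  by rewrite -exprMn ler_pXn2r ?nnegrE ?cnorm_ge0// mulr_ge0 ?cnorm_ge0.
have h2 : cnorm (v b) ^+ 2 <= be ^+ 2 * cnorm b ^+ 2.
  by rewrite -exprMn ler_pXn2r ?nnegrE ?cnorm_ge0// mulr_ge0 ?cnorm_ge0.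
set m := Num.max al be.
have am : al ^+ 2 <= m ^+ 2 by rewrite ler_pXn2r ?nnegrE ?le_max ?al0 ?lexx.
have bm : be ^+ 2 <= m ^+ 2 by rewrite ler_pXn2r ?nnegrE ?le_max ?be0 ?lexx ?orbT.
rewrite aE mulrDr; apply: lerD; [apply: le_trans h1 _|apply: le_trans h2 _].
  by rewrite ler_wpM2r ?sqr_ge0.
by rewrite ler_wpM2r ?sqr_ge0.
Qed.

Lemma compact_op_adjoint (f : H1 -> H2) (y : H2) : compact_op f ->
  exists z : H1, forall a, inner H2 (f a) y = inner H1 a z.
Proof.
move=> cf; have [fb _] := op_normP cf.
apply: (riesz (g := fun a => inner H2 (f a) y) (C := op_norm f * cnorm y)).
  by move=> k a b; rewrite cf.1 dotDl dotZl.
move=> a; apply: le_trans (cauchy_schwarz _ _) _.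
by rewrite mulrAC ler_wpM2r ?cnorm_ge0.
Qed.

Lemma compact_op_net (f : H1 -> H2) (e : R) : compact_op f -> 0 < e ->
  exists s : seq H1, forall a, cnorm a <= 1 ->
    exists2 x, x \in s & cnorm (f a - f x) <= e.
Proof.
move=> [f_lin]; rewrite precompactE compact_cover => cf e0.
pose F (x : H1) := [set y : H2 | cnorm (y - f x) < e].
have [|y|D DB cov] := cf H1 [set x | `|x| <= 1] F.
- move=> x _; rewrite openE => y /= yx; apply/nbhs_cnormP.
  exists (e - cnorm (y - f x)); first by rewrite subr_gt0.
  move=> z yz; rewrite /F/=.
  have := cnormD (z - y) (y - f x); rewrite addrA subrK.
  by rewrite cnorm_distC in yz => h; lra.
- move=> /(closure_cnorm)/(_ e0)[_ [x x1 <-] yx]; exists x => //.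
exists (finmap.enum_fset D) => a /unit_ballP a1.
have [|x xD /= ax] := cov (f a); first by apply: subset_closure; exists a.
by exists x => //; exact: ltW.
Qed.

(** [f] is followed by the projection onto the span of a finite net of its image. The clauses on [q]
    say that [q.1] is the adjoint at [q.2] and that [q.2] comes from the range, so orthogonality
    conditions on [f] pass to each term. *)
Lemma finite_rank_approx (f : H1 -> H2) (e : R) : compact_op f -> 0 < e ->
  exists l : seq (H1 * H2),
  (forall q, q \in l -> (forall a, inner H2 (f a) q.2 = inner H1 a q.1) /\
    forall S, subspace_of S -> (forall a, S (f a)) -> S q.2) /\
  op_bound (fun a => f a - rank_sum l a) e.
Proof.
move=> cf e0; have f_lin := cf.1; have [s fs] := compact_op_net cf e0.
have [k [fixk orthk subk]] := gram_schmidt (map f s).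
have /choice[z zP] : forall p, exists z : H1, forall a, inner H2 (f a) p = inner H1 a z.
  by move=> p; exact: compact_op_adjoint.
have kE a : rank_sum [seq (z p, p) | p <- k] a = proj k (f a).
  by rewrite /rank_sum big_map; apply: eq_bigr => p _; rewrite -zP.
exists [seq (z p, p) | p <- k]; split.
  move=> _ /mapP[p pk ->]; split=> [a|S SS Sf]; first exact: zP.
  by apply: (subk S SS) => // _ /mapP[x _ ->].
move=> a; rewrite kE; have [->|a0] := eqVneq a 0.
  by rewrite (lin0 f_lin) /proj big1 ?subrr ?(is_norm0 (cnorm_is_norm _))
      ?mulr0// => p _; rewrite dot0l scale0r.
have na : 0 < cnorm a.
  by rewrite lt0r cnorm_ge0 andbT; apply: contra a0 => /eqP/cnorm_eq0 ->.
pose c := cnorm a; pose b := c^-1%:C *: a.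
have ab : a = c%:C *: b by rewrite /b scalerA -rmorphM divff ?gt_eqF// scale1r.
have b1 : cnorm b <= 1.
  by rewrite cnormZ cabs_real ger0_norm ?invr_ge0 ?cnorm_ge0// mulVf// gt_eqF.
have [x xs bx] := fs b b1.
have h : cnorm (f b - proj k (f b)) <= e.
  by apply: le_trans bx; apply: proj_best => //; apply: fixk; exact: map_f.
have -> : f a - proj k (f a) = c%:C *: (f b - proj k (f b)).
  rewrite {1 2}ab (lin_scale f_lin) scalerBr; congr (_ - _).
  by rewrite /proj scaler_sumr; apply: eq_bigr => p _; rewrite dotZl scalerA.
by rewrite cnormZ cabs_real ger0_norm ?cnorm_ge0// mulrC ler_wpM2r ?cnorm_ge0.
Qed.

End FiniteRank.

(** * Faces in spaces of compact operators *)

Section OperatorFaces.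
Variables (R : realType) (K : jbstar_triple R) (Y : completeNormedModType R).
Variable Delta : K -> Y.
Hypothesis Delta_sphere : set_fun (unit_sphere K) (unit_sphere Y) Delta.
Hypothesis Delta_surj : set_surj (unit_sphere K) (unit_sphere Y) Delta.
Hypothesis Delta_isometry : forall x y, unit_sphere K x -> unit_sphere K y ->
  `|Delta x - Delta y| = cnorm (x - y).
Variables (H1 H2 : hilbert_space R) (A : set (H1 -> H2)).
Variable Phi : {linear K -> (H1 -> H2)}.
Hypothesis Phi_bij : set_bij setT A Phi.
Hypothesis Phi_norm : forall x, cnorm x = op_norm (Phi x).
Hypothesis A_compact : A `<=` @compact_op R H1 H2.

Let X : lmodType R := realified K.
Let N : X -> R := @cnorm R K.
Let T : X -> Y := Delta.
Let N_norm : is_norm N := cnorm_is_norm K.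

(* [P] is a set of pairs [(xi, eta)] of unit vectors, and [rank_sum (tri p)] is
   the minimal tripotent of [A] that maps [xi] to [eta]. *)
Variables (P : set (H1 * H2)) (tri : H1 * H2 -> seq (H1 * H2)).

(** Orthogonality of [w] to the rank one operator from [p.1] to [p.2], with the adjoint unfolded;
    [tri_ker] extends it to the whole tripotent. *)
Definition tker (p : H1 * H2) (w : H1 -> H2) :=
  w p.1 = 0 /\ forall a, inner H2 (w a) p.2 = 0.

Definition tri_dir p : set (realified (H1 -> H2)) :=
  [set f | exists p', [/\ P p', f = rank_sum (tri p') & tker p f]].

(** What types 1 to 3 have to supply. [tri_val], [tri_bound] and [tri_ker] put the tripotent plus
    the orthogonal unit ball into the face, [tri_sub] gives the converse bound, [tri_common] yields
    star-closedness, [norming_pair] finds a face through two points, and [tri_dense] provides the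
    directions. *)
Hypothesis P_unit : forall p, P p -> cnorm p.1 = 1 /\ cnorm p.2 = 1.
Hypothesis tri_mem : forall p, P p -> A (rank_sum (tri p)).
Hypothesis tri_val : forall p, P p -> rank_sum (tri p) p.1 = p.2.
Hypothesis tri_bound : forall p, P p -> op_bound (rank_sum (tri p)) 1.
Hypothesis tri_ker : forall p w, P p -> A w -> tker p w ->
  forall q, q \in tri p -> tker q w.
Hypothesis tri_sub : forall p z, P p -> A z -> op_bound z 1 -> z p.1 = p.2 ->
  op_bound (z - rank_sum (tri p)) 1.
Hypothesis tri_common : forall p z zeta, P p -> A z -> op_bound z 1 ->
  cnorm zeta = 1 -> cnorm (z zeta) = 1 -> z zeta = rank_sum (tri p) zeta ->
  z p.1 = p.2.
Hypothesis norming_pair : forall x y zeta, A x -> A y ->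
  op_bound x 1 -> op_bound y 1 -> cnorm zeta = 1 -> cnorm (x zeta) = 1 ->
  x zeta = y zeta -> exists p, [/\ P p, x p.1 = p.2 & y p.1 = p.2].
Hypothesis tri_dense : forall p v e, P p -> A v -> tker p v -> 0 < e ->
  exists2 h, lspan (tri_dir p) h & op_bound (v - h) e.

Let PhiA (x : X) : A (Phi x).
Proof. by case: Phi_bij => f _ _; exact: f. Qed.

Let Phi_lin (x : X) : linear (Phi x).
Proof. by have [] := A_compact (PhiA x). Qed.

Let PhiD (x y : X) : Phi (x + y) = Phi x + Phi y.
Proof. exact: raddfD. Qed.

Let PhiB (x y : X) : Phi (x - y) = Phi x - Phi y.
Proof. exact: raddfB. Qed.

Let PhiZ (r : R) (x : X) : Phi (r *: x) = r%:C *: Phi x.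
Proof. exact: linearZ. Qed.

Let N_leP (x : X) (s : R) : 0 <= s -> N x <= s <-> op_bound (Phi x) s.
Proof.
move=> s0; rewrite /N Phi_norm; split; last exact: (op_norm_le (A_compact (PhiA x)) s0).
move=> xs a; have [fb _] := op_normP (A_compact (PhiA x)).
by apply: le_trans (fb a) _; rewrite ler_wpM2r ?cnorm_ge0.
Qed.

Let N_attained (x : X) : N x = 1 ->
  exists2 xi, cnorm xi = 1 & cnorm (Phi x xi) = 1.
Proof. by rewrite /N Phi_norm; exact: (op_norm_attained (A_compact (PhiA x))). Qed.

Let Phi_surj f : A f -> exists x : X, Phi x = f.
Proof. by case: Phi_bij => _ _ s /s[x _ <-]; exists x. Qed.

(** The mean of [x] and [y] has norm 1 and attains it at some [zeta]; strict convexity of [H2] makes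
    the two values agree there. *)
Let common_norming (x y : X) : N x <= 1 -> N y <= 1 -> N (x + y) = 2 ->
  exists zeta, [/\ cnorm zeta = 1, cnorm (Phi x zeta) = 1 & Phi x zeta = Phi y zeta].
Proof.
move=> x1 y1 xy.
have [|zeta z1 zE] := @N_attained (2^-1 *: (x + y)).
  by rewrite (is_normZ_ge0 N_norm) ?invr_ge0// xy mulVf.
have h1 : cnorm (Phi x zeta) <= 1.
  by have := (N_leP x ler01).1 x1 zeta; rewrite z1 mulr1.
have h2 : cnorm (Phi y zeta) <= 1.
  by have := (N_leP y ler01).1 y1 zeta; rewrite z1 mulr1.
have h3 : cnorm (Phi x zeta + Phi y zeta) = 2.
  move: zE; rewrite PhiZ PhiD -[(_ *: _) zeta]/((2^-1)%:C *: (Phi x zeta + Phi y zeta)).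
  by rewrite cnormZ cabs_real gtr0_norm ?invr_gt0//; lra.
have e : Phi x zeta = Phi y zeta by apply: (eq_of_cnorm_add h1 h2); rewrite h3 mulr1.
exists zeta; split => //; apply/eqP; rewrite eq_le h1/=.
have := cnormD (Phi x zeta) (Phi y zeta); rewrite h3 -e; lra.
Qed.

Section Face.
Variables (p : H1 * H2) (Pp : P p).

Definition op_face : set X := [set z | N z <= 1 /\ Phi z p.1 = p.2].

Let op_face_norm z : op_face z -> N z = 1.
Proof.
move=> [z1 zp]; apply/eqP; rewrite eq_le z1/=.
have [p1 p2] := P_unit Pp; have := (N_leP z ler01).1 z1 p.1.
have [fb _] := op_normP (A_compact (PhiA z)).
by have := fb p.1; rewrite zp p1 p2 -Phi_norm mulr1.
Qed.

Let op_face_convex : sphere_convex N op_face.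
Proof.
split=> [|x y t [x1 xp] [y1 yp] tP]; first exact: op_face_norm.
split.
  apply: le_trans (is_norm_convex N_norm _ _ tP) _; nra.
rewrite PhiD !PhiZ -[LHS]/(t%:C *: Phi x p.1 + (1 - t)%:C *: Phi y p.1) xp yp.
by rewrite -scalerDl -rmorphD addrC subrK scale1r.
Qed.

Let e : X := sval (cid (Phi_surj (tri_mem Pp))).
Let PhiE : Phi e = rank_sum (tri p). Proof. by rewrite /e; case: cid. Qed.

Let kerN_add (w : X) : tker p (Phi w) -> N w <= 1 -> op_face (e + w).
Proof.
move=> wp w1; split; last first.
  by rewrite PhiD -[LHS]/(Phi e p.1 + Phi w p.1) PhiE wp.1 addr0 tri_val.
apply/N_leP => //; rewrite PhiD PhiE -[X in op_bound _ X](maxxx 1).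
apply: rank_sum_orth => //; [exact: tri_ker|exact: tri_bound|exact/N_leP].
Qed.

(** Both operators attain norm 1 at [p.1], so by [norming_isometry] pairing their values with [p.2]
    gives [inner H1 a p.1] in both cases. *)
Let tker_sub (x y : X) : op_face x -> op_face y -> tker p (Phi (x - y)).
Proof.
move=> [x1 xp] [y1 yp]; have [p1 p2] := P_unit Pp.
rewrite PhiB; split=> [|a].
  by rewrite -[LHS]/(Phi x p.1 - Phi y p.1) xp yp subrr.
rewrite -[(_ - _) a]/(Phi x a - Phi y a) dotDl dotNl -{1}xp -yp.
rewrite !norming_isometry ?subrr// ?xp ?yp//; exact/N_leP.
Qed.

Let face_e : op_face e.
Proof.
rewrite -[e]addr0; apply: kerN_add; last by rewrite (is_norm0 N_norm).
rewrite (_ : Phi 0 = 0); last exact: raddf0.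
by split=> // a; rewrite dot0l.
Qed.

(** The single point [e] of the face suffices as a test: [u] and [e] agree at a common norming
    vector, and [tri_common] carries this to [p.1]. *)
Let op_face_star : star_closed N op_face.
Proof.
move=> u u1 /(_ _ face_e) ue; split; first by rewrite u1.
have u1' : N u <= 1 by rewrite u1.
have [zeta [z1 uz uez]] := common_norming u1' face_e.1 ue.
apply: (tri_common (zeta := zeta)) => //; first exact/N_leP.
by rewrite uez PhiE.
Qed.

Let D : set X := [set d | exists p', [/\ P p', Phi d = rank_sum (tri p') & tker
    p (Phi d)]].
Let orth (d w : X) := exists p', [/\ P p', Phi d = rank_sum (tri p'),
  tker p' (Phi w) & tker p (Phi w)].

Let D_norm d : D d -> N d <= 1.
Proof. by move=> [p' [Pp' dE _]]; apply/N_leP => //; rewrite dE; exact: tri_bound. Qed.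

Let tkerZ (q : H1 * H2) (w : X) (r : R) : tker q (Phi w) -> tker q (Phi (r *: w)).
Proof.
move=> [w0 wq]; rewrite PhiZ; split.
  by rewrite -[LHS]/(r%:C *: Phi w q.1) w0 scaler0.
by move=> a; rewrite -[(_ *: _) a]/(r%:C *: Phi w a) dotZl wq mulr0.
Qed.

Let tkerD (q : H1 * H2) (w w' : X) :
  tker q (Phi w) -> tker q (Phi w') -> tker q (Phi (w + w')).
Proof.
move=> [w0 wq] [w'0 w'q]; rewrite PhiD; split.
  by rewrite -[LHS]/(Phi w q.1 + Phi w' q.1) w0 w'0 addr0.
by move=> a; rewrite -[(_ + _) a]/(Phi w a + Phi w' a) dotDl wq w'q addr0.
Qed.

(** At [p'.1] the two operators take values of norm at most [c] with sum [2 * c] times a unit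
    vector, so the values agree and [w] vanishes there. Both operators then attain their bound at
    [p'.1], and subtracting the two instances of [dot_norming] gives the orthogonality of the
    range. *)
Let orth_of_norm_op d x y (c : R) : D d -> op_face x -> op_face y -> 0 < c ->
  N (c *: d + (x - y)) <= c * N d -> N (c *: d - (x - y)) <= c * N d ->
  orth d (x - y).
Proof.
move=> Dd Fx Fy c0 h1 h2; have xyp := tker_sub Fx Fy.
have Nd := D_norm Dd; have [p' [Pp' dE _]] := Dd.
have [p1 p2] := P_unit Pp'; have cn0 : c%:C != 0 :> R[i].
  by rewrite (inj_eq (@complexI R) c 0) gt_eqF.
set w := x - y in h1 h2 xyp *.
have cd : c * N d <= c by rewrite ler_piMr// ltW.
have b1 := (N_leP _ (ltW c0)).1 (le_trans h1 cd).
have b2 := (N_leP _ (ltW c0)).1 (le_trans h2 cd).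
have v1 a : Phi (c *: d + w) a = c%:C *: rank_sum (tri p') a + Phi w a.
  by rewrite PhiD PhiZ dE.
have v2 a : Phi (c *: d - w) a = c%:C *: rank_sum (tri p') a - Phi w a.
  by rewrite PhiB PhiZ dE.
have w0 : Phi w p'.1 = 0.
  have e1 := b1 p'.1; have e2 := b2 p'.1.
  rewrite p1 mulr1 v1 tri_val// in e1; rewrite p1 mulr1 v2 tri_val// in e2.
  have : c%:C *: p'.2 + Phi w p'.1 = c%:C *: p'.2 - Phi w p'.1.
    apply: (eq_of_cnorm_add e1 e2).
    rewrite addrACA subrr addr0 -scalerDl -rmorphD cnormZ cabs_real p2 mulr1.
    by rewrite gtr0_norm; lra.
  move=> /addrI/eqP; rewrite -subr_eq0 opprK -mulr2n -scaler_nat scaler_eq0.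
  by rewrite pnatr_eq0/= => /eqP.
exists p'; split=> //; split=> // a.
have nc : cnorm (c%:C *: p'.2) = c by rewrite cnormZ cabs_real p2 mulr1 gtr0_norm.
have := dot_norming a (Phi_lin _) b1 p1; rewrite !v1 tri_val// w0 addr0 => /(_ nc).
have := dot_norming a (Phi_lin _) b2 p1; rewrite !v2 tri_val// w0 subr0 => /(_ nc) <-.
move=> /eqP; rewrite dotDl [X in _ == X]dotDl dotNl -subr_eq0.
rewrite opprD opprK addrACA subrr add0r -mulr2n dotZr conj_real.
rewrite -mulr_natl !mulf_eq0 pnatr_eq0/= (negPf cn0)/=.
by move=> /eqP.
Qed.

Let orth_norm_op d d' w (s t r : R) : D d -> D d' -> orth d w -> orth d' w ->
  N (s *: d + t *: d' + r *: w) <= Num.max (N (s *: d + t *: d')) (N (r *: w)).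
Proof.
move=> _ _ [p1 [Pp1 dE wp1 _]] [p2 [Pp2 d'E wp2 _]].
apply/N_leP; first by rewrite le_max (is_norm_ge0 N_norm).
pose l := [seq (q.1, s%:C *: q.2) | q <- tri p1] ++ [seq (q.1, t%:C *: q.2) | q
    <- tri p2].
have scaled (c : R) q : rank_sum [seq (q.1, c%:C *: q.2) | q <- tri q] = c%:C
    *: rank_sum (tri q).
  apply/funext => a; rewrite /rank_sum big_map -[RHS]/(c%:C *: \sum_(i <- _) _)
      scaler_sumr.
  by apply: eq_bigr => i _; rewrite /= !scalerA mulrC.
have lE : Phi (s *: d + t *: d') = rank_sum l.
  rewrite PhiD !PhiZ dE d'E -!scaled; apply/funext => a.
  by rewrite /rank_sum big_cat.
rewrite PhiD lE; apply: rank_sum_orth => //.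
- exact: (is_norm_ge0 N_norm).
- exact: (is_norm_ge0 N_norm).
- move=> q; rewrite mem_cat => /orP[|] /mapP[q' q'l ->].
    have [w0 wq] := tri_ker Pp1 (PhiA _) (tkerZ r wp1) q'l.
    by split=> // a; rewrite dotZr wq mulr0.
  have [w0 wq] := tri_ker Pp2 (PhiA _) (tkerZ r wp2) q'l.
  by split=> // a; rewrite dotZr wq mulr0.
- by rewrite -lE; apply/N_leP => //; exact: (is_norm_ge0 N_norm).
- by apply/N_leP => //; exact: (is_norm_ge0 N_norm).
Qed.

Let lspan_lift h : lspan (tri_dir p) h -> exists k : X,
  [/\ Phi k = h, lspan D k & tker p (Phi k)].
Proof.
elim=> [|{}h c d _ [k [kE Dk kp]] [p' [Pp' dE dp]]].
  exists 0; rewrite (_ : Phi 0 = 0); last exact: raddf0.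
  split=> //; first exact: lspan0.
  by split=> // a; rewrite dot0l.
have [d' d'E] := Phi_surj (tri_mem Pp').
have dp' : tker p (Phi d') by rewrite d'E -dE.
exists (k + c *: d'); split.
- by rewrite PhiD PhiZ kE d'E dE.
- by apply: lspan_add => //; exists p'.
- exact: (tkerD kp (tkerZ _ dp')).
Qed.

Let op_face_approx x y (eps : R) : op_face x -> op_face y -> 0 < eps ->
  exists x' y', [/\ op_face x', op_face y', N (x - x') <= eps, N (y - y') <= eps
    & lspan D (y' - x')].
Proof.
move=> Fx Fy e0.
have xp := tker_sub Fx face_e; have yp := tker_sub Fy face_e.
have sub1 z : op_face z -> N (z - e) <= 1.
  move=> [z1 zp]; apply/N_leP => //; rewrite PhiB PhiE.
  by apply: tri_sub => //; exact/N_leP.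
pose d := Num.min 1 (eps / 2).
have d0 : 0 < d by rewrite lt_min ltr01 divr_gt0.
have d2 : d <= eps / 2 by rewrite ge_min lexx orbT.
have [h hs hb] := tri_dense Pp (PhiA (y - x)) (tker_sub Fy Fx) d0.
have [k [kE Dk kp]] := lspan_lift hs.
have kN : N (y - x - k) <= d by apply/N_leP; [exact: ltW|rewrite PhiB kE].
(* [x - e + k] differs from [y - e] by at most [d], so its norm is at most [1 + d]; scaling by [c]
   brings it back into the unit ball. *)
pose c : R := (1 + d)^-1.
have d1 : 0 < 1 + d by lra.
have c0 : 0 < c by rewrite invr_gt0.
have c1 : c <= 1 by rewrite invf_le1//; lra.
have cE : c * (1 + d) = 1 by rewrite mulVf// gt_eqF.
have cd : 1 - c <= d by nra.
have x1 := sub1 _ Fx; have y1 := sub1 _ Fy.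
exists (e + c *: (x - e)), (e + c *: (x - e + k)); split.
- apply: kerN_add; first exact: tkerZ.
  by rewrite (is_normZ_ge0 N_norm) ?(ltW c0)//; have := is_norm_ge0 N_norm (x - e); nra.
- apply: kerN_add; first exact/tkerZ/tkerD.
  rewrite (is_normZ_ge0 N_norm) ?(ltW c0)//.
  have := is_normD N_norm (y - e) (- (y - x - k)).
  rewrite (is_normN N_norm) (_ : y - e - _ = x - e + k); last by lincomb R X.
  by nra.
- rewrite (_ : x - _ = (1 - c) *: (x - e)); last by lincomb R X.
  rewrite (is_normZ_ge0 N_norm) ?subr_ge0//.
  have := is_norm_ge0 N_norm (x - e); nra.
- rewrite (_ : y - _ = (1 - c) *: (y - e) + c *: (y - x - k)); last by lincomb R X.
  apply: le_trans (is_normD N_norm _ _) _.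
  rewrite !(is_normZ_ge0 N_norm) ?subr_ge0 ?(ltW c0)//.
  have := is_norm_ge0 N_norm (y - e); have := is_norm_ge0 N_norm (y - x - k); nra.
- rewrite (_ : _ - _ = c *: k); last by lincomb R X.
  by apply: lspanZ.
Qed.

Lemma op_face_affine x y (t : R) : op_face x -> op_face y -> 0 <= t <= 1 ->
  T (t *: x + (1 - t) *: y) = t *: T x + (1 - t) *: T y.
Proof.
apply: (@directions_affine R X N N_norm Y T op_face e D orth 1) => //.
- exact: op_face_convex.2.
- exact: (sphere_convex_isometry Delta_isometry op_face_convex).
- by move=> u v; exact: (star_closed_mid Delta_sphere Delta_surj Delta_isometry
    op_face_convex op_face_star).
- move=> d w c _ [p' [_ _ _ wp]] cw; apply: kerN_add => //; exact: tkerZ.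
- move=> d Dd; exists 1 => // s s1; apply: kerN_add.
    by apply: tkerZ; have [p' []] := Dd.
  rewrite (is_normZ N_norm); have := D_norm Dd; have := is_norm_ge0 N_norm d.
  by have := normr_ge0 s; nra.
Qed.

End Face.

(** The face depends on the pair: [C] only gives [N (x + y) = 2], from which a common norming pair
    and hence a face through [x] and [y] result. *)
Lemma operator_affine (C : set X) x y (t : R) : sphere_convex N C ->
  C x -> C y -> 0 <= t <= 1 ->
  T (t *: x + (1 - t) *: y) = t *: T x + (1 - t) *: T y.
Proof.
move=> sC Cx Cy.
have x1 : N x <= 1 by rewrite sC.1.
have y1 : N y <= 1 by rewrite sC.1.
have [zeta [z1 xz xyz]] := common_norming x1 y1 (sphere_convex_add N_norm sC Cx Cy).
have [p [Pp xp yp]] := norming_pair (PhiA x) (PhiA y)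
  ((N_leP x ler01).1 x1) ((N_leP y ler01).1 y1) z1 xz xyz.
by apply: (op_face_affine Pp).
Qed.

End OperatorFaces.

(** * Types 1, 2 and 3 *)

Section RankOne.
Variables (R : realType) (H1 H2 : hilbert_space R).
Implicit Types p q : H1 * H2.

Lemma rank_sum1 p a : rank_sum [:: p] a = inner H1 a p.1 *: p.2.
Proof. by rewrite /rank_sum big_seq1. Qed.

Lemma compact_op_rank1 p : compact_op (rank_sum [:: p]).
Proof.
rewrite (_ : rank_sum _ = fun a => inner H1 a p.1 *: p.2); last first.
  by apply/funext => a; exact: rank_sum1.
apply: (compact_op_functional _ (C := cnorm p.1)) => [k x y|a].
  by rewrite dotDl dotZl.
by rewrite mulrC; exact: cauchy_schwarz.
Qed.

Lemma rank1_bound p : cnorm p.1 = 1 -> cnorm p.2 = 1 ->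
  op_bound (rank_sum [:: p]) 1.
Proof.
move=> p1 p2 a; rewrite rank_sum1 cnormZ p2 mulr1 mul1r.
by have := cauchy_schwarz a p.1; rewrite p1 mulr1.
Qed.

Lemma proj_contract (H : hilbert_space R) (l : seq H) a :
  (forall b u : H, u \in l -> inner H (b - proj l b) u = 0) ->
  cnorm (a - proj l a) <= cnorm a.
Proof.
move=> orthl; have := proj_best a orthl (y := 0); rewrite subr0; apply.
by rewrite /proj big1// => u _; rewrite dot0l scale0r.
Qed.

Lemma proj_le (H : hilbert_space R) (l : seq H) a :
  (forall b u : H, u \in l -> inner H (b - proj l b) u = 0) ->
  cnorm (proj l a) <= cnorm a.
Proof.
move=> orthl; rewrite -(@ler_pXn2r _ 2) ?nnegrE ?cnorm_ge0//.
have aE : a = proj l a + (a - proj l a) by rewrite addrC subrK.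
rewrite [in leRHS]aE cnorm_orthD ?lerDl ?sqr_ge0//.
rewrite dot_projl big_seq big1// => u ul.
by rewrite [inner H u _]dotC orthl// rmorph0 mulr0.
Qed.

(** The difference is [z] composed with the projection onto the complement of [p.1]. *)
Lemma rank1_sub p z : cnorm p.1 = 1 -> linear z -> op_bound z 1 -> z p.1 = p.2 ->
  op_bound (z - rank_sum [:: p]) 1.
Proof.
move=> p1 z_lin z1 zp a.
rewrite -[(_ - _) a]/(z a - rank_sum [:: p] a) rank_sum1 -zp.
rewrite -(lin_scale z_lin) -(lin_sub z_lin) (le_trans (z1 _))// !mul1r.
have := @proj_contract H1 [:: p.1] a; rewrite /proj big_seq1; apply => b u.
rewrite inE => /eqP ->; rewrite big_seq1 dotDl dotNl dotZl dotxx p1 expr1n mulr1.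
by rewrite subrr.
Qed.

Lemma eq_scale_of_dot (H : hilbert_space R) (x y : H) : cnorm x = 1 -> cnorm y = 1 ->
  cabs (inner H x y) = 1 -> x = inner H x y *: y.
Proof.
move=> x1 y1 xy; apply/eqP; rewrite -subr_eq0; apply/eqP/cnorm_eq0/eqP.
rewrite -sqrf_eq0; apply/eqP/complexI; rewrite -dotxx !dotE.
rewrite !dotxx x1 y1 [inner H y x]dotC.
transitivity (1 - inner H x y * (inner H x y)^*).
  by rewrite expr1n rmorph1; ring.
by rewrite mulC_conj xy expr1n rmorph1 subrr.
Qed.

(** Equality in Cauchy-Schwarz: [zeta] must be a unimodular multiple of [p.1]. *)
Lemma rank1_common p z zeta : cnorm p.1 = 1 -> cnorm p.2 = 1 -> linear z ->
  cnorm zeta = 1 -> cnorm (z zeta) = 1 -> z zeta = rank_sum [:: p] zeta ->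
  z p.1 = p.2.
Proof.
move=> p1 p2 z_lin zeta1 zz; rewrite rank_sum1 => zE.
have c1 : cabs (inner H1 zeta p.1) = 1.
  by move: zz; rewrite zE cnormZ p2 mulr1.
have c0 : inner H1 zeta p.1 != 0.
  by apply/eqP => h; move: c1; rewrite h (cabs_real 0) normr0 => /esym/eqP;
      rewrite oner_eq0.
move: zE; rewrite {1}(eq_scale_of_dot zeta1 p1 c1) (lin_scale z_lin).
by move=> /(scalerI c0).
Qed.

Lemma exists_unit (H : hilbert_space R) (x : H) : x != 0 ->
  exists2 u, cnorm u = 1 & x = (cnorm x)%:C *: u.
Proof.
move=> x0; have nx : 0 < cnorm x.
  by rewrite lt0r cnorm_ge0 andbT; apply: contra x0 => /eqP/cnorm_eq0 ->.
exists ((cnorm x)^-1%:C *: x).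
  by rewrite cnormZ cabs_real ger0_norm ?invr_ge0 ?cnorm_ge0// mulVf// gt_eqF.
by rewrite scalerA -rmorphM divff ?gt_eqF// scale1r.
Qed.

End RankOne.

Section RectangularOperators.
Variables (R : realType) (H1 H2 : hilbert_space R).

Lemma compact_op_dense (p : H1 * H2) v (e : R) : compact_op v -> tker p v -> 0 < e ->
  exists2 h, lspan (tri_dir [set q | cnorm q.1 = 1 /\ cnorm q.2 = 1]
    (fun q => [:: q]) p) h & op_bound (v - h) e.
Proof.
move=> cv [v0 vp] e0; have [l [lP lb]] := finite_rank_approx cv e0.
exists (rank_sum l : realified (H1 -> H2)); last exact: lb.
elim: l lP {lb} => [|q l IH] lP.
  rewrite (_ : rank_sum [::] = 0); first exact: lspan0.
  by apply/funext => a; rewrite /rank_sum big_nil.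
rewrite (_ : rank_sum (q :: l) = (rank_sum l : realified (H1 -> H2)) + rank_sum
    [:: q]); last first.
  by apply/funext => a; rewrite -[RHS]/(rank_sum l a + rank_sum [:: q] a)
      /rank_sum big_cons big_seq1 addrC.
have hl : lspan (tri_dir [set q | cnorm q.1 = 1 /\ cnorm q.2 = 1] (fun q => [:: q]) p)
    (rank_sum l : realified (H1 -> H2)).
  by apply: IH => q' q'l; apply: lP; rewrite inE q'l orbT.
have [vq Sq] := lP q (mem_head _ _).
have qp1 : inner H1 p.1 q.1 = 0 by rewrite -vq v0 dot0l.
have qp2 : inner H2 q.2 p.2 = 0.
  apply: (Sq [set y | inner H2 y p.2 = 0]) => //.
  split; first by rewrite /= dot0l.
  by move=> k x y /= hx hy; rewrite dotDl dotZl hx hy mulr0 addr0.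
have [q1|/exists_unit[u1 nu1 uE1]] := eqVneq q.1 0.
  rewrite (_ : rank_sum [:: q] = 0) ?addr0//.
  by apply/funext => a; rewrite rank_sum1 q1 dot0r scale0r.
have [q2|/exists_unit[u2 nu2 uE2]] := eqVneq q.2 0.
  rewrite (_ : rank_sum [:: q] = 0) ?addr0//.
  by apply/funext => a; rewrite rank_sum1 q2 scaler0.
have [q10|q10] := eqVneq (cnorm q.1) 0.
  rewrite (_ : rank_sum [:: q] = 0) ?addr0//.
  by apply/funext => a; rewrite rank_sum1 (cnorm_eq0 q10) dot0r scale0r.
have [q20|q20] := eqVneq (cnorm q.2) 0.
  rewrite (_ : rank_sum [:: q] = 0) ?addr0//.
  by apply/funext => a; rewrite rank_sum1 (cnorm_eq0 q20) scaler0.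
rewrite (_ : rank_sum [:: q] = (cnorm q.1 * cnorm q.2) *:
    (rank_sum [:: (u1, u2)] : realified (H1 -> H2))); last first.
  apply/funext => a; rewrite -[RHS]/((_)%:C *: rank_sum [:: (u1, u2)] a) !rank_sum1/=.
  rewrite {1}uE1 {1}uE2 dotZr conj_real !scalerA rmorphM; congr (_ *: _); ring.
apply: lspan_add => //; exists (u1, u2); split => //.
split => [|a]; rewrite rank_sum1/=.
  suff -> : inner H1 p.1 u1 = 0 by rewrite scale0r.
  move: qp1; rewrite uE1 dotZr conj_real => /eqP.
  by rewrite mulf_eq0 (inj_eq (@complexI R) _ 0) (negPf q10)/= => /eqP.
rewrite dotZl; suff -> : inner H2 u2 p.2 = 0 by rewrite mulr0.
move: qp2; rewrite uE2 dotZl => /eqP.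
by rewrite mulf_eq0 (inj_eq (@complexI R) _ 0) (negPf q20)/= => /eqP.
Qed.

End RectangularOperators.

(** * Operators equal to their transpose up to a sign *)

Section SymmetricOperators.
Variables (R : realType) (H : hilbert_space R) (j : H -> H).
Hypothesis j_conj : conjugation j.
Variable s : R.
Hypothesis s_sqr : s * s = 1.

(* The transpose of [x] is [s x]. *)
Definition sym_op (x : H -> H) :=
  forall a b, inner H (x a) (j b) = s%:C * inner H (x b) (j a).

Definition sym_ops : set (H -> H) := [set x | compact_op x /\ sym_op x].

Lemma dot_conjr a y : inner H a (j y) = inner H y (j a).
Proof.
by rewrite -{1}(conjugationK j_conj a) (dot_conjugation j_conj) -dotC.
Qed.

Lemma adjointP x a y : compact_op x -> inner H (x a) y = inner H a (adjoint x y).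
Proof.
move=> cx; have [z zP] := compact_op_adjoint y cx.
exact: (xgetPex 0 (ex_intro [set z | forall x0, inner H (x x0) y = inner H x0 z] z zP)).
Qed.

Lemma dot_conj_inj x y : (forall b, inner H x (j b) = inner H y (j b)) -> x = y.
Proof.
move=> h; apply/eqP; rewrite -subr_eq0; apply/eqP/dot_eq0 => b.
rewrite dotC dotDl dotNl -[b](conjugationK j_conj) h subrr rmorph0.
by [].
Qed.

Lemma op_transposeP x : compact_op x ->
  op_transpose j x = s%:C *: x <-> sym_op x.
Proof.
move=> cx; split=> [e a b|symx].
  rewrite adjointP//; have := congr1 (fun f : H -> H => j (f b)) e.
  rewrite /op_transpose/= (conjugationK j_conj) => ->.
  rewrite -[(_ *: x) b]/(s%:C *: x b) (conjugationZ j_conj) conj_real.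
  by rewrite dotZr conj_real dot_conjr.
apply/funext => b; apply: dot_conj_inj => a; rewrite /op_transpose/=.
rewrite (dot_conjugation j_conj) -dotC -adjointP// symx.
by rewrite -[(_ *: x) b]/(s%:C *: x b) dotZl.
Qed.

Lemma sym_tker p w : sym_op w -> tker p w -> tker (j p.2, j p.1) w.
Proof.
move=> symw [w0 wp]; split=> [|a] /=.
  by apply: dot_conj_inj => b; rewrite symw (conjugationK j_conj) wp mulr0 dot0l.
by rewrite symw w0 dot0l mulr0.
Qed.

(** The pair [(j q.2, j q.1)] is the transpose of the rank one operator [q], so this is its
    symmetrisation with sign [s]. *)
Definition sym_term (q : H * H) : realified (H -> H) :=
  2^-1 *: ((rank_sum [:: q] : realified (H -> H))
           + s *: (rank_sum [:: (j q.2, j q.1)] : realified (H -> H))).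

Lemma sym_termE q a : sym_term q a =
  (2^-1)%:C *: (inner H a q.1 *: q.2 + s%:C *: (inner H a (j q.2) *: j q.1)).
Proof.
rewrite -[LHS]/((2^-1)%:C *: (rank_sum [:: q] a + s%:C *: rank_sum [:: (j q.2,
    j q.1)] a)).
by rewrite !rank_sum1.
Qed.

(** A finite rank approximant is averaged with [s] times its transpose. As [v] is [s] times its own
    transpose, the transposed error obeys the same bound. The four conditions on [q] come from
    orthogonality to [p] and, by [sym_tker], to its transpose. *)
Lemma sym_op_dense p v (D : set (realified (H -> H))) (e : R) : sym_ops v -> tker p v ->
  0 < e ->
  (forall q, inner H p.1 q.1 = 0 -> inner H q.2 p.2 = 0 ->
     inner H (j p.2) q.1 = 0 -> inner H q.2 (j p.1) = 0 -> lspan D (sym_term q)) ->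
  exists2 h, lspan D h & op_bound (v - h) e.
Proof.
move=> [cv symv] vp e0 termD; have [v0 vp2] := vp; have [vj0 vj2] := sym_tker symv vp.
have [l [lP lb]] := finite_rank_approx cv e0.
exists (\sum_(q <- l) sym_term q).
  elim: l lP {lb} => [|q l IH] lP; first by rewrite big_nil; exact: lspan0.
  rewrite big_cons; apply: lspanD; last first.
    by apply: IH => q' q'l; apply: lP; rewrite inE q'l orbT.
  have [vq Sq] := lP q (mem_head _ _).
  have sub u : subspace_of [set y | inner H y u = 0].
    split; first by rewrite /= dot0l.
    by move=> k x y /= hx hy; rewrite dotDl dotZl hx hy mulr0 addr0.
  apply: termD; [by rewrite -vq v0 dot0l|exact: (Sq _ (sub _))|
    by rewrite -vq vj0 dot0l|exact: (Sq _ (sub _))].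
pose B := rank_sum l.
pose B' a := s%:C *: \sum_(q <- l) inner H a (j q.2) *: j q.1.
have hE a : (\sum_(q <- l) sym_term q) a = (2^-1)%:C *: (B a + B' a).
  rewrite /B /B' /rank_sum; elim: (l) => [|q k IH].
    by rewrite !big_nil scaler0 addr0 scaler0.
  rewrite big_cons -[LHS]/(sym_term q a + (\sum_(i <- k) sym_term i) a) IH sym_termE.
  by rewrite !big_cons !scalerDr -!addrA; congr (_ + _); rewrite addrCA.
have trans a b : inner H (v a - B' a) (j b) = s%:C * inner H (v b - B b) (j a).
  rewrite !dotDl !dotNl symv mulrDr mulrN; congr (_ - _).
  rewrite /B' /B /rank_sum dotZl; congr (_ * _).
  elim: (l) => [|q k IH]; first by rewrite !big_nil !dot0l.
  rewrite !big_cons !dotDl IH; congr (_ + _); rewrite !dotZl.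
  by rewrite (dot_conjugation j_conj) -dotC [inner H a (j _)]dot_conjr mulrC.
have B'b a : cnorm (v a - B' a) <= e * cnorm a.
  set y := v a - B' a; have [->|y0] := eqVneq (cnorm y) 0.
    by rewrite mulr_ge0 ?cnorm_ge0// ltW.
  have y_gt0 : 0 < cnorm y by rewrite lt0r y0 cnorm_ge0.
  rewrite -(ler_pM2l y_gt0) -expr2.
  have -> : cnorm y ^+ 2 = complex.Re (s%:C * inner H (v (j y) - B (j y)) (j a)).
    by rewrite -trans (conjugationK j_conj) -cnorm_sqr.
  apply: le_trans (Re_le_cabs _) _; rewrite cabsM cabs_real.
  have -> : `|s| = 1 by apply/eqP; rewrite -sqr_norm_eq1 expr2 s_sqr.
  rewrite mul1r (le_trans (cauchy_schwarz _ _))// (cnorm_conjugation j_conj).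
  rewrite mulrA ler_wpM2r ?cnorm_ge0// mulrC.
  by have := lb (j y); rewrite (cnorm_conjugation j_conj).
move=> a; rewrite -[(_ - _) a]/(v a - (\sum_(q <- l) sym_term q) a) hE.
have -> : v a - (2^-1)%:C *: (B a + B' a) = (2^-1)%:C *: ((v a - B a) + (v a - B' a)).
  by rewrite fmorphV rmorph_nat; lincomb R[i] H.
rewrite cnormZ cabs_real gtr0_norm ?invr_gt0//.
by have := cnormD (v a - B a) (v a - B' a); have := lb a; have := B'b a;
    rewrite -/B; lra.
Qed.

End SymmetricOperators.

Section SymmetricCase.
Variables (R : realType) (H : hilbert_space R) (j : H -> H).
Hypothesis j_conj : conjugation j.

Definition sym_pair : set (H * H) := [set p | cnorm p.1 = 1 /\ p.2 = j p.1].

Lemma sym_op_rank1 u : sym_op j 1 (rank_sum [:: (u, j u)]).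
Proof.
move=> a b; rewrite !rank_sum1 !dotZl/= !(dot_conjugation j_conj) -!dotC mul1r.
exact: mulrC.
Qed.

Lemma sym_square_span p u : sym_pair p -> inner H p.1 u = 0 ->
  lspan (tri_dir sym_pair (fun q => [:: q]) p)
    (rank_sum [:: (u, j u)] : realified (H -> H)).
Proof.
move=> [p1 p2] pu; have [->|u0] := eqVneq u 0.
  rewrite (_ : rank_sum _ = 0); first exact: lspan0.
  by apply/funext => a; rewrite rank_sum1 dot0r scale0r.
have [v v1 uE] := exists_unit u0.
have nu : cnorm u != 0 by apply: contra u0 => /eqP/cnorm_eq0 ->.
have pv : inner H p.1 v = 0.
  move: pu; rewrite uE dotZr conj_real => /eqP.
  by rewrite mulf_eq0 (inj_eq (@complexI R) _ 0) (negPf nu)/= => /eqP.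
rewrite (_ : rank_sum [:: (u, j u)] = 0 +
   (cnorm u ^+ 2) *: (rank_sum [:: (v, j v)] : realified (H -> H))).
  apply: lspan_add; first exact: lspan0.
  exists (v, j v); split => //; split=> [|a]; rewrite rank_sum1/=.
    by rewrite pv scale0r.
  by rewrite p2 dotZl (dot_conjugation j_conj) -dotC pv mulr0.
apply/funext => a; rewrite -[RHS]/(0 + (_)%:C *: rank_sum [:: (v, j v)] a) add0r.
rewrite !rank_sum1/= {1 2}uE (conjugationZ j_conj) dotZr !conj_real !scalerA.
by rewrite expr2 rmorphM; congr (_ *: _); ring.
Qed.

(** Polarisation: a symmetrised rank one term is a combination of the squares of [q.1], [j q.2] and
    their sum, all orthogonal to [p.1]. *)
Lemma sym_ops_dense p v (e : R) : sym_pair p -> sym_ops j 1 v -> tker p v -> 0 < e ->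
  exists2 h, lspan (tri_dir sym_pair (fun q => [:: q]) p) h & op_bound (v - h) e.
Proof.
move=> Pp vA vp e0; apply: (sym_op_dense j_conj (mulr1 1) vA vp e0) => q q1 _ _ q4.
have -> : sym_term j 1 q = 2^-1 *: (rank_sum [:: (q.1 + j q.2, j (q.1 + j
    q.2))] : realified (H -> H))
    + ((- 2^-1) *: (rank_sum [:: (q.1, j q.1)] : realified (H -> H))
      + (- 2^-1) *: (rank_sum [:: (j q.2, j (j q.2))] : realified (H -> H))).
  apply/funext => a; rewrite sym_termE.
  rewrite -[RHS]/((2^-1)%:C *: rank_sum [:: (q.1 + j q.2, j (q.1 + j q.2))] a
    + ((- 2^-1)%:C *: rank_sum [:: (q.1, j q.1)] a
    + (- 2^-1)%:C *: rank_sum [:: (j q.2, j (j q.2))] a)).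
  rewrite !rank_sum1/= (conjugationD j_conj) (conjugationK j_conj) dotDr scale1r.
  rewrite rmorphN; lincomb R[i] H.
have q5 : inner H p.1 (j q.2) = 0 by rewrite (dot_conjr j_conj).
apply: lspanD; [|apply: lspanD]; apply: lspanZ; apply: sym_square_span => //.
by rewrite dotDr q1 q5 addr0.
Qed.

(** Symmetry gives [x (j eta) = j zeta], so [u = zeta + j eta] satisfies [x u = j u]. If this sum is
    0, then [eta = - j zeta], and multiplying [zeta] by ['i] corrects the sign. *)
Lemma sym_norming_pair x y zeta : sym_ops j 1 x -> sym_ops j 1 y ->
  op_bound x 1 -> op_bound y 1 -> cnorm zeta = 1 -> cnorm (x zeta) = 1 ->
  x zeta = y zeta -> exists p, [/\ sym_pair p, x p.1 = p.2 & y p.1 = p.2].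
Proof.
move=> [[x_lin cx] symx] [[y_lin cy] symy] x1 y1 z1 xz xyz.
set eta := x zeta in xz xyz.
have jx : x (j eta) = j zeta.
  apply: (dot_conj_inj j_conj) => b; rewrite symx (conjugationK j_conj) mul1r.
  by rewrite (norming_isometry b x_lin x1 z1 xz) (dot_conjugation j_conj) -dotC.
have jy : y (j eta) = j zeta.
  apply: (dot_conj_inj j_conj) => b; rewrite symy (conjugationK j_conj) mul1r xyz.
  have yz : cnorm (y zeta) = 1 by rewrite -xyz.
  by rewrite (norming_isometry b y_lin y1 z1 yz) (dot_conjugation j_conj) -dotC.
have [u u0 [xu yu]] : exists2 u, u != 0 & x u = j u /\ y u = j u.
  have [h|h] := eqVneq (zeta + j eta) 0; last first.
    exists (zeta + j eta) => //; rewrite (conjugationD j_conj) (conjugationK j_conj).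
    by rewrite (lin_add x_lin) (lin_add y_lin) jx jy -xyz addrC.
  have etaE : eta = - j zeta.
    have /eqP := h; rewrite addr_eq0 => /eqP ->.
    by rewrite (conjugationN j_conj) (conjugationK j_conj) opprK.
  have zeta0 : zeta != 0.
    by apply/eqP => z0; move: z1; rewrite z0 (is_norm0 (cnorm_is_norm _)) =>
        /esym/eqP; rewrite oner_eq0.
  have i0 : 'i%C != 0 :> R[i] by rewrite eq_complex/= oner_eq0 andbF.
  exists ('i%C *: zeta); first by rewrite scaler_eq0 negb_or i0.
  rewrite (conjugationZ j_conj) (lin_scale x_lin) (lin_scale y_lin) -xyz -/eta etaE.
  have -> : ('i%C)^* = - 'i%C :> R[i] by apply/eqP; rewrite eq_complex/= oppr0 !eqxx.
  by rewrite scaleNr scalerN.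
have [v v1 uE] := exists_unit u0.
have nu : (cnorm u)%:C != 0 :> R[i].
  by rewrite (inj_eq (@complexI R) _ 0); apply: contra u0 => /eqP/cnorm_eq0 ->.
exists (v, j v); split => //=; apply: (scalerI nu).
  by rewrite -(lin_scale x_lin) -uE xu {1}uE (conjugationZ j_conj) conj_real.
by rewrite -(lin_scale y_lin) -uE yu {1}uE (conjugationZ j_conj) conj_real.
Qed.

End SymmetricCase.

Section AntisymmetricCase.
Variables (R : realType) (H : hilbert_space R) (j : H -> H).
Hypothesis j_conj : conjugation j.

(** The last condition makes [p.1] and [j p.2] orthonormal, so that [alt_tri], a rank one operator
    minus its transpose, is a partial isometry of rank two. *)
Definition alt_pair : set (H * H) :=
  [set p | [/\ cnorm p.1 = 1, cnorm p.2 = 1 & inner H p.2 (j p.1) = 0]].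

Definition alt_tri (p : H * H) : seq (H * H) := [:: p; (j p.2, - j p.1)].

Lemma alt_triE p a :
  rank_sum (alt_tri p) a = inner H a p.1 *: p.2 - inner H a (j p.2) *: j p.1.
Proof. by rewrite /rank_sum/= big_cons big_seq1 scalerN. Qed.

Lemma alt_tri_mem p : sym_ops j (-1) (rank_sum (alt_tri p)).
Proof.
split.
  rewrite (_ : rank_sum _ = rank_sum [:: p] + rank_sum [:: (j p.2, - j p.1)]).
    by apply: compact_op_add; exact: compact_op_rank1.
  apply/funext => a; rewrite -[RHS]/(rank_sum [:: p] a + rank_sum [:: (j p.2, -
      j p.1)] a).
  by rewrite alt_triE !rank_sum1 scalerN.
move=> a b; rewrite !alt_triE !dotDl !dotNl !dotZl !(dot_conjugation j_conj) -!dotC.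
rewrite rmorphN rmorph1 !(dot_conjr j_conj p.2); ring.
Qed.

Lemma alt_tri_val p : alt_pair p -> rank_sum (alt_tri p) p.1 = p.2.
Proof.
move=> [p1 p2 p3]; rewrite alt_triE dotxx p1 expr1n scale1r.
by rewrite (dot_conjr j_conj) p3 scale0r subr0.
Qed.

Let alt_proj p a : alt_pair p -> forall u, u \in [:: p.1; j p.2] ->
  inner H (a - proj [:: p.1; j p.2] a) u = 0.
Proof.
move=> [p1 p2 p3] u; rewrite /proj big_cons big_seq1 !inE => /orP[] /eqP ->.
  rewrite !dotE dotxx p1 expr1n mulr1.
  by rewrite [inner H (j p.2) _]dotC (dot_conjr j_conj p.1) p3 rmorph0 mulr0
      addr0 subrr.
rewrite !dotE dotxx (cnorm_conjugation j_conj) p2 expr1n mulr1.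
by rewrite (dot_conjr j_conj p.1) p3 mulr0 add0r subrr.
Qed.

Let alt_norm p a : alt_pair p ->
  cnorm (rank_sum (alt_tri p) a) ^+ 2
  = cabs (inner H a p.1) ^+ 2 + cabs (inner H a (j p.2)) ^+ 2.
Proof.
move=> [p1 p2 p3]; rewrite alt_triE cnorm_orthD.
  rewrite (is_normN (cnorm_is_norm _)) !cnormZ (cnorm_conjugation j_conj) p1 p2.
  by rewrite !mulr1.
by rewrite dotZl dotNr dotZr p3 mulr0 oppr0 mulr0.
Qed.

Lemma alt_tri_bound p : alt_pair p -> op_bound (rank_sum (alt_tri p)) 1.
Proof.
move=> Pp a; rewrite mul1r -(@ler_pXn2r _ 2) ?nnegrE ?cnorm_ge0// alt_norm//.
have -> : cabs (inner H a p.1) ^+ 2 + cabs (inner H a (j p.2)) ^+ 2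
    = cnorm (proj [:: p.1; j p.2] a) ^+ 2.
  have [p1 p2 p3] := Pp; rewrite /proj big_cons big_seq1 cnorm_orthD.
    by rewrite !cnormZ (cnorm_conjugation j_conj) p1 p2 !mulr1.
  by rewrite dotZl dotZr (dot_conjr j_conj p.1) p3 !mulr0.
by rewrite ler_pXn2r ?nnegrE ?cnorm_ge0//; apply: proj_le => b; exact: alt_proj.
Qed.

Lemma alt_tri_ker p w : sym_ops j (-1) w -> tker p w ->
  forall q, q \in alt_tri p -> tker q w.
Proof.
move=> [_ symw] wp q; rewrite !inE => /orP[] /eqP ->//.
have [w0 w1] := sym_tker j_conj symw wp.
by split=> // a; rewrite dotNr w1 oppr0.
Qed.

(** The face prescribes [z] at [p.1] only; antisymmetry forces its value at the second initial
    vector [j p.2]. *)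
Let alt_partner p z : alt_pair p -> sym_ops j (-1) z -> op_bound z 1 ->
  z p.1 = p.2 -> z (j p.2) = - j p.1.
Proof.
move=> [p1 p2 p3] [[z_lin cz] symz] z1 zp; apply: (dot_conj_inj j_conj) => b.
rewrite symz (conjugationK j_conj) -zp norming_isometry// ?zp//.
by rewrite rmorphN rmorph1 mulN1r dotNl (dot_conjugation j_conj) -dotC.
Qed.

Lemma alt_tri_sub p z : alt_pair p -> sym_ops j (-1) z -> op_bound z 1 ->
  z p.1 = p.2 -> op_bound (z - rank_sum (alt_tri p)) 1.
Proof.
move=> Pp zA z1 zp a; have z_lin := zA.1.1.
rewrite -[(_ - _) a]/(z a - rank_sum (alt_tri p) a) alt_triE -{1}zp.
have -> : j p.1 = - z (j p.2) by rewrite (alt_partner Pp zA z1 zp) opprK.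
rewrite scalerN opprK -!(lin_scale z_lin) -(lin_add z_lin) -(lin_sub z_lin).
apply: le_trans (z1 _) _; rewrite !mul1r.
have := @proj_contract _ H [:: p.1; j p.2] a (fun b => alt_proj b Pp).
by rewrite /proj big_cons big_seq1 opprD addrA.
Qed.

Lemma alt_tri_common p z zeta : alt_pair p -> sym_ops j (-1) z -> op_bound z 1 ->
  cnorm zeta = 1 -> cnorm (z zeta) = 1 -> z zeta = rank_sum (alt_tri p) zeta ->
  z p.1 = p.2.
Proof.
move=> Pp [[z_lin cz] symz] z1 zeta1 zz zE; have [p1 p2 p3] := Pp.
set al := inner H zeta p.1; set be := inner H zeta (j p.2).
have ab1 : cabs al ^+ 2 + cabs be ^+ 2 = 1.
  by rewrite -(alt_norm _ Pp) -zE zz expr1n.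
have abC : al * al^* + be * be^* = 1.
  by rewrite !mulC_conj -rmorphD ab1.
have zetaE : zeta = al *: p.1 + be *: j p.2.
  apply/eqP; rewrite -subr_eq0; apply/eqP/cnorm_eq0/eqP; rewrite -sqrf_eq0.
  have := cnorm_orthD (x := proj [:: p.1; j p.2] zeta)
    (y := zeta - proj [:: p.1; j p.2] zeta).
  have -> : inner H (proj [:: p.1; j p.2] zeta) (zeta - proj [:: p.1; j p.2] zeta) = 0.
    rewrite dot_projl big_seq big1// => u ul.
    by rewrite [inner H u _]dotC (alt_proj zeta Pp ul) rmorph0 mulr0.
  move=> /(_ erefl); rewrite addrC subrK zeta1.
  have -> : cnorm (proj [:: p.1; j p.2] zeta) ^+ 2 = 1.
    rewrite /proj big_cons big_seq1 cnorm_orthD.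
      by rewrite !cnormZ (cnorm_conjugation j_conj) p1 p2 !mulr1.
    by rewrite dotZl dotZr (dot_conjr j_conj p.1) p3 !mulr0.
  rewrite /proj big_cons big_seq1 -/al -/be expr1n => h.
  by apply/eqP; lra.
(* This is [j (z zeta)], so antisymmetry yields [z zeta' = - j zeta]. Together [zeta] and [zeta']
   are an orthonormal basis of the plane of [p.1] and [j p.2], on which [z] is now known. *)
pose zeta' := al^* *: j p.2 - be^* *: p.1.
have jzeta' : j zeta' = z zeta.
  rewrite zE alt_triE -/al -/be /zeta' (conjugationD j_conj) (conjugationN j_conj).
  by rewrite !(conjugationZ j_conj) !conjCK (conjugationK j_conj).
have zzeta' : z zeta' = - j zeta.
  apply: (dot_conj_inj j_conj) => b.
  rewrite symz jzeta' (norming_isometry b z_lin z1 zeta1 zz).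
  by rewrite rmorphN rmorph1 mulN1r dotNl (dot_conjugation j_conj) -dotC.
have p1E : p.1 = al^* *: zeta - be *: zeta'.
  rewrite /zeta' {1}zetaE.
  transitivity ((al * al^* + be * be^* ) *: p.1); first by rewrite abC scale1r.
  by lincomb R[i] H.
rewrite {1}p1E (lin_sub z_lin) !(lin_scale z_lin) zzeta' zE alt_triE -/al -/be.
rewrite {1}zetaE (conjugationD j_conj) !(conjugationZ j_conj) (conjugationK j_conj).
transitivity ((al * al^* + be * be^* ) *: p.2); last by rewrite abC scale1r.
by lincomb R[i] H.
Qed.

(** The norming vector itself serves: an alternating form vanishes on the diagonal, which is the
    orthogonality demanded by [alt_pair]. *)
Lemma alt_norming_pair x y zeta : sym_ops j (-1) x -> sym_ops j (-1) y ->
  op_bound x 1 -> op_bound y 1 -> cnorm zeta = 1 -> cnorm (x zeta) = 1 ->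
  x zeta = y zeta -> exists p, [/\ alt_pair p, x p.1 = p.2 & y p.1 = p.2].
Proof.
move=> [_ symx] _ _ _ z1 xz xyz; exists (zeta, x zeta); split => //; split => //=.
have := symx zeta zeta; rewrite rmorphN rmorph1 mulN1r => /eqP.
by rewrite -subr_eq0 opprK -mulr2n -mulr_natl mulf_eq0 pnatr_eq0/= => /eqP.
Qed.

(** Each term is a wedge of two vectors; one orthogonalisation step and two normalisations turn it
    into a real multiple of a single [alt_tri], or into 0. *)
Lemma alt_ops_dense p v (e : R) : alt_pair p -> sym_ops j (-1) v -> tker p v -> 0 < e ->
  exists2 h, lspan (tri_dir alt_pair alt_tri p) h & op_bound (v - h) e.
Proof.
move=> Pp vA vp e0.
have s1 : (-1) * (-1) = 1 :> R by rewrite mulrNN mulr1.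
apply: (sym_op_dense j_conj s1 vA vp e0) => q q1 q2 q3 q4.
have termE a : sym_term j (-1) q a =
    (2^-1)%:C *: (inner H a q.1 *: q.2 - inner H a (j q.2) *: j q.1).
  by rewrite sym_termE rmorphN rmorph1 scaleN1r.
have zero : (forall a, sym_term j (-1) q a = 0) ->
    lspan (tri_dir alt_pair alt_tri p) (sym_term j (-1) q).
  move=> h; rewrite (_ : sym_term j (-1) q = 0); first exact: lspan0.
  exact/funext.
have [q10|u0] := eqVneq q.1 0.
  apply: zero => a; rewrite termE q10 (conjugation0 j_conj) dot0r scale0r scaler0.
  by rewrite subr0 scaler0.
have [u u1 uE] := exists_unit u0.
have nq : cnorm q.1 != 0 by apply: contra u0 => /eqP/cnorm_eq0 ->.
have nqC : (cnorm q.1)%:C != 0 :> R[i] by rewrite (inj_eq (@complexI R) _ 0).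
(* Removing the component of [q.2] along [j u] does not change the wedge. *)
pose w := q.2 - inner H q.2 (j u) *: j u.
have wedge a : inner H a q.1 *: q.2 - inner H a (j q.2) *: j q.1
    = (cnorm q.1)%:C *: (inner H a u *: w - inner H a (j w) *: j u).
  rewrite {1 2}uE /w !(conjugationD j_conj) !(conjugationN j_conj)
      !(conjugationZ j_conj).
  rewrite (conjugationK j_conj) !dotE conj_real conjCK.
  by lincomb R[i] H; ring.
have pu : inner H p.1 u = 0.
  by move: q1; rewrite {1}uE dotZr conj_real => /eqP; rewrite mulf_eq0 (negPf
      nqC)/= => /eqP.
have jpu : inner H (j p.2) u = 0.
  by move: q3; rewrite {1}uE dotZr conj_real => /eqP; rewrite mulf_eq0 (negPf
      nqC)/= => /eqP.
have [w0|w0] := eqVneq w 0.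
  apply: zero => a; rewrite termE wedge w0 (conjugation0 j_conj) dot0r scale0r scaler0.
  by rewrite subr0 !scaler0.
have [t t1 wE] := exists_unit w0.
have nw : cnorm w != 0 by apply: contra w0 => /eqP/cnorm_eq0 ->.
have nwC : (cnorm w)%:C != 0 :> R[i] by rewrite (inj_eq (@complexI R) _ 0).
have dot_t b : inner H w b = 0 -> inner H t b = 0.
  by rewrite {1}wE dotZl => /eqP; rewrite mulf_eq0 (negPf nwC)/= => /eqP.
have tju : inner H t (j u) = 0.
  apply: dot_t; rewrite /w dotDl dotNl dotZl dotxx (cnorm_conjugation j_conj) u1.
  by rewrite expr1n mulr1 subrr.
have jup2 : inner H (j u) p.2 = 0.
  by rewrite -[p.2](conjugationK j_conj) (dot_conjugation j_conj) -dotC.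
have jujp1 : inner H (j u) (j p.1) = 0 by rewrite (dot_conjugation j_conj) -dotC pu.
have tp2 : inner H t p.2 = 0.
  by apply: dot_t; rewrite /w dotDl dotNl dotZl q2 jup2 mulr0 subrr.
have tjp1 : inner H t (j p.1) = 0.
  by apply: dot_t; rewrite /w dotDl dotNl dotZl q4 jujp1 mulr0 subrr.
rewrite (_ : sym_term j (-1) q = 0 + (2^-1 * (cnorm q.1 * cnorm w)) *:
    (rank_sum (alt_tri (u, t)) : realified (H -> H))).
  apply: lspan_add; first exact: lspan0.
  exists (u, t); split => //; split=> [|a]; rewrite alt_triE/=.
    by rewrite pu (dot_conjr j_conj) tjp1 !scale0r subrr.
  by rewrite dotDl dotNl !dotZl tp2 jup2 !mulr0 subrr.
apply/funext => a; rewrite termE wedge.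
rewrite -[RHS]/(0 + (_)%:C *: rank_sum (alt_tri (u, t)) a) add0r alt_triE/=.
rewrite {1 2}wE (conjugationZ j_conj) !dotZr !conj_real !rmorphM.
lincomb R[i] H; ring.
Qed.

End AntisymmetricCase.

Theorem corollary3p8 (R : realType) (K : jbstar_triple R)
    (Y : completeNormedModType R) (Delta : K -> Y) (C : set K)
    (K_elementary : elementary K)
    (Delta_sphere : set_fun (unit_sphere K) (unit_sphere Y) Delta)
    (Delta_surj : set_surj (unit_sphere K) (unit_sphere Y) Delta)
    (Delta_isometry : forall x y, unit_sphere K x -> unit_sphere K y ->
       `|Delta x - Delta y| = cnorm (x - y))
    (C_sphere : C `<=` unit_sphere K)
    (C_nonempty : C !=set0)
    (C_convex : forall x y (t : R), C x -> C y -> 0 <= t <= 1 ->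
       C (t%:C *: x + (1 - t)%:C *: y)) :
  forall x y (t : R), C x -> C y -> 0 <= t <= 1 ->
    Delta (t%:C *: x + (1 - t)%:C *: y) = t *: Delta x + (1 - t) *: Delta y.
Proof.
move=> x y t Cx Cy tP.
have sC : sphere_convex (@cnorm R K : realified K -> R) C.
  by split=> [z /C_sphere/cnorm_eq1//|]; exact: C_convex.
case: K_elementary => [H1 H2|H j j_conj|H j j_conj|H j _ j_conj|N p _ _|N _].
- move=> [Phi [Phi_bij Phi_norm _]].
  apply: (operator_affine Delta_sphere Delta_surj Delta_isometry Phi_bij Phi_norm
    (P := [set p | cnorm p.1 = 1 /\ cnorm p.2 = 1]) (tri := fun p => [:: p])
    _ _ _ _ _ _ _ _ _ _ sC Cx Cy tP) => //.
  + by move=> p _; exact: compact_op_rank1.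
  + by move=> p [p1 _]; rewrite rank_sum1 dotxx p1 expr1n scale1r.
  + by move=> p [p1 p2]; exact: rank1_bound.
  + by move=> p w _ _ wp q; rewrite inE => /eqP ->.
  + by move=> p z [p1 _] [z_lin _]; exact: rank1_sub.
  + by move=> p z zeta [p1 p2] [z_lin _] _; exact: rank1_common.
  + by move=> u v zeta _ _ _ _ z1 uz uv; exists (zeta, u zeta).
  + by move=> p v e _ cv vp e0; exact: compact_op_dense.
- move=> [Phi [Phi_bij Phi_norm _]].
  have AE : [set u | compact_op u /\ op_transpose j u = - u] = sym_ops j (-1).
    by apply/seteqP; split=> u [cu uE]; split=> //; move: uE;
      rewrite -op_transposeP// ?rmorphN ?rmorph1 ?scaleN1r// mulrNN mulr1.
  rewrite AE in Phi_bij.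
  apply: (operator_affine Delta_sphere Delta_surj Delta_isometry Phi_bij Phi_norm
    (P := alt_pair j) (tri := alt_tri j) _ _ _ _ _ _ _ _ _ _ sC Cx Cy tP).
  + by move=> u [].
  + by move=> p [].
  + by move=> p _; exact: alt_tri_mem.
  + by move=> p; exact: alt_tri_val.
  + by move=> p; exact: alt_tri_bound.
  + by move=> p w _; exact: alt_tri_ker.
  + by move=> p z; exact: alt_tri_sub.
  + by move=> p z zeta; exact: alt_tri_common.
  + by move=> u v zeta; exact: alt_norming_pair.
  + by move=> p v e; exact: alt_ops_dense.
- move=> [Phi [Phi_bij Phi_norm _]].
  have AE : [set u | compact_op u /\ op_transpose j u = u] = sym_ops j 1.
    by apply/seteqP; split=> u [cu uE]; split=> //; move: uE;
      rewrite -op_transposeP// ?rmorph1 ?scale1r// mulr1.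
  rewrite AE in Phi_bij.
  have unit2 (p : H * H) : sym_pair j p -> cnorm p.1 = 1 /\ cnorm p.2 = 1.
    by move=> [p1 ->]; rewrite (cnorm_conjugation j_conj).
  apply: (operator_affine Delta_sphere Delta_surj Delta_isometry Phi_bij Phi_norm
    (P := sym_pair j) (tri := fun p => [:: p]) _ _ _ _ _ _ _ _ _ _ sC Cx Cy tP).
  + by move=> u [].
  + exact: unit2.
  + move=> [u v] [/= _ ->]; split; [exact: compact_op_rank1|exact: sym_op_rank1].
  + by move=> p [p1 _]; rewrite rank_sum1 dotxx p1 expr1n scale1r.
  + by move=> p /unit2[p1 p2]; exact: rank1_bound.
  + by move=> p w _ _ wp q; rewrite inE => /eqP ->.
  + by move=> p z [p1 _] [[z_lin _] _]; exact: rank1_sub.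
  + by move=> p z zeta /unit2[p1 p2] [[z_lin _] _] _; exact: rank1_common.
  + by move=> u v zeta; exact: sym_norming_pair.
  + by move=> p v e; exact: sym_ops_dense.
- move=> K_real.
  exact: (spin_affine Delta_sphere Delta_surj Delta_isometry j_conj K_real sC Cx Cy tP).
- move=> K_real.
  exact: (coct_mx_affine Delta_sphere Delta_surj Delta_isometry K_real sC Cx Cy tP).
- move=> K_real.
  exact: (coct_mx_affine Delta_sphere Delta_surj Delta_isometry K_real sC Cx Cy tP).
Qed.
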